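(* Let $\gamma>0$, $p_0\ge1$, $p_0<p_1,p_2<\infty$ and $\frac1p=\frac1{p_1}+\frac1{p_2}$. Let $\mathcal{S}$ be a sparse collection of cubes in a dyadic grid of $\mathbb{R}^n$. Let $w,\sigma_1,\sigma_2$ be weights with $[w,\vec\sigma]_{A_{\vec P/p_0}}<\infty$ and $w,\sigma_1,\sigma_2\in A_\infty$. If $\gamma\ge p_0$, then $$\big\|\mathcal{A}_{p_0,\gamma,\mathcal{S}}(\cdot\,\sigma_1,\cdot\,\sigma_2)\big\|_{L^{p_1}(\sigma_1)\times L^{p_2}(\sigma_2)\to L^p(w)}\lesssim[w,\vec\sigma]_{A_{\vec P/p_0}}^{\frac1p}\Big(\prod_{i=1}^2[\sigma_i]_{A_\infty}^{\frac1{p_i}}+[w]_{A_\infty}^{(\frac1\gamma-\frac1p)_+}\sum_{j=1}^2\prod_{i\ne j}[\sigma_i]_{A_\infty}^{\frac1{p_i}}\Big),$$ where $(\frac1\gamma-\frac1p)_+=\max\{\frac1\gamma-\frac1p,0\}$ and the implicit constant does not depend on the weights. If $\gamma<p_0$, the same estimate still holds for all $p>\gamma$.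
   Context: A weight is a locally integrable function on $\mathbb{R}^n$ with values in $(0,\infty)$ a.e.; $\langle f\rangle_Q=\frac1{|Q|}\int_Qf$, $w(Q)=\int_Qw$; ''cube'' means cube with sides parallel to the axes. Sparse: $\mathcal{S}$ (contained in a dyadic grid) is sparse if there is $\delta\in(0,1)$ with $\sum_{S'\in \mathrm{ch}_{\mathcal{S}}(S)}|S'|\le\delta|S|$ for all $S\in\mathcal{S}$, where $\mathrm{ch}_{\mathcal{S}}(S)$ is the set of maximal $S'\in\mathcal{S}$ with $S'\subsetneq S$. Operator: $\mathcal{A}_{p_0,\gamma,\mathcal{S}}(f_1,f_2)(x)=\Big(\sum_{Q\in\mathcal{S}}\big[\langle f_1\rangle_{Q,p_0}\langle f_2\rangle_{Q,p_0}\big]^\gamma\mathbf{1}_Q(x)\Big)^{1/\gamma}$ with $\langle f\rangle_{Q,p_0}=\big(\frac1{|Q|}\int_Q|f|^{p_0}\big)^{1/p_0}$. The norm $\|\mathcal{A}_{p_0,\gamma,\mathcal{S}}(\cdot\,\sigma_1,\cdot\,\sigma_2)\|_{L^{p_1}(\sigma_1)\times L^{p_2}(\sigma_2)\to L^p(w)}$ is the least $C$ such that $\|\mathcal{A}_{p_0,\gamma,\mathcal{S}}(f_1\sigma_1,f_2\sigma_2)\|_{L^p(w)}\le C\|f_1\|_{L^{p_1}(\sigma_1)}\|f_2\|_{L^{p_2}(\sigma_2)}$ for all $f_1,f_2$. Weight constants: $\vec P/p_0=(p_1/p_0,p_2/p_0)$ and $[w,\vec\sigma]_{A_{\vec P/p_0}}=\sup_Q\langle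 w\rangle_Q\prod_{i=1}^2\langle\sigma_i\rangle_Q^{\frac{p/p_0}{(p_i/p_0)'}}$, supremum over all cubes, where $s'$ is the conjugate exponent of $s$. The (Fujii–Wilson) constant is $[w]_{A_\infty}=\sup_Q\frac1{w(Q)}\int_QM(w\mathbf{1}_Q)\,dx$ with $M$ the Hardy–Littlewood maximal operator, and $w\in A_\infty$ means $[w]_{A_\infty}<\infty$.
   Formalization: The operator is applied to f_i σ_i^{1/p_0} instead of f_i σ_i (the same for p_0=1), because for every p_0>1 the estimate as written fails under scaling σ_1 → λσ_1. *)

(* Defs.v *)
From HB Require Import structures.
From mathcomp Require Import all_boot all_order all_algebra.
From mathcomp Require Import all_classical all_reals all_analysis.
Set Implicit Arguments.
Unset Strict Implicit.
Unset Printing Implicit Defensive.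
Import Order.TTheory GRing.Theory Num.Theory.
Import numFieldNormedType.Exports.
Local Open Scope classical_set_scope.
Local Open Scope ring_scope.
Local Open Scope ereal_scope.

Notation Rn R n := (n.-tuple (measurableTypeR R)).

Section LebesgueRn.
Context {R : realType}.

Definition tcons n (x : measurableTypeR R * Rn R n) : Rn R n.+1 :=
  [the n.+1.-tuple _ of x.1 :: x.2].

Lemma measurable_tcons n : measurable_fun [set: _] (@tcons n).
Proof. exact: (@measurable_cons _ _ _ _ fst n snd measurable_fst measurable_snd). Qed.

Section step.
Variables (n : nat) (m : {sigma_finite_measure set (Rn R n) -> \bar R}).

Definition leb_step : set (Rn R n.+1) -> \bar R :=
  pushforward (@lebesgue_measure R \x m) (@tcons n).

Let leb_step0 : leb_step set0 = 0.
Proof. by rewrite /leb_step /pushforward preimage_set0 measure0. Qed.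

Let leb_step_ge0 A : 0 <= leb_step A.
Proof. by rewrite /leb_step /pushforward; exact: measure_ge0. Qed.

Let leb_step_sigma_additive : semi_sigma_additive leb_step.
Proof.
rewrite /leb_step => F mF tF mUF; rewrite /pushforward preimage_bigcup.
have mp i : measurable (@tcons n @^-1` F i).
  by rewrite -[X in measurable X]setTI; apply: measurable_tcons.
apply: measure_semi_sigma_additive => //.
- apply/trivIsetP => /= i j _ _ ij; rewrite -preimage_setI.
  by move/trivIsetP : tF => /(_ _ _ _ _ ij) ->//; rewrite preimage_set0.
- exact: bigcup_measurable.
Qed.

HB.instance Definition _ := isMeasure.Build _ _ _ leb_step
  leb_step0 leb_step_ge0 leb_step_sigma_additive.

Lemma leb_stepE (A : set (measurableTypeR R)) (B : set (Rn R n)) :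
  measurable A -> measurable B ->
  leb_step [set x : Rn R n.+1 | A (thead x) /\ B [tuple of behead x]] =
    lebesgue_measure A * m B.
Proof.
move=> mA mB; rewrite -product_measure1E// /leb_step /pushforward.
congr product_measure1; apply/seteqP; split => -[x y] /=;
  by rewrite theadE (_ : [tuple of _] = y)//; exact/val_inj.
Qed.

Let leb_step_sigma_finite : sigma_finite setT leb_step.
Proof.
have /sigma_finiteP[F [TF ndF Foo]] := sigma_finiteT (@lebesgue_measure R).
have /sigma_finiteP[G [TG ndG Goo]] := sigma_finiteT m.
exists (fun k => [set x : Rn R n.+1 | F k (thead x) /\ G k [tuple of behead x]]).
  apply/seteqP; split => // x _.
  have [k _ Fx] : (\bigcup_i F i) (thead x) by rewrite -TF.
  have [l _ Gx] : (\bigcup_i G i) [tuple of behead x] by rewrite -TG.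
  exists (maxn k l) => //; split.
  - by move: Fx; exact/subsetPset/ndF/leq_maxl.
  - by move: Gx; exact/subsetPset/ndG/leq_maxr.
move=> k; have [mF Fk] := Foo k; have [mG Gk] := Goo k; split.
  apply: measurableI; rewrite -[X in measurable X]setTI.
  - exact: (@measurable_tnth _ _ _ ord0).
  - exact: measurable_behead.
by rewrite leb_stepE// lte_mul_pinfty// ge0_fin_numE.
Qed.

HB.instance Definition _ := @Measure_isSigmaFinite.Build _ _ _ leb_step
  leb_step_sigma_finite.

End step.

(* Lebesgue measure on R^n, R^(n+1) carrying the image of the product
   measure on R * R^n under (t, x) |-> t :: x *)
Fixpoint leb n : {sigma_finite_measure set (Rn R n) -> \bar R} :=
  if n is k.+1 then leb_step (leb k)
  else @dirac _ (Rn R 0) [tuple] R.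

(* half-open cubes: those are the cubes of a dyadic grid, and averages do not see
   the boundary *)
Definition cube n (a : Rn R n) (l : R) : set (Rn R n) :=
  [set x | forall i : 'I_n,
     ((tnth a i : R) <= (tnth x i : R) < (tnth a i : R) + l)%R].

Lemma measurable_cube n (a : Rn R n) (l : R) : measurable (cube a l).
Proof.
rewrite (_ : cube a l = \bigcap_(i in [set: 'I_n])
    ((fun x : Rn R n => tnth x i) @^-1` `[tnth a i : R, ((tnth a i : R) + l)%R[)).
  apply: fin_bigcap_measurable => // i _; rewrite -[X in measurable X]setTI.
  set I := [set` _]; have mI : measurable (I : set (measurableTypeR R)).
    exact: measurable_itv.
  exact: (@measurable_tnth _ (measurableTypeR R) n i measurableT _ mI).
by apply/seteqP; split => x h i; [move=> _|]; have := h i; rewrite /= in_itv/=;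
  apply.
Qed.

Lemma leb_cube n (a : Rn R n) (l : R) : (0 < l)%R -> leb n (cube a l) = (l ^+ n)%:E.
Proof.
move=> l0; elim: n a => [|n IH] a.
  by rewrite /= diracE mem_set// => -[].
rewrite [LHS](_ : _ = leb_step (leb n)
    [set x : Rn R n.+1 | `[thead a : R, ((thead a : R) + l)%R[%classic (thead x) /\
                          cube [tuple of behead a] l [tuple of behead x]]).
  set I := `[_, _[%classic; have mI : measurable (I : set (measurableTypeR R)).
    exact: measurable_itv.
  rewrite leb_stepE//; last exact: measurable_cube.
  have -> : lebesgue_measure I = l%:E.
    by rewrite /I lebesgue_measure_itv/= lte_fin ltrDl l0 -EFinD addrC addKr.
  by rewrite [X in _ * X = _]IH exprS EFinM.
have tE (y : Rn R n.+1) j : tnth [tuple of behead y] j = tnth y (lift ord0 j).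
  by case/tupleP: y => u t; rewrite tnthS; congr tnth; exact/val_inj.
congr leb_step; apply/seteqP; split => x /=.
  move=> h; split; first by rewrite in_itv/=; exact: (h ord0).
  by move=> i; rewrite !tE; exact: h.
rewrite in_itv/= => -[h0 h] i.
have [j ->|->] := unliftP ord0 i; last exact: h0.
by have := h j; rewrite !tE.
Qed.

End LebesgueRn.

Section Operators.
Context {R : realType} {n : nat}.
Local Notation E := (Rn R n).
Local Notation mu := (leb n).
Implicit Types (f w sigma : E -> R) (Q : set E) (S D : set (set E)).

Definition is_cube Q := exists2 l : R, (0 < l)%R & exists a : E, Q = cube a l.

Definition avg (f : E -> \bar R) Q : \bar R := (mu Q)^-1 * \int[mu]_(x in Q) f x.

Definition pavg (q : R) f Q : \bar R :=
  avg (fun x => (`|f x| `^ q)%:E) Q `^ q^-1.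

(* general dyadic grid: sides in 2^Z, nestedness, and for each k the cubes of
   side 2^k partition R^n *)
Definition dyadic_grid D :=
  [/\ forall Q, D Q -> exists k : int, exists a : E, Q = cube a (2 ^ k)%R,
      forall P Q, D P -> D Q -> [\/ P `&` Q = P, P `&` Q = Q | P `&` Q = set0] &
      forall (k : int) (x : E), exists! Q,
        [/\ D Q, exists a : E, Q = cube a (2 ^ k)%R & Q x]].

Definition children S Q : set (set E) :=
  [set Q' | [/\ S Q', Q' `<` Q &
     forall Q'', S Q'' -> Q'' `<` Q -> Q' `<=` Q'' -> Q'' = Q']].

Definition sparse (delta : R) S :=
  (0 < delta < 1)%R /\
  forall Q, S Q -> \esum_(Q' in children S Q) mu Q' <= delta%:E * mu Q.

Definition sparse_op (p0 gamma : R) S (f1 f2 : E -> R) (x : E) : \bar R :=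
  (\esum_(Q in S)
      ((pavg p0 f1 Q * pavg p0 f2 Q) `^ gamma * (\1_Q x : R)%:E)) `^ gamma^-1.

Definition weight w :=
  [/\ measurable_fun [set: E] w,
      forall Q, is_cube Q -> mu.-integrable Q (EFin \o w) &
      {ae mu, forall x, (0 < w x)%R}].

(* ||f||_(L^q(w)); q may be smaller than 1 *)
Definition wnorm (q : R) w (f : E -> \bar R) : \bar R :=
  (\int[mu]_x (`|f x| `^ q * (w x)%:E)) `^ q^-1.

(* The pairing of A_(p0, gamma, S) with the weights: f sigma stands for the measure
   f dsigma, so that its p0-average over Q is (|Q|^-1 \int_Q |f|^p0 dsigma)^(1/p0),
   i.e. A is applied to f sigma^(1/p0), which is f sigma for p0 = 1. The product
   of functions f sigma would give for p0 > 1 an operator norm homogeneous of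
   degree 1 - 1/p1 in sigma1, against 1/p0 - 1/p1 for
   [w, sigma]_(A_(P/p0))^(1/p). *)
Definition two_weight_op (p0 gamma : R) S sigma1 sigma2 f1 f2 : E -> \bar R :=
  sparse_op p0 gamma S (fun x => f1 x * sigma1 x `^ p0^-1)%R
                       (fun x => f2 x * sigma2 x `^ p0^-1)%R.

(* the norm L^p1(sigma1) * L^p2(sigma2) -> L^p(w) of a two-variable operator;
   +oo when the operator is unbounded *)
Definition opnorm (p1 p2 p : R) sigma1 sigma2 w
    (T : (E -> R) -> (E -> R) -> E -> \bar R) : \bar R :=
  ereal_inf [set C%:E | C in [set C : R | (0 <= C)%R /\
    forall f1 f2, measurable_fun [set: E] f1 -> measurable_fun [set: E] f2 ->
      wnorm p1 sigma1 (EFin \o f1) < +oo -> wnorm p2 sigma2 (EFin \o f2) < +oo ->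
      wnorm p w (T f1 f2) <= C%:E *
        (wnorm p1 sigma1 (EFin \o f1) * wnorm p2 sigma2 (EFin \o f2))]].

(* [w, (sigma1, sigma2)]_(A_(q1, q2)) with 1/q = 1/q1 + 1/q2 *)
Definition A_const (q1 q2 q : R) w sigma1 sigma2 : \bar R :=
  ereal_sup [set avg (EFin \o w) Q
      * (avg (EFin \o sigma1) Q `^ (q / fine (hoelder_conjugate q1%:E))
         * avg (EFin \o sigma2) Q `^ (q / fine (hoelder_conjugate q2%:E)))
    | Q in is_cube].

Definition maximal f (x : E) : \bar R :=
  ereal_sup [set avg (fun y => `|f y|%:E) Q | Q in [set Q | is_cube Q /\ Q x]].

Definition Ainfty_const w : \bar R :=
  ereal_sup [set (\int[mu]_(x in Q) (w x)%:E)^-1 *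
                 \int[mu]_(x in Q) maximal (fun y => w y * \1_Q y)%R x
    | Q in is_cube].

End Operators.

(* Main.v *)
(* For g_i = |f_i|^p0, q_i = p_i / p0, q = p / p0 and r = gamma / p0, the claim is the
   p0-th root of an estimate for the L^q(w)-quasinorm of T^(1/r), where T is the sum over
   Q in S of (u_Q v_Q)^r 1_Q and u_Q, v_Q are the means over Q of g_1 sigma1, g_2 sigma2.
   Since S is countable, finite subfamilies suffice.

   If q <= r, then T^(q/r) is at most the sum of (u_Q v_Q)^q 1_Q; the A_P condition and
   Hoelder's inequality reduce the integral to two Carleson embeddings, where the Carleson
   constants of sigma1, sigma2 are controlled by their A_infty constants.

   If q > r, write the integral of T^(q/r) w as the sum of (u_Q v_Q)^r h_Q w(Q) with
   h = T^(q/r - 1) and h_Q its w-mean. Split the cubes according to the size of the A_P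
   product. On one level, the sequence sigma1^a1 sigma2^a2 w^a3, with
   a = (r/q1, r/q2, 1 - r/q), is a Carleson sequence by Kolmogorov's inequality, with an
   absolute constant. Summation by parts along the inclusion order then leaves the
   increments of a product of three maximal functions. Each increment falls on one factor,
   to which Doob's inequality applies without loss, while the other two cost their
   A_infty constants; this gives the three terms of the bound. Finally the power of the
   integral arising from h is absorbed. *)
Require Import Defs.
From mathcomp Require Import all_boot all_order all_algebra.
From mathcomp Require Import all_classical all_reals all_analysis.
From mathcomp Require Import measurable_realfun zify ring lra.
Set Implicit Arguments.
Unset Strict Implicit.
Unset Printing Implicit Defensive.
Import Order.TTheory GRing.Theory Num.Theory.
Import numFieldNormedType.Exports.
Local Open Scope classical_set_scope.
Local Open Scope ring_scope.

(** Every maximal function of the argument is a maximum over those members of a finite laminar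
    family that contain a given cube or point. The increments of a power of such a maximum telescope
    along chains, so the estimates of Carleson, Doob and Kolmogorov become finite sums with explicit
    constants, and no stopping cubes are selected.

    For q > r, Hölder's inequality applied at once to the three maximal functions would cost all
    three A_infty constants. One summation by parts against the mixed sequence spares, in each term,
    the constant of the factor that bears the increment. The restriction to levels costs no
    logarithm: the summand contains the A_P product to the power r/q, so the k-th level carries a
    factor 2^-k.

    Absorption rests on finiteness. The exponent conjugate to q/r satisfies h^((q/r)') = T^(q/r), so
    Doob's inequality for h gives back the integral I itself, to the power a3 < 1. For a finite
    family I is a real number and I^a3 can be cancelled. What remains is I^(r/q), and the power 1/r
    turns a into (1/q1, 1/q2, 1/r - 1/q), the exponents of the theorem up to the p0-th root. *)

Section RealInequalities.
Context {R : realType}.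
Implicit Types a b c x y z : R.

Lemma mulrACA3 (x1 x2 x3 y1 y2 y3 : R) :
  x1 * y1 * (x2 * y2) * (x3 * y3) = x1 * x2 * x3 * (y1 * y2 * y3).
Proof. ring. Qed.

Lemma mulr_regroup3 (x1 x2 x3 y1 y2 y3 u1 u2 u3 w1 w2 w3 : R) :
  w1 * w2 * w3 = u1 * u2 * u3 ->
  x1 * y1 * w1 * (x2 * y2 * w2) * (x3 * y3 * w3) =
  y1 * y2 * y3 * (x1 * u1 * (x2 * u2) * (x3 * u3)).
Proof.
move=> wu; transitivity (x1 * x2 * x3 * (y1 * y2 * y3) * (w1 * w2 * w3)); first ring.
by rewrite wu; ring.
Qed.

Lemma ler_pM3 (x1 x2 x3 y1 y2 y3 : R) : 0 <= x1 <= y1 -> 0 <= x2 <= y2 ->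
  0 <= x3 <= y3 -> x1 * x2 * x3 <= y1 * y2 * y3.
Proof.
move=> /andP[x10 xy1] /andP[x20 xy2] /andP[x30 xy3].
by rewrite ler_pM ?mulr_ge0// ler_pM.
Qed.

Lemma prod3_increment_le (x1 x2 x3 y1 y2 y3 : R) : 0 <= x1 <= y1 -> 0 <= x2 <= y2 ->
  0 <= x3 <= y3 -> y1 * y2 * y3 - x1 * x2 * x3 <=
  (y1 - x1) * y2 * y3 + (y2 - x2) * y1 * y3 + (y3 - x3) * y1 * y2.
Proof.
move=> /andP[x10 xy1] /andP[x20 xy2] /andP[x30 xy3]; rewrite -subr_ge0.
rewrite [leRHS](_ : _ = (y2 - x2) * y3 * (y1 - x1) +
  (y3 - x3) * ((y1 - x1) * y2 + x1 * (y2 - x2))); last ring.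
have y10 := le_trans x10 xy1; have y20 := le_trans x20 xy2.
have y30 := le_trans x30 xy3.
rewrite -subr_ge0 in xy1; rewrite -subr_ge0 in xy2; rewrite -subr_ge0 in xy3.
apply: addr_ge0; rewrite !mulr_ge0//.
by apply: addr_ge0; rewrite mulr_ge0.
Qed.

(** This is [ln x <= x - 1], exponentiated so that x = 0 is allowed. *)
Lemma powR_le_expR a x : 0 <= a -> 0 <= x -> x `^ a <= expR (a * (x - 1)).
Proof.
move=> a0; rewrite le_eqVlt => /predU1P[<-|x0].
  rewrite /powR eqxx; case: eqP => [->|_]; first by rewrite mul0r expR0.
  exact: expR_ge0.
rewrite /powR gt_eqF// ler_expR ler_wpM2l//.
by have := @le_ln1Dx R (x - 1); rewrite addrCA subrr addr0; apply; lra.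
Qed.

(** After division by the arithmetic mean [A], the exponents produced by [powR_le_expR] add up to
    0. *)
Lemma weighted_am_gm3 a b c x y z : 0 <= a -> 0 <= b -> 0 <= c -> a + b + c = 1 ->
  0 <= x -> 0 <= y -> 0 <= z ->
  x `^ a * y `^ b * z `^ c <= a * x + b * y + c * z.
Proof.
move=> a0 b0 c0 abc x0 y0 z0.
have ax : 0 <= a * x by exact: mulr_ge0.
have bY : 0 <= b * y by exact: mulr_ge0.
have cz : 0 <= c * z by exact: mulr_ge0.
have [A0|A0] := ltP 0 (a * x + b * y + c * z); last first.
  have /eqP : a * x = 0 by lra.
  have /eqP : b * y = 0 by lra.
  have /eqP : c * z = 0 by lra.
  (* Since 0 to the power 0 is 1, a vanishing summand yields either a zero exponent or a zero
     factor; three zero exponents would contradict [abc]. *)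
  have zero (d u : R) : d * u == 0 -> d = 0 \/ u `^ d = 0.
    rewrite mulf_eq0 => /orP[/eqP|/eqP ->]; first by left.
    by have [->|d0] := eqVneq d 0; [left|right; rewrite powR0].
  move=> /zero[c0'|->] /zero[b0'|->] /zero[a0'|->];
    rewrite ?(mul0r, mulr0)//; try by rewrite !addr_ge0.
  by move: abc; rewrite a0' b0' c0' !addr0 => /esym/eqP; rewrite oner_eq0.
set A := _ + _ + _ in A0 *.
have AV : 0 <= A^-1 by rewrite invr_ge0 ltW.
have step : (x * A^-1) `^ a * (y * A^-1) `^ b * (z * A^-1) `^ c <= 1.
  apply: (@le_trans _ _ (expR (a * (x * A^-1 - 1)) * expR (b * (y * A^-1 - 1)) *
    expR (c * (z * A^-1 - 1)))).
    apply: ler_pM; rewrite ?mulr_ge0 ?powR_ge0 ?powR_le_expR ?mulr_ge0//.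
    by apply: ler_pM; rewrite ?powR_ge0 ?powR_le_expR ?mulr_ge0.
  rewrite -!expRD [X in expR X](_ : _ = A * A^-1 - (a + b + c)).
    by rewrite divff ?gt_eqF// abc subrr expR0.
  by rewrite /A; ring.
have AK u : u = u * A^-1 * A by rewrite mulfVK ?gt_eqF.
have -> : x `^ a * y `^ b * z `^ c =
    (x * A^-1) `^ a * (y * A^-1) `^ b * (z * A^-1) `^ c * A `^ (a + b + c).
  rewrite {1}(AK x) {1}(AK y) {1}(AK z).
  rewrite !(@powRM _ (_ * _) A) ?(ltW A0) ?mulr_ge0//.
  by rewrite 2?powRD ?(gt_eqF A0) ?implybT//; ring.
by rewrite abc powRr1 ?(ltW A0)// ler_piMl// ltW.
Qed.

Lemma weighted_am_gm2 b x y : 0 <= b <= 1 -> 0 <= x -> 0 <= y ->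
  x `^ b * y `^ (1 - b) <= b * x + (1 - b) * y.
Proof.
move=> /andP[b0 b1] x0 y0.
have := @weighted_am_gm3 b (1 - b) 0 x y 1 b0.
rewrite subr_ge0 powRr0 mulr1 mul0r !addr0 subrKC.
exact.
Qed.

(** Young's inequality for x y^(p-1), the source of the factor p / (p - 1) in Doob's inequality. The
    factor x is kept apart: at a jump of the maximal function it is the mean of g over the cube and
    turns the mass of W into that of g W. *)
Lemma powR_increment_le p x y : 1 < p -> 0 <= y <= x ->
  x `^ p - y `^ p <= p / (p - 1) * (x * (x `^ (p - 1) - y `^ (p - 1))).
Proof.
move=> p1 /andP[y0 yx]; have x0 := le_trans y0 yx.
have p0 : 0 < p by lra.
have h : x * y `^ (p - 1) <= p^-1 * x `^ p + (1 - p^-1) * y `^ p.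
  have := @weighted_am_gm2 p^-1 (x `^ p) (y `^ p).
  rewrite -!powRrM divff ?gt_eqF// powRr1// mulrBr mulr1 divff ?gt_eqF//.
  by apply; rewrite ?powR_ge0// invr_ge0 invf_le1// ltW//= ltW.
rewrite mulrBr mulr_powRB1//.
set u := x `^ p in h *; set v := y `^ p in h *; set w := x * _ in h *.
have {}h : p * w <= u + (p - 1) * v.
  rewrite (_ : u + _ = p * (p^-1 * u + (1 - p^-1) * v)) ?ler_pM2l//.
  by field; rewrite gt_eqF.
rewrite -subr_ge0 (_ : _ - _ = (u + (p - 1) * v - p * w) / (p - 1)); last first.
  by field; rewrite subr_eq0 gt_eqF.
by rewrite divr_ge0//; lra.
Qed.

(** The concave function t^b lies below its tangent at y. This is the counterpart of
    [powR_increment_le] below exponent 1; the power b - 1 is decreasing, hence the reversed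
    difference. *)
Lemma powR_increment_le_neg b x y : 0 < b < 1 -> 0 < y <= x ->
  x `^ b - y `^ b <= b / (1 - b) * (x * (y `^ (b - 1) - x `^ (b - 1))).
Proof.
move=> /andP[b0 b1] /andP[y0 yx]; have x0 := lt_le_trans y0 yx.
have h : x `^ b <= b * (x * y `^ (b - 1)) + (1 - b) * y `^ b.
  have := @weighted_am_gm2 b (x * y `^ (b - 1)) (y `^ b).
  rewrite powRM ?powR_ge0 ?(ltW x0)// -!powRrM -mulrA -powRD ?(gt_eqF y0) ?implybT//.
  rewrite (_ : (b - 1) * b + b * (1 - b) = 0); last by ring.
  by rewrite powRr0 mulr1; apply; rewrite ?mulr_ge0 ?powR_ge0 ?ltW ?b0 ?b1.
rewrite mulrBr mulr_powRB1 ?(ltW x0)//.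
set u := x `^ b in h *; set v := y `^ b in h *; set w := x * _ in h *.
rewrite -subr_ge0.
rewrite (_ : _ - _ = (b * (w - u) - (u - v) * (1 - b)) / (1 - b)); last first.
  by field; rewrite subr_eq0 gt_eqF.
by rewrite divr_ge0//; lra.
Qed.

(** Superadditivity of t^k; it later bounds an increment of [maxval ^ d] by a power of an increment
    of [maxval ^ (d / a)]. *)
Lemma powR_subr_le k x y : 1 <= k -> 0 <= y <= x ->
  (x - y) `^ k <= x `^ k - y `^ k.
Proof.
move=> k1 /andP[y0 yx]; have x0 := le_trans y0 yx; have k0 : 0 < k by lra.
rewrite lerBrDr -(mulr_powRB1 x0 k0) -(mulr_powRB1 y0 k0).
rewrite -(@mulr_powRB1 _ (x - y)) ?subr_ge0//.
rewrite -[X in _ <= X * _](subrK y x) [leRHS]mulrDl.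
by apply: lerD; rewrite ler_wpM2l ?subr_ge0// ge0_ler_powR ?nnegrE ?subr_ge0//; lra.
Qed.

Lemma powR_addr_le t x y : 0 < t <= 1 -> 0 <= x -> 0 <= y ->
  (x + y) `^ t <= x `^ t + y `^ t.
Proof.
move=> /andP[t0 t1] x0 y0.
have xt0 := powR_ge0 x t; have yt0 := powR_ge0 y t.
have powRK z : 0 <= z -> (z `^ t) `^ t^-1 = z.
  by move=> z0; rewrite -powRrM divff ?gt_eqF// powRr1.
have := @powR_subr_le t^-1 (x `^ t + y `^ t) (y `^ t).
rewrite invf_ge1// t1 yt0 lerDr xt0 => /(_ isT isT); rewrite addrK !powRK//.
rewrite lerBrDr => h.
have := @ge0_ler_powR _ t (ltW t0) (x + y) ((x `^ t + y `^ t) `^ t^-1).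
rewrite !nnegrE addr_ge0 ?powR_ge0//= => /(_ isT isT h).
by rewrite -powRrM mulVf ?gt_eqF// powRr1// addr_ge0.
Qed.

Lemma powR_sum_le (I : Type) (s : seq I) (P : pred I) (f : I -> R) t : 0 < t <= 1 ->
  (forall i, 0 <= f i) ->
  (\sum_(i <- s | P i) f i) `^ t <= \sum_(i <- s | P i) f i `^ t.
Proof.
move=> t01 f0; have [t0 _] := andP t01.
elim: s => [|i s IH]; first by rewrite !big_nil powR0// gt_eqF.
rewrite !big_cons; case: ifP => // _.
apply: (le_trans (powR_addr_le t01 (f0 i) (sumr_ge0 _ (fun j _ => f0 j)))).
by rewrite lerD2l.
Qed.

Section sums.
Context {I : eqType}.
Implicit Types (s : seq I) (P : pred I) (f g h : I -> R).

Let holder_pos s P f g h a b c X Y Z :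
  (forall i, 0 <= f i) -> (forall i, 0 <= g i) -> (forall i, 0 <= h i) ->
  0 <= a -> 0 <= b -> 0 <= c -> a + b + c = 1 -> 0 < X -> 0 < Y -> 0 < Z ->
  \sum_(i <- s | P i) f i <= X -> \sum_(i <- s | P i) g i <= Y ->
  \sum_(i <- s | P i) h i <= Z ->
  \sum_(i <- s | P i) f i `^ a * g i `^ b * h i `^ c <= X `^ a * Y `^ b * Z `^ c.
Proof.
move=> f0 g0 h0 a0 b0 c0 abc X0 Y0 Z0 fX gY hZ.
have XYZ : 0 < X `^ a * Y `^ b * Z `^ c by rewrite !mulr_gt0 ?powR_gt0.
rewrite -[leRHS]mul1r -ler_pdivrMr// mulr_suml.
apply: (@le_trans _ _ (\sum_(i <- s | P i)
    (a * (f i / X) + b * (g i / Y) + c * (h i / Z)))).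
  apply: ler_sum => i _.
  have fX0 : 0 <= f i / X by rewrite divr_ge0// ltW.
  have gY0 : 0 <= g i / Y by rewrite divr_ge0// ltW.
  have hZ0 : 0 <= h i / Z by rewrite divr_ge0// ltW.
  apply: le_trans (weighted_am_gm3 a0 b0 c0 abc fX0 gY0 hZ0).
  have E d (u U : R) : 0 <= u -> 0 < U -> u `^ d = (u / U) `^ d * U `^ d.
    by move=> u0 U0; rewrite -powRM ?divr_ge0 ?(ltW U0)// divfK ?gt_eqF.
  rewrite ler_pdivrMr// (E a _ X)// (E b _ Y)// (E c _ Z)//.
  rewrite le_eqVlt; apply/orP; left; apply/eqP; ring.
rewrite !big_split/= -!mulr_sumr -!mulr_suml.
by rewrite -abc; apply: lerD; first apply: lerD; rewrite ler_piMr// ler_pdivrMr// mul1r.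
Qed.

Let sum_powR_eq0 s P f (F : I -> R) : (forall i, 0 <= f i) ->
  (forall i, f i = 0 -> F i = 0) -> \sum_(i <- s | P i) f i = 0 ->
  \sum_(i <- s | P i) F i = 0.
Proof.
move=> f0 fF /eqP; rewrite psumr_eq0// => /allP h.
by apply: big1_seq => i /andP[Pi /h]; rewrite Pi => /eqP/fF.
Qed.

(** The weighted AM-GM inequality is applied to the terms divided by their total sums; if a total is
    0, every term on the left is 0. *)
Lemma holder_sum3 s P f g h a b c :
  (forall i, 0 <= f i) -> (forall i, 0 <= g i) -> (forall i, 0 <= h i) ->
  0 < a -> 0 < b -> 0 < c -> a + b + c = 1 ->
  \sum_(i <- s | P i) f i `^ a * g i `^ b * h i `^ c <=
  (\sum_(i <- s | P i) f i) `^ a * (\sum_(i <- s | P i) g i) `^ b *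
  (\sum_(i <- s | P i) h i) `^ c.
Proof.
move=> f0 g0 h0 a0 b0 c0 abc.
have pos (F : I -> R) : (forall i, 0 <= F i) -> \sum_(i <- s | P i) F i = 0 \/
    0 < \sum_(i <- s | P i) F i.
  move=> F0; have : 0 <= \sum_(i <- s | P i) F i by exact: sumr_ge0.
  by rewrite le_eqVlt => /predU1P[<-|]; [left|right].
have rhs0 : 0 <= (\sum_(i <- s | P i) f i) `^ a * (\sum_(i <- s | P i) g i) `^ b *
  (\sum_(i <- s | P i) h i) `^ c by rewrite !mulr_ge0 ?powR_ge0.
have [fe|fp] := pos f f0.
  rewrite (sum_powR_eq0 (F := fun i => f i `^ a * g i `^ b * h i `^ c) f0 _ fe)// => i ->.
  by rewrite powR0 ?gt_eqF// !mul0r.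
have [ge|gp] := pos g g0.
  rewrite (sum_powR_eq0 (F := fun i => f i `^ a * g i `^ b * h i `^ c) g0 _ ge)// => i ->.
  by rewrite powR0 ?gt_eqF// mulr0 mul0r.
have [he|hpos] := pos h h0.
  rewrite (sum_powR_eq0 (F := fun i => f i `^ a * g i `^ b * h i `^ c) h0 _ he)// => i ->.
  by rewrite powR0 ?gt_eqF// mulr0.
exact: (holder_pos f0 g0 h0 (ltW a0) (ltW b0) (ltW c0)).
Qed.

(** The three-factor inequality with [g] taken twice, each time with exponent (1 - b) / 2. *)
Lemma holder_sum2 s P f g b :
  (forall i, 0 <= f i) -> (forall i, 0 <= g i) -> 0 < b < 1 ->
  \sum_(i <- s | P i) f i `^ b * g i `^ (1 - b) <=
  (\sum_(i <- s | P i) f i) `^ b * (\sum_(i <- s | P i) g i) `^ (1 - b).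
Proof.
move=> f0 g0 /andP[b0 b1].
have c0 : 0 < (1 - b) / 2 by rewrite divr_gt0// subr_gt0.
have c1 : b + (1 - b) / 2 + (1 - b) / 2 = 1 by lra.
have := holder_sum3 s P f0 g0 g0 b0 c0 c0 c1.
have E (u : R) : 0 <= u -> u `^ ((1 - b) / 2) * u `^ ((1 - b) / 2) = u `^ (1 - b).
  by move=> u0; rewrite -powRD -?splitr// gt_eqF ?subr_gt0.
rewrite -mulrA E ?sumr_ge0// => /(le_trans _); apply.
by rewrite le_eqVlt; apply/orP; left; apply/eqP; apply: eq_bigr => i _; rewrite -mulrA E.
Qed.

End sums.
End RealInequalities.

(** * Summation by parts in laminar families *)

Section Laminar.
Context {X : Type}.
Implicit Types (s l : seq (set X)) (Q : set X) (P : pred (set X)).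

(** Members are nonempty so that all supersets of one member share a point and hence form a
    chain. *)
Definition laminar s := [/\ uniq s, forall Q, Q \in s -> Q !=set0 &
  forall Q Q', Q \in s -> Q' \in s -> Q `&` Q' !=set0 -> Q `<=` Q' \/ Q' `<=` Q].

Definition supersets s Q := [seq Q' <- s | `[< Q `<=` Q' >]].

Definition strict_supersets s Q := [seq Q' <- s | `[< Q `<=` Q' >] && (Q' != Q)].

Lemma laminar_filter P s : laminar s -> laminar (seq.filter P s).
Proof.
move=> [us s0 sI]; split; first exact: filter_uniq.
  by move=> Q; rewrite mem_filter => /andP[_]; exact: s0.
by move=> Q Q'; rewrite !mem_filter => /andP[_ Qs] /andP[_ Q's]; exact: sI.
Qed.

Lemma chain_min l : l != [::] ->
  (forall Q Q', Q \in l -> Q' \in l -> Q `<=` Q' \/ Q' `<=` Q) ->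
  exists2 m, m \in l & forall Q, Q \in l -> m `<=` Q.
Proof.
elim: l => // a l IH _ ch.
have [->|l0] := eqVneq l [::].
  by exists a; rewrite ?mem_seq1// => Q; rewrite mem_seq1 => /eqP ->.
have [|m ml mmin] := IH l0.
  by move=> Q Q' Ql Q'l; apply: ch; rewrite in_cons ?Ql ?Q'l orbT.
have mal : m \in a :: l by rewrite in_cons ml orbT.
have [ma|am] := ch _ _ mal (mem_head a l).
- exists m => // Q; rewrite in_cons => /predU1P[->//|]; exact: mmin.
- exists a; first exact: mem_head.
  by move=> Q; rewrite in_cons => /predU1P[->//|/mmin]; exact: subset_trans.
Qed.

(** Induction on the size of the chain selected by [P]. By upward closure the supersets of its
    smallest member [m] are the whole chain, so the summand of [m] is the change of [Phi] when [m]
    is removed. *)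
Lemma telescope_chain (V : zmodType) (Phi : seq (set X) -> V) s P : uniq s ->
  (forall Q Q', Q \in s -> Q' \in s -> P Q -> P Q' -> Q `<=` Q' \/ Q' `<=` Q) ->
  (forall Q Q', Q \in s -> Q' \in s -> P Q -> Q `<=` Q' -> P Q') ->
  \sum_(Q <- s | P Q) (Phi (supersets s Q) - Phi (strict_supersets s Q)) =
  Phi (seq.filter P s) - Phi [::].
Proof.
move=> us; have [n] := ubnP (count P s); elim: n P => // n IH P nP ch upc.
have [Ps0|Ps0] := eqVneq (seq.filter P s) [::].
  by rewrite -big_filter Ps0 big_nil subrr.
have [||m] := @chain_min (seq.filter P s) => //.
  by move=> Q Q'; rewrite !mem_filter => /andP[PQ Qs] /andP[PQ' Q's]; exact: ch.
rewrite mem_filter => /andP[Pm ms] mmin.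
have upm : supersets s m = seq.filter P s.
  apply: eq_in_filter => Q Qs; apply/asboolP/idP; first exact: (upc m).
  by move=> PQ; apply: mmin; rewrite mem_filter PQ.
pose P' Q := P Q && (Q != m).
have supE : strict_supersets s m = seq.filter (predC1 m) (supersets s m).
  by rewrite -filter_predI; apply: eq_filter => Q /=; rewrite andbC.
have supm : strict_supersets s m = seq.filter P' s.
  by rewrite supE upm -filter_predI; apply: eq_filter => Q /=; rewrite /P' andbC.
rewrite big_mkcond (bigD1_seq m)//= Pm upm supm -big_mkcondr/=.
under eq_bigl do rewrite andbC.
rewrite (IH P').
- by rewrite addrA subrK.
- rewrite -ltnS; apply: leq_trans nP; rewrite ltnS -!size_filter -supm supE upm.
  rewrite [X in (X < _)%N]size_filter ltn_neqAle count_size andbT -all_count.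
  by apply/allPn; exists m; rewrite ?mem_filter ?Pm//= negbK.
- by move=> Q Q' Qs Q's /andP[PQ _] /andP[PQ' _]; exact: ch.
- move=> Q Q' Qs Q's /andP[PQ Qm] QQ'; rewrite /P' (upc Q)//=.
  apply: contra Qm => /eqP Q'm; apply/eqP/seteqP; split.
    by rewrite -Q'm.
  by apply: mmin; rewrite mem_filter PQ.
Qed.

Section abel.
Context {R : realType} (Phi : seq (set X) -> R) (s : seq (set X)).
Hypothesis lam : laminar s.

Definition increment Q := Phi (supersets s Q) - Phi (strict_supersets s Q).

Lemma telescope_supersets Q : Q \in s ->
  \sum_(Q' <- s | `[< Q `<=` Q' >]) increment Q' = Phi (supersets s Q) - Phi [::].
Proof.
have [us s0 sI] := lam; move=> Qs; apply: telescope_chain => //.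
- move=> Q1 Q2 Q1s Q2s /asboolP QQ1 /asboolP QQ2; apply: sI => //.
  by have [x Qx] := s0 _ Qs; exists x; split; [exact: QQ1|exact: QQ2].
- by move=> Q1 Q2 _ _ /asboolP QQ1 Q12; apply/asboolP; exact: subset_trans Q12.
Qed.

Lemma telescope_point x :
  \sum_(Q <- s | x \in Q) increment Q = Phi [seq Q <- s | x \in Q] - Phi [::].
Proof.
have [us s0 sI] := lam; apply: telescope_chain => //.
- by move=> Q1 Q2 Q1s Q2s /set_mem Q1x /set_mem Q2x; apply: sI => //; exists x.
- by move=> Q1 Q2 _ _ /set_mem Q1x Q12; apply/mem_set; exact: Q12.
Qed.

(** Each difference on the left is the sum of the increments over the supersets of [Q]; the two sums
    are then exchanged. *)
Lemma abel_summation (c : set X -> R) :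
  \sum_(Q <- s) (Phi (supersets s Q) - Phi [::]) * c Q =
  \sum_(Q <- s) increment Q * \sum_(Q' <- s | `[< Q' `<=` Q >]) c Q'.
Proof.
under [RHS]eq_bigr do rewrite mulr_sumr.
under [RHS]eq_bigr do rewrite big_mkcond/=.
rewrite exchange_big/=; apply: eq_big_seq => Q Qs.
rewrite -telescope_supersets// mulr_suml [LHS]big_mkcond/=.
by apply: eq_bigr => Q' _; case: ifP.
Qed.

End abel.
End Laminar.

(** * Maximal averages *)

Section MaximalValue.
Context {X : Type} {R : realType}.
Implicit Types (s l : seq (set X)) (Q : set X) (v : set X -> R).

(** A function of lists, so that it fits into [increment]. On the supersets of a cube, or the
    members containing a point, it is the maximal function of the family; the default 0 is its value
    on the empty chain. *)
Definition maxval v l : R := \big[Num.max/0]_(Q <- l) v Q.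

Lemma maxval_nil v : maxval v [::] = 0.
Proof. exact: big_nil. Qed.

Lemma maxval_ge0 v l : 0 <= maxval v l.
Proof. exact: bigmax_ge_id. Qed.

Lemma maxval_ge v l Q : Q \in l -> v Q <= maxval v l.
Proof. by move=> Ql; exact: le_bigmax_seq. Qed.

Lemma maxval_le v l y : 0 <= y -> (forall Q, Q \in l -> v Q <= y) -> maxval v l <= y.
Proof.
move=> y0 vy; rewrite /maxval big_seq_cond; apply: bigmax_le => // Q.
by rewrite andbT; exact: vy.
Qed.

Lemma mem_supersets s Q : Q \in s -> Q \in supersets s Q.
Proof. by move=> Qs; rewrite mem_filter Qs andbT; apply/asboolP. Qed.

Lemma supersets_le v s Q : Q \in s -> v Q <= maxval v (supersets s Q).
Proof. by move=> Qs; apply: maxval_ge; exact: mem_supersets. Qed.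

Lemma maxval_strict_le v s Q :
  maxval v (strict_supersets s Q) <= maxval v (supersets s Q).
Proof.
apply: maxval_le => [|Q']; first exact: maxval_ge0.
by rewrite mem_filter => /andP[/andP[QQ' _] Q's]; apply: maxval_ge;
  rewrite mem_filter QQ'.
Qed.

Lemma maxval_supersetsE v s Q : Q \in s ->
  maxval v (supersets s Q) = Num.max (v Q) (maxval v (strict_supersets s Q)).
Proof.
move=> Qs; apply/eqP; rewrite eq_le ge_max supersets_le//= maxval_strict_le andbT.
apply: maxval_le => [|Q']; first by rewrite le_max maxval_ge0 orbT.
have [->|Q'Q] := eqVneq Q' Q; first by rewrite le_max lexx.
rewrite mem_filter => /andP[QQ' Q's]; rewrite le_max maxval_ge ?orbT//.
by rewrite mem_filter QQ' Q'Q.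
Qed.

(** The dichotomy behind all jump estimates: either the increment at [Q] vanishes, or [v Q] is the
    new record. *)
Lemma maxval_supersetsP v s Q : Q \in s ->
  maxval v (supersets s Q) = maxval v (strict_supersets s Q) \/
  maxval v (supersets s Q) = v Q /\ maxval v (strict_supersets s Q) <= v Q.
Proof.
move=> /maxval_supersetsE ->.
by case: (leP (v Q) (maxval v (strict_supersets s Q))); [left|right; rewrite ltW].
Qed.

Lemma powR_maxval_increment_ge0 v s a Q : 0 <= a ->
  0 <= increment (fun l => maxval v l `^ a) s Q.
Proof.
move=> a0; rewrite subr_ge0 ge0_ler_powR ?nnegrE ?maxval_ge0//.
exact: maxval_strict_le.
Qed.

(** Summation by parts puts the sum over the subsets of [Q] on [c], where the packing condition
    applies; the increments, being nonnegative, preserve the inequality. *)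
Lemma carleson_abel (Phi : seq (set X) -> R) s (b c : set X -> R) (L : R) :
  laminar s -> Phi [::] = 0 ->
  (forall Q, Q \in s -> 0 <= increment Phi s Q) ->
  (forall Q, Q \in s -> \sum_(Q' <- s | `[< Q' `<=` Q >]) c Q' <= L * b Q) ->
  \sum_(Q <- s) Phi (supersets s Q) * c Q <=
  L * \sum_(Q <- s) increment Phi s Q * b Q.
Proof.
move=> lam Phi0 inc0 cb.
under eq_bigr do rewrite -[X in X * _]subr0 -Phi0.
rewrite abel_summation// mulr_sumr big_seq [leRHS]big_seq.
apply: ler_sum => Q Qs; rewrite mulrCA.
by apply: ler_wpM2l; [exact: inc0|exact: cb].
Qed.

End MaximalValue.

(** * Sums over cubes as integrals *)

Section SumIntegral.
Context d (T : measurableType d) {R : realType}.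
Variable mu : {measure set T -> \bar R}.
Implicit Types (s : seq (set T)) (c : set T -> R).
Local Open Scope ereal_scope.

Lemma measurable_sum_mem s c : (forall Q, Q \in s -> measurable Q) ->
  measurable_fun [set: T] (fun x => \sum_(Q <- s | x \in Q) c Q)%R.
Proof.
elim: s => [|Q s IH] ms.
  by under eq_fun do rewrite big_nil; exact: measurable_cst.
have -> : (fun x => \sum_(Q' <- Q :: s | x \in Q') c Q')%R =
    (fun x => c Q * \1_Q x + \sum_(Q' <- s | x \in Q') c Q')%R.
  apply/funext => x; rewrite big_cons indicE.
  by case: ifP => _; rewrite ?mulr1// mulr0 add0r.
apply: measurable_funD; last by apply: IH => Q' Q's; apply: ms; rewrite in_cons Q's orbT.
apply: measurable_funM => //; apply: measurable_indic.
by apply: ms; rewrite mem_head.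
Qed.

Lemma sum_integral_mem s c (h : T -> \bar R) :
  (forall Q, Q \in s -> measurable Q) -> (forall Q, (0 <= c Q)%R) ->
  measurable_fun [set: T] h -> (forall x, 0 <= h x) ->
  \sum_(Q <- s) (c Q)%:E * \int[mu]_(x in Q) h x =
  \int[mu]_x ((\sum_(Q <- s | x \in Q) c Q)%R%:E * h x).
Proof.
move=> + c0 mh h0; elim: s => [|Q s IH] ms.
  by under eq_integral do rewrite big_nil mul0e; rewrite integral0 big_nil.
have mQ : measurable Q by apply: ms; rewrite mem_head.
have {}ms Q' : Q' \in s -> measurable Q'.
  by move=> Q's; apply: ms; rewrite in_cons Q's orbT.
have sum0 x : (0 <= \sum_(Q <- s | x \in Q) c Q)%R by exact: sumr_ge0.
rewrite big_cons IH// integral_mkcond -ge0_integralZl//; last 3 first.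
- by apply/(measurable_restrictT _ _).1 => //; exact: measurable_funTS.
- by move=> x _; rewrite patchE; case: ifP.
- by rewrite lee_fin.
rewrite -ge0_integralD//; last 4 first.
- by move=> x _; rewrite mule_ge0// ?lee_fin// patchE; case: ifP.
- apply: measurable_funeM.
  by apply/(measurable_restrictT _ _).1 => //; exact: measurable_funTS.
- by move=> x _; rewrite mule_ge0// lee_fin.
- apply: emeasurable_funM => //; apply/measurable_EFinP.
  exact: measurable_sum_mem.
apply: eq_integral => x _; rewrite big_cons patchE.
by case: ifP => _; rewrite ?mule0 ?add0e// EFinD ge0_muleDl// lee_fin.
Qed.

Definition mass (f : T -> R) Q : R := fine (\int[mu]_(x in Q) (f x)%:E).

Lemma mass_ge0 (f : T -> R) Q : (forall x, (0 <= f x)%R) -> (0 <= mass f Q)%R.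
Proof. by move=> f0; apply/fine_ge0/integral_ge0 => x _; rewrite lee_fin. Qed.

Lemma mass_integral (f : T -> R) Q : (forall x, (0 <= f x)%R) ->
  \int[mu]_(x in Q) (f x)%:E < +oo -> (mass f Q)%:E = \int[mu]_(x in Q) (f x)%:E.
Proof.
move=> f0 foo; rewrite fineK// ge0_fin_numE//.
by apply: integral_ge0 => x _; rewrite lee_fin.
Qed.

Lemma sum_mass_integral s c (f : T -> R) :
  (forall Q, Q \in s -> measurable Q) -> (forall Q, (0 <= c Q)%R) ->
  measurable_fun [set: T] f -> (forall x, (0 <= f x)%R) ->
  (forall Q, Q \in s -> \int[mu]_(x in Q) (f x)%:E < +oo) ->
  (\sum_(Q <- s) c Q * mass f Q)%R%:E =
  \int[mu]_x ((\sum_(Q <- s | x \in Q) c Q) * f x)%R%:E.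
Proof.
move=> ms c0 mf f0 foo; under eq_integral do rewrite EFinM.
rewrite -(sum_integral_mem (h := fun x => (f x)%:E) ms c0)//; last first.
  exact/measurable_EFinP.
rewrite -sumEFin big_seq [RHS]big_seq; apply: eq_bigr => Q Qs.
by rewrite EFinM mass_integral// foo.
Qed.

End SumIntegral.

(** * Doob's inequality for weighted averages *)

Section WeightedEstimates.
Context d (T : measurableType d) {R : realType}.
Variables (mu : {measure set T -> \bar R}) (W : T -> R).
Hypotheses (mW : measurable_fun [set: T] W) (W0 : forall x, 0 <= W x).
Variable s : seq (set T).
Hypotheses (lam : laminar s) (ms : forall Q, Q \in s -> measurable Q).
Implicit Types Q : set T.

Definition wavg (g : T -> R) Q : R := mass mu (fun x => g x * W x) Q / mass mu W Q.

(** Each mass is an integral over its cube, and at a point the increments over the cubes containing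
    it telescope; [0 < a] makes the value on the empty chain 0. *)
Lemma sum_increment_integral (v : set T -> R) a (h : T -> R) : 0 < a ->
  measurable_fun [set: T] h -> (forall x, 0 <= h x) ->
  (forall Q, Q \in s -> \int[mu]_(x in Q) (h x)%:E < +oo)%E ->
  ((\sum_(Q <- s) increment (fun l => maxval v l `^ a) s Q * mass mu h Q)%R%:E =
  \int[mu]_x (maxval v [seq Q <- s | x \in Q] `^ a * h x)%:E)%E.
Proof.
move=> a0 mh h0 hoo; set Phi := fun l => maxval v l `^ a.
have PhiE x : maxval v [seq Q <- s | x \in Q] `^ a =
    \sum_(Q <- s | x \in Q) increment Phi s Q.
  by rewrite telescope_point// /Phi maxval_nil powR0 ?gt_eqF// subr0.
under eq_integral do rewrite PhiE.
apply: sum_mass_integral => // Q.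
by apply: powR_maxval_increment_ge0; exact: ltW.
Qed.

Hypotheses (Woo : forall Q, Q \in s -> (\int[mu]_(x in Q) (W x)%:E < +oo)%E)
  (Wpos : forall Q, Q \in s -> 0 < mass mu W Q).

(* Doob's inequality in the form of a sum over the family: the increments of
   [maxval ^ p] telescope to the p-th power of the maximal function at each point. *)
Lemma doob_increment (g : T -> R) p : 1 < p ->
  measurable_fun [set: T] g -> (forall x, 0 <= g x) ->
  (forall Q, Q \in s -> \int[mu]_(x in Q) (g x * W x)%:E < +oo)%E ->
  ((\sum_(Q <- s) increment (fun l => maxval (wavg g) l `^ p) s Q * mass mu W Q)%R%:E <=
   ((2 * (p / (p - 1))) `^ p)%:E * \int[mu]_x (g x `^ p * W x)%:E)%E.
Proof.
move=> p1 mg g0 goo; set v := wavg g; have p0 : 0 < p by lra.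
have pm0 : 0 < p - 1 by lra.
set p' := p / (p - 1); have p'0 : 0 < p' by rewrite divr_gt0.
have mgW : measurable_fun [set: T] (fun x => g x * W x) by exact: measurable_funM.
have gW0 x : 0 <= g x * W x by rewrite mulr_ge0.
pose m x := maxval v [seq Q <- s | x \in Q].
have m0 x : 0 <= m x by exact: maxval_ge0.
set Y := \sum_(Q <- s) _.
have YE : (Y%:E = \int[mu]_x (m x `^ p * W x)%:E)%E.
  by apply: sum_increment_integral.
set Z := \sum_(Q <- s) increment (fun l => maxval v l `^ (p - 1)) s Q *
  mass mu (fun x => g x * W x) Q.
have ZE : (Z%:E = \int[mu]_x (m x `^ (p - 1) * (g x * W x))%:E)%E.
  by apply: sum_increment_integral.
(* Where the maximum jumps, its new value is [v Q], and [v Q * mass mu W Q] is the mass of g W;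
   elsewhere both increments are 0. *)
have YZ : Y <= p' * Z.
  rewrite mulr_sumr /Y big_seq [leRHS]big_seq; apply: ler_sum => Q Qs.
  have [E|[E vle]] := maxval_supersetsP v Qs.
    by rewrite /increment E !subrr !mul0r mulr0.
  rewrite [X in _ * (_ * X)](_ : _ = v Q * mass mu W Q); last first.
    by rewrite divfK// gt_eqF// Wpos.
  rewrite (mulrA _ (v Q)) mulrA ler_wpM2r ?(ltW (Wpos Qs))//.
  have := @powR_increment_le _ p (v Q) (maxval v (strict_supersets s Q)) p1.
  rewrite maxval_ge0 vle => /(_ isT); rewrite /increment E => /le_trans; apply.
  by rewrite [v Q * _]mulrC.
have mm a : 0 < a -> measurable_fun [set: T] (fun x => m x `^ a).
  move=> a0; pose Phi := fun l => maxval v l `^ a.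
  rewrite (_ : (fun x => _) = (fun x => \sum_(Q <- s | x \in Q) increment Phi s Q)).
    exact: measurable_sum_mem.
  apply/funext => x.
  by rewrite telescope_point// /Phi maxval_nil powR0 ?gt_eqF// subr0.
(* The factor 2 in [2 * p'] leaves the coefficient 1/2 in front of m^p, so that half of the real
   number [Y] can be absorbed at the end. *)
have young x : p' * (m x `^ (p - 1) * (g x * W x)) <=
    2^-1 * ((2 * p') `^ p * (g x `^ p * W x)) + 2^-1 * (m x `^ p * W x).
  have K0 : 0 <= 2 * p' by rewrite mulr_ge0// (ltW p'0).
  have pV : 0 <= p^-1 <= 1 by rewrite invr_ge0 invf_le1// !ltW.
  have := @weighted_am_gm2 _ p^-1 ((2 * p' * g x) `^ p) (m x `^ p) pV.
  rewrite !powR_ge0 -!powRrM divff ?gt_eqF// powRr1 ?(mulr_ge0 K0)//.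
  rewrite mulrBr mulr1 divff ?gt_eqF// => /(_ isT isT).
  rewrite [(2 * p' * g x) `^ p]powRM//.
  have Kg0 : 0 <= (2 * p') `^ p * g x `^ p by rewrite mulr_ge0 ?powR_ge0.
  have M0 : 0 <= m x `^ p by exact: powR_ge0.
  case/andP : pV => pV0 pV1.
  have := ler_piMl Kg0 pV1; have /(ler_piMl M0) : 1 - p^-1 <= 1 by rewrite gerBl.
  set A := m x `^ (p - 1); set M := m x `^ p; set K := _ `^ p * _.
  move=> M1 K1 h.
  rewrite [leLHS](_ : _ = p' * (A * g x) * W x); last by rewrite !mulrA.
  rewrite [leRHS](_ : _ = (2^-1 * K + 2^-1 * M) * W x); last by rewrite /K; ring.
  have -> : p' * (A * g x) = 2^-1 * (2 * p' * g x * A) by field.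
  rewrite ler_wpM2r// -mulrDr ler_wpM2l// ?invr_ge0//.
  by apply: (le_trans h); exact: lerD.
have mgp : measurable_fun [set: T] (fun x => g x `^ p * W x).
  apply: measurable_funM => //; exact: (measurableT_comp (measurable_powR p) mg).
set N := (\int[mu]_x (g x `^ p * W x)%:E)%E.
have Kp0 : (0 < (2 * p') `^ p) by rewrite powR_gt0// mulr_gt0.
have N0 : (0 <= N)%E.
  by apply: integral_ge0 => x _; rewrite lee_fin mulr_ge0// powR_ge0.
have [Noo|] := eqVneq N +oo%E; first by rewrite Noo gt0_muley ?lte_fin// leey.
rewrite -ltey -ge0_fin_numE// => Nfin; rewrite -(fineK Nfin) -EFinM lee_fin.
have Zb : ((p' * Z)%:E <= (2^-1 * ((2 * p') `^ p * fine N) + 2^-1 * Y)%:E)%E.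
  have mZ : measurable_fun [set: T] (fun x => m x `^ (p - 1) * (g x * W x)).
    by apply: measurable_funM => //; exact: mm.
  have mY : measurable_fun [set: T] (fun x => m x `^ p * W x).
    by apply: measurable_funM => //; exact: mm.
  have half0 : (0 <= 2^-1 :> R) by rewrite invr_ge0.
  have KK0 : 0 <= 2^-1 * (2 * p') `^ p by rewrite mulr_ge0// ltW.
  have Z0 x : 0 <= m x `^ (p - 1) * (g x * W x) by rewrite mulr_ge0 ?powR_ge0.
  have Y0 x : 0 <= m x `^ p * W x by rewrite mulr_ge0 ?powR_ge0.
  have N0' x : 0 <= g x `^ p * W x by rewrite mulr_ge0 ?powR_ge0.
  rewrite mulrA EFinD !EFinM ZE YE fineK//.
  rewrite -!ge0_integralZl_EFin//; last 8 first.
  all: try by apply/measurable_EFinP.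
  all: try by move=> x _; rewrite lee_fin.
  all: try exact: ltW p'0.
  all: try by rewrite mulr_ge0// ltW.
  rewrite -ge0_integralD//; last 4 first.
  all: try by apply: measurable_funeM; exact/measurable_EFinP.
  all: try by move=> x _; rewrite -EFinM lee_fin mulr_ge0.
  apply: ge0_le_integral => //.
  - by move=> x _; rewrite -EFinM lee_fin mulr_ge0// (ltW p'0).
  - by apply: measurable_funeM; exact/measurable_EFinP.
  - apply: emeasurable_funD.
      by apply: measurable_funeM; exact/measurable_EFinP.
    by apply: measurable_funeM; exact/measurable_EFinP.
  - move=> x _; rewrite -!EFinM -EFinD lee_fin; apply: le_trans (young x) _.
    by rewrite !mulrA.
move: Zb; rewrite lee_fin => Zb.
have := le_trans YZ Zb; lra.
Qed.

End WeightedEstimates.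

(** * Kolmogorov's inequality *)

Section Kolmogorov.
Context d (T : measurableType d) {R : realType}.
Variables (mu : {measure set T -> \bar R}) (W : T -> R) (s : seq (set T)).
Hypotheses (mW : measurable_fun [set: T] W) (W0 : forall x, 0 <= W x).
Hypotheses (lam : laminar s) (ms : forall Q, Q \in s -> measurable Q).
Hypotheses (Woo : forall Q, Q \in s -> (\int[mu]_(x in Q) (W x)%:E < +oo)%E)
  (Wpos : forall Q, Q \in s -> 0 < mass mu W Q).
Variables (vol : set T -> R) (L b : R) (R0 : set T).
Hypotheses (b01 : 0 < b < 1) (R0s : R0 \in s)
  (vol0 : forall Q, Q \in s -> 0 < vol Q)
  (packing : forall Q, Q \in s ->
     \sum_(Q' <- s | `[< Q' `<=` Q >]) vol Q' <= L * vol Q).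

Let v Q := mass mu W Q / vol Q.
Let s' := [seq Q <- s | `[< Q `<=` R0 >]].

Let s's Q : Q \in s' -> Q \in s.
Proof. by rewrite mem_filter => /andP[]. Qed.

Let vpos Q : Q \in s -> 0 < v Q.
Proof. by move=> Qs; rewrite divr_gt0 ?Wpos ?vol0. Qed.

Let R0s' : R0 \in s'.
Proof. by rewrite mem_filter R0s andbT; apply/asboolP. Qed.

(** The sign makes the decreasing power b - 1 increasing along chains, and the floor [v R0] bounds
    its total variation by (v R0)^(b-1). *)
Let Psi l := - Num.max (v R0) (maxval v l) `^ (b - 1).

Let Psi_increment_ge0 Q : 0 <= increment Psi s' Q.
Proof.
have [/andP[b0 b1] vR0] := (b01, vpos R0s).
rewrite /increment /Psi opprK addrC subr_ge0 -(opprB 1 b) !powRN.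
have h l : 0 < Num.max (v R0) (maxval v l) by rewrite lt_max vR0.
rewrite lef_pV2 ?posrE ?powR_gt0// ge0_ler_powR ?nnegrE ?(ltW (h _))// ?subr_ge0 ?(ltW b1)//.
by rewrite ge_max !le_max lexx maxval_strict_le orbT.
Qed.

(** At a point of [R0] the increments telescope to at most (v R0)^(b-1); at a point outside [R0]
    there are none. *)
Let Psi_increment_sum :
  \sum_(Q <- s') increment Psi s' Q * mass mu W Q <= v R0 `^ (b - 1) * mass mu W R0.
Proof.
have mW' : measurable_fun [set: T] (fun x => (W x)%:E) by exact/measurable_EFinP.
have W0' x : (0 <= (W x)%:E)%E by rewrite lee_fin.
have ms' Q : Q \in s' -> measurable Q by move=> /s's; exact: ms.
have massE Q : Q \in s -> ((mass mu W Q)%:E = \int[mu]_(x in Q) (W x)%:E)%E.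
  by move=> Qs; rewrite fineK// ge0_fin_numE ?Woo// integral_ge0.
have c0 (Q : set T) : 0 <= v R0 `^ (b - 1) by exact: powR_ge0.
have mR0 Q : Q \in [:: R0] -> measurable Q by rewrite mem_seq1 => /eqP ->; exact: ms.
rewrite -lee_fin EFinM massE// (_ : (_ * \int[mu]_(x in R0) _ =
    \sum_(Q <- [:: R0]) (v R0 `^ (b - 1))%:E * \int[mu]_(x in Q) (W x)%:E)%E); last first.
  by rewrite big_seq1.
rewrite (sum_integral_mem mu mR0 c0 mW' W0').
rewrite (_ : (_%:E = \sum_(Q <- s') (increment Psi s' Q)%:E *
    \int[mu]_(x in Q) (W x)%:E)%E); last first.
  rewrite -sumEFin big_seq [RHS]big_seq; apply: eq_bigr => Q /s's Qs.
  by rewrite EFinM massE.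
rewrite (sum_integral_mem mu ms' Psi_increment_ge0 mW' W0').
apply: ge0_le_integral => //.
- by move=> x _; rewrite mule_ge0// lee_fin sumr_ge0.
- apply: emeasurable_funM => //; apply/measurable_EFinP.
  exact: measurable_sum_mem.
- apply: emeasurable_funM => //; apply/measurable_EFinP.
  exact: measurable_sum_mem.
move=> x _; apply: lee_wpmul2r => //; rewrite lee_fin [leRHS]big_mkcond big_seq1.
case: ifPn => [_|xR0].
  rewrite telescope_point; last exact: laminar_filter.
  rewrite /Psi maxval_nil opprK addrC.
  by rewrite max_l ?(ltW (vpos _))// gerBl powR_ge0.
rewrite big_seq_cond big1// => Q; rewrite mem_filter.
case/andP=> /andP[/asboolP QR0 _] /set_mem xQ.
by move: xR0; rewrite notin_setE => /(_ (QR0 _ xQ)).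
Qed.

(** Packing reduces the sum to increments of [maxval ^ b] weighted by volume. The top cube [R0]
    contributes its own term; below it [powR_increment_le_neg] converts each jump into an increment
    of [Psi] weighted by mass, and 1 + b / (1 - b) = 1 / (1 - b). *)
Lemma kolmogorov_sum :
  \sum_(Q <- s | `[< Q `<=` R0 >]) v Q `^ b * vol Q <=
  L / (1 - b) * (v R0 `^ b * vol R0).
Proof.
have /andP[b0 b1] := b01; have vR0 := vpos R0s; have volR0 := vol0 R0s.
have L0 : 0 <= L.
  rewrite -(pmulr_lge0 _ volR0); apply: le_trans (packing R0s).
  by rewrite big_seq_cond sumr_ge0// => Q /andP[Qs _]; rewrite ltW// vol0.
pose Phi l := maxval v l `^ b.
have lam' : laminar s' by exact: laminar_filter.
have Phi0 : Phi [::] = 0 by rewrite /Phi maxval_nil powR0// gt_eqF.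
rewrite -big_filter -/s'.
apply: (@le_trans _ _ (\sum_(Q <- s') Phi (supersets s' Q) * vol Q)).
  rewrite big_seq [leRHS]big_seq; apply: ler_sum => Q Qs'.
  rewrite ler_wpM2r ?(ltW (vol0 (s's Qs')))// ge0_ler_powR ?nnegrE ?(ltW b0)//.
  - exact/ltW/vpos/s's.
  - exact: maxval_ge0.
  - exact: supersets_le.
apply: (le_trans (carleson_abel lam' Phi0 _ (b := vol) (L := L) _)).
- by move=> Q _; apply: powR_maxval_increment_ge0; exact: ltW.
- move=> Q; rewrite mem_filter => /andP[/asboolP QR0 Qs].
  apply: le_trans (packing Qs); rewrite big_filter_cond/= le_eqVlt; apply/orP; left.
  apply/eqP; apply: eq_bigl => Q'; rewrite andb_idl// => /asboolP QQ'.
  by apply/asboolP; exact: subset_trans QR0.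
rewrite -mulrA ler_wpM2l//.
(* [R0] is treated apart because below it the running maximum is at least [v R0], so that the floor
   in [Psi] is inactive. *)
pose top Q := if Q == R0 then v R0 `^ b * vol R0 else 0.
apply: (@le_trans _ _ (\sum_(Q <- s')
    (top Q + b / (1 - b) * (increment Psi s' Q * mass mu W Q)))).
  rewrite big_seq [leRHS]big_seq; apply: ler_sum => Q Qs'.
  have Qs := s's Qs'; have vQ := vpos Qs.
  have massE : mass mu W Q = v Q * vol Q by rewrite divfK// gt_eqF ?vol0.
  have bb0 : 0 <= b / (1 - b) by rewrite divr_ge0 ?subr_ge0 ?(ltW b0) ?(ltW b1).
  rewrite /top; case: eqP => [QE|/eqP QR0].
    have E : increment Phi s' Q = v R0 `^ b.
      rewrite /increment {1}/Phi maxval_supersetsE// (_ : strict_supersets _ _ = [::]).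
        by rewrite maxval_nil Phi0 subr0 max_l ?(ltW vQ)// QE.
      apply/eqP; rewrite -(negbK (_ == _)) -has_filter -all_predC.
      apply/allP => Q'; rewrite mem_filter => /andP[/asboolP Q'R0 _] /=.
      rewrite negb_and negbK orbC QE; have [//|/= Q'E] := eqVneq Q' R0.
      by apply/asboolPn => R0Q'; move/eqP : Q'E; apply; exact/seteqP.
    rewrite E QE lerDl mulr_ge0// mulr_ge0//; exact: (ltW (Wpos R0s)).
  rewrite add0r massE !mulrA ler_wpM2r ?(ltW (vol0 Qs))//.
  have R0strict : v R0 <= maxval v (strict_supersets s' Q).
    apply: maxval_ge; rewrite mem_filter R0s' andbT eq_sym QR0 andbT.
    by move: Qs'; rewrite mem_filter => /andP[].
  have R0up := le_trans R0strict (maxval_strict_le v s' Q).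
  rewrite /increment /Psi /Phi (max_r R0strict) (max_r R0up) opprK.
  have [E|[E vle]] := maxval_supersetsP v Qs'.
    by rewrite E subrr addNr mulr0 !mul0r.
  rewrite E; set y := maxval _ _ in R0strict vle *.
  have := @powR_increment_le_neg _ b (v Q) y b01.
  rewrite vle (lt_le_trans vR0 R0strict) => /(_ isT) /le_trans; apply.
  by rewrite le_eqVlt; apply/orP; left; apply/eqP; rewrite /v; ring.
rewrite big_split/= -mulr_sumr.
have -> : \sum_(Q <- s') top Q = v R0 `^ b * vol R0.
  rewrite (bigD1_seq R0)//= ?big1 ?addr0 /top ?eqxx//; first by move=> Q /negPf ->.
  by have [] := lam'.
apply: (le_trans (lerD (lexx _) (ler_wpM2l _ Psi_increment_sum))).
  by rewrite divr_ge0 ?subr_ge0 ?(ltW b0) ?(ltW b1).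
have -> : v R0 `^ (b - 1) * mass mu W R0 = v R0 `^ b * vol R0.
  have -> : mass mu W R0 = v R0 * vol R0 by rewrite divfK// gt_eqF.
  by rewrite -(mulr_powRB1 (ltW vR0) b0); ring.
rewrite -[X in X + _]mul1r -mulrDl (_ : 1 + _ = (1 - b)^-1)//.
by field; rewrite subr_eq0 gt_eqF.
Qed.

End Kolmogorov.

(** * The trilinear estimate *)

Section Trilinear.
Context {X : Type} {R : realType}.
Implicit Types (s : seq (set X)) (Q : set X) (v W : set X -> R).

(** As 1 / a1 >= 1, superadditivity bounds the increment of [maxval ^ d1] by the a1-th power of that
    of [maxval ^ (d1 / a1)]; Hölder's inequality then separates the factors. The first one keeps its
    increment and therefore needs no Carleson constant. *)
Lemma holder_increment s v1 v2 v3 W1 W2 W3 (d1 d2 d3 a1 a2 a3 N1 M2 M3 : R) :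
  (forall Q, 0 <= W1 Q) -> (forall Q, 0 <= W2 Q) -> (forall Q, 0 <= W3 Q) ->
  0 < a1 -> 0 < a2 -> 0 < a3 -> a1 + a2 + a3 = 1 ->
  0 <= d1 -> 0 <= d2 -> 0 <= d3 ->
  \sum_(Q <- s) increment (fun l => maxval v1 l `^ (d1 / a1)) s Q * W1 Q <= N1 ->
  \sum_(Q <- s) maxval v2 (supersets s Q) `^ (d2 / a2) * W2 Q <= M2 ->
  \sum_(Q <- s) maxval v3 (supersets s Q) `^ (d3 / a3) * W3 Q <= M3 ->
  \sum_(Q <- s) increment (fun l => maxval v1 l `^ d1) s Q *
    maxval v2 (supersets s Q) `^ d2 * maxval v3 (supersets s Q) `^ d3 *
    (W1 Q `^ a1 * W2 Q `^ a2 * W3 Q `^ a3) <= N1 `^ a1 * M2 `^ a2 * M3 `^ a3.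
Proof.
move=> W10 W20 W30 a10 a20 a30 asum d10 d20 d30 hN1 hM2 hM3.
have p0 d a : 0 <= d -> 0 < a -> 0 <= d / a by move=> d0 a0; rewrite divr_ge0// ltW.
pose f1 Q := increment (fun l => maxval v1 l `^ (d1 / a1)) s Q * W1 Q.
pose f2 Q := maxval v2 (supersets s Q) `^ (d2 / a2) * W2 Q.
pose f3 Q := maxval v3 (supersets s Q) `^ (d3 / a3) * W3 Q.
have f10 Q : 0 <= f1 Q by rewrite mulr_ge0// powR_maxval_increment_ge0// p0.
have f20 Q : 0 <= f2 Q by rewrite mulr_ge0// powR_ge0.
have f30 Q : 0 <= f3 Q by rewrite mulr_ge0// powR_ge0.
have powRVK x d a : 0 < a -> (x `^ (d / a)) `^ a = x `^ d :> R.
  by move=> a0; rewrite -powRrM divfK// gt_eqF.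
apply: (@le_trans _ _ (\sum_(Q <- s) f1 Q `^ a1 * f2 Q `^ a2 * f3 Q `^ a3)).
  apply: ler_sum => Q _.
  rewrite /f1 /f2 /f3 (powRM _ _ (W20 Q)) ?powR_ge0// (powRM _ _ (W30 Q)) ?powR_ge0//.
  rewrite (powRM _ _ (W10 Q)) ?powR_maxval_increment_ge0 ?p0// !powRVK//.
  set I := increment _ _ _; set J := increment _ _ _.
  have IJ : I <= J `^ a1.
    have I0 : 0 <= I by exact: powR_maxval_increment_ge0.
    have -> : I = (I `^ a1^-1) `^ a1 by rewrite -powRrM mulVf ?gt_eqF// powRr1.
    rewrite ge0_ler_powR ?nnegrE//.
    - exact: ltW.
    - exact: powR_ge0.
    - by apply: powR_maxval_increment_ge0; exact: p0.
    rewrite /J /increment !powRrM; apply: powR_subr_le.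
      by rewrite invf_ge1//; lra.
    by rewrite powR_ge0 -subr_ge0 (powR_maxval_increment_ge0 v1 s Q d10).
  rewrite [leRHS](_ : _ = J `^ a1 * (maxval v2 (supersets s Q) `^ d2 *
    maxval v3 (supersets s Q) `^ d3 * (W1 Q `^ a1 * W2 Q `^ a2 * W3 Q `^ a3))); last ring.
  by rewrite -!mulrA ler_wpM2r// !mulr_ge0// powR_ge0.
apply: (le_trans (holder_sum3 s xpredT f10 f20 f30 a10 a20 a30 asum)).
have S1 : 0 <= \sum_(Q <- s) f1 Q by exact: sumr_ge0.
have S2 : 0 <= \sum_(Q <- s) f2 Q by exact: sumr_ge0.
have S3 : 0 <= \sum_(Q <- s) f3 Q by exact: sumr_ge0.
have N10 := le_trans S1 hN1; have M20 := le_trans S2 hM2; have M30 := le_trans S3 hM3.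
apply: ler_pM; rewrite ?mulr_ge0 ?powR_ge0//.
  by apply: ler_pM; rewrite ?powR_ge0// ge0_ler_powR ?nnegrE// ltW.
by rewrite ge0_ler_powR ?nnegrE// ltW.
Qed.

Lemma powR_maxval_carleson s v W (p k N : R) : 0 < p -> 0 <= k ->
  laminar s ->
  (forall Q, Q \in s -> \sum_(Q' <- s | `[< Q' `<=` Q >]) W Q' <= k * W Q) ->
  \sum_(Q <- s) increment (fun l => maxval v l `^ p) s Q * W Q <= N ->
  \sum_(Q <- s) maxval v (supersets s Q) `^ p * W Q <= k * N.
Proof.
move=> p0 k0 lam kW hN.
have Phi0 : maxval v [::] `^ p = 0 by rewrite maxval_nil powR0// gt_eqF.
apply: le_trans (ler_wpM2l k0 hN).
apply: (carleson_abel (Phi := fun l => maxval v l `^ p) lam Phi0 _ kW).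
by move=> Q _; apply: powR_maxval_increment_ge0; exact: ltW.
Qed.

Variables (v1 v2 v3 W1 W2 W3 : set X -> R).
Variables (d1 d2 d3 a1 a2 a3 k1 k2 k3 N1 N2 N3 : R).
Hypotheses (v10 : forall Q, 0 <= v1 Q) (v20 : forall Q, 0 <= v2 Q)
  (v30 : forall Q, 0 <= v3 Q).
Hypotheses (W10 : forall Q, 0 <= W1 Q) (W20 : forall Q, 0 <= W2 Q)
  (W30 : forall Q, 0 <= W3 Q).
Hypotheses (a10 : 0 < a1) (a20 : 0 < a2) (a30 : 0 < a3) (asum : a1 + a2 + a3 = 1).
Hypotheses (k10 : 0 <= k1) (k20 : 0 <= k2) (k30 : 0 <= k3).
Hypotheses (d10 : 0 < d1) (d20 : 0 < d2) (d30 : 0 < d3).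

(** One summand for each factor that bears the increment: the Carleson constants of the other
    two. *)
Let pairs := k2 `^ a2 * k3 `^ a3 + k1 `^ a1 * k3 `^ a3 + k1 `^ a1 * k2 `^ a2.

Let N_ge0 s v W N d a : (forall Q, 0 <= W Q) -> 0 < d -> 0 < a ->
  \sum_(Q <- s) increment (fun l => maxval v l `^ (d / a)) s Q * W Q <= N -> 0 <= N.
Proof.
move=> W0 d0 a0; apply: le_trans; apply: sumr_ge0 => Q _.
by rewrite mulr_ge0// powR_maxval_increment_ge0// divr_ge0// ltW.
Qed.

(** The Carleson constant [L] of the mixed sequence pays for a single summation by parts of the
    product of the three maximal functions; [prod3_increment_le] then lets [holder_increment] act
    with the three roles permuted. *)
Lemma trilinear_level s (L : R) : 0 <= L -> laminar s ->
  (forall Q, Q \in s -> \sum_(Q' <- s | `[< Q' `<=` Q >]) W1 Q' <= k1 * W1 Q) ->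
  (forall Q, Q \in s -> \sum_(Q' <- s | `[< Q' `<=` Q >]) W2 Q' <= k2 * W2 Q) ->
  (forall Q, Q \in s -> \sum_(Q' <- s | `[< Q' `<=` Q >]) W3 Q' <= k3 * W3 Q) ->
  \sum_(Q <- s) increment (fun l => maxval v1 l `^ (d1 / a1)) s Q * W1 Q <= N1 ->
  \sum_(Q <- s) increment (fun l => maxval v2 l `^ (d2 / a2)) s Q * W2 Q <= N2 ->
  \sum_(Q <- s) increment (fun l => maxval v3 l `^ (d3 / a3)) s Q * W3 Q <= N3 ->
  (forall Q, Q \in s -> \sum_(Q' <- s | `[< Q' `<=` Q >])
     W1 Q' `^ a1 * W2 Q' `^ a2 * W3 Q' `^ a3 <=
     L * (W1 Q `^ a1 * W2 Q `^ a2 * W3 Q `^ a3)) ->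
  \sum_(Q <- s) v1 Q `^ d1 * v2 Q `^ d2 * v3 Q `^ d3 *
    (W1 Q `^ a1 * W2 Q `^ a2 * W3 Q `^ a3) <=
  L * pairs * (N1 `^ a1 * N2 `^ a2 * N3 `^ a3).
Proof.
move=> L0 lam kW1 kW2 kW3 hN1 hN2 hN3 LW.
have N10 := N_ge0 W10 d10 a10 hN1; have N20 := N_ge0 W20 d20 a20 hN2.
have N30 := N_ge0 W30 d30 a30 hN3.
have hM1 := powR_maxval_carleson (divr_gt0 d10 a10) k10 lam kW1 hN1.
have hM2 := powR_maxval_carleson (divr_gt0 d20 a20) k20 lam kW2 hN2.
have hM3 := powR_maxval_carleson (divr_gt0 d30 a30) k30 lam kW3 hN3.
pose G1 l := maxval v1 l `^ d1; pose G2 l := maxval v2 l `^ d2.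
pose G3 l := maxval v3 l `^ d3; pose Phi l := G1 l * G2 l * G3 l.
have Phi0 : Phi [::] = 0.
  by rewrite /Phi /G1 maxval_nil powR0 ?gt_eqF// !mul0r.
have G0 v d l : 0 <= maxval v l `^ d by exact: powR_ge0.
have Ginc v d Q : 0 < d ->
    maxval v (strict_supersets s Q) `^ d <= maxval v (supersets s Q) `^ d.
  by move=> d0; rewrite -subr_ge0 (powR_maxval_increment_ge0 v s Q (ltW d0)).
pose c Q := W1 Q `^ a1 * W2 Q `^ a2 * W3 Q `^ a3.
have c0 Q : 0 <= c Q by rewrite !mulr_ge0 ?powR_ge0.
apply: (@le_trans _ _ (\sum_(Q <- s) Phi (supersets s Q) * c Q)).
  rewrite big_seq [leRHS]big_seq; apply: ler_sum => Q Qs.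
  apply: ler_wpM2r; first exact: c0.
  have vle v d : 0 < d -> (forall Q, 0 <= v Q) -> v Q `^ d <= maxval v (supersets s Q) `^ d.
    move=> d0 v0; rewrite ge0_ler_powR ?nnegrE ?maxval_ge0 ?(ltW d0)//.
    exact: supersets_le.
  by apply: ler_pM3; rewrite powR_ge0 vle.
apply: (le_trans (carleson_abel lam Phi0 _ LW)).
  by move=> Q _; rewrite subr_ge0 /Phi; apply: ler_pM3; rewrite G0 Ginc.
rewrite -mulrA ler_wpM2l//.
have h1 := holder_increment W10 W20 W30 a10 a20 a30 asum (ltW d10) (ltW d20) (ltW d30) hN1 hM2 hM3.
have h2 := holder_increment W20 W10 W30 a20 a10 a30 _ (ltW d20) (ltW d10) (ltW d30) hN2 hM1 hM3.
have h3 := holder_increment W30 W10 W20 a30 a10 a20 _ (ltW d30) (ltW d10) (ltW d20) hN3 hM1 hM2.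
apply: le_trans (_ : _ <= N1 `^ a1 * (k2 * N2) `^ a2 * (k3 * N3) `^ a3 +
  N2 `^ a2 * (k1 * N1) `^ a1 * (k3 * N3) `^ a3 +
  N3 `^ a3 * (k1 * N1) `^ a1 * (k2 * N2) `^ a2) _; last first.
  rewrite !powRM// /pairs le_eqVlt; apply/orP; left; apply/eqP; ring.
apply: le_trans (lerD (lerD h1 (h2 _)) (h3 _)); last 2 first.
- by rewrite (addrC a2).
- by rewrite -addrA addrC.
rewrite -!big_split/=; apply: ler_sum => Q _.
rewrite -/(c Q) [W2 Q `^ a2 * W1 Q `^ a1]mulrC -/(c Q).
rewrite [W3 Q `^ a3 * _ * _](_ : _ = c Q); last by rewrite /c; ring.
do 2 rewrite -mulrDl; apply: ler_wpM2r; first exact: c0.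
rewrite /increment /Phi /G1 /G2 /G3.
by apply: prod3_increment_le; rewrite G0 Ginc.
Qed.

(* Kolmogorov's inequality requires exponents of sum less than 1, whereas a1 + a2 + a3 = 1.
   On a level set of m = w1^e1 w2^e2 w3^e3 one may trade w^a for w^(a - tau e). *)
Lemma level_carleson s vol (e1 e2 e3 tau c K : R)
    (b1 := a1 - tau * e1) (b2 := a2 - tau * e2) (b3 := a3 - tau * e3)
    (beta := b1 + b2 + b3)
    (m := fun Q => (W1 Q / vol Q) `^ e1 * (W2 Q / vol Q) `^ e2 * (W3 Q / vol Q) `^ e3) :
  (forall Q, 0 <= vol Q) -> (forall Q, Q \in s -> 0 < vol Q) ->
  (forall Q, Q \in s -> [/\ 0 < W1 Q, 0 < W2 Q & 0 < W3 Q]) ->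
  0 < tau -> 0 < b1 -> 0 < b2 -> 0 < b3 -> 0 <= K -> 0 < c ->
  (forall W Q, W \in [:: W1; W2; W3] -> Q \in s ->
    \sum_(Q' <- s | `[< Q' `<=` Q >]) (W Q' / vol Q') `^ beta * vol Q' <=
    K * ((W Q / vol Q) `^ beta * vol Q)) ->
  (forall Q, Q \in s -> c <= m Q <= 2 * c) ->
  forall Q, Q \in s ->
  \sum_(Q' <- s | `[< Q' `<=` Q >]) W1 Q' `^ a1 * W2 Q' `^ a2 * W3 Q' `^ a3 <=
  K * 2 `^ tau * (W1 Q `^ a1 * W2 Q `^ a2 * W3 Q `^ a3).
Proof.
move=> vol_ge0 vol_gt0 Wgt0 tau0 b10 b20 b30 K0 c0 kolm mc.
have beta0 : 0 < beta by exact: addr_gt0 (addr_gt0 b10 b20) b30.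
pose f W Q := (W Q / vol Q) `^ beta * vol Q.
have f0 W Q : 0 <= f W Q by rewrite mulr_ge0 ?powR_ge0.
(* A weighted geometric mean of the three sequences covered by [kolm]. Its weights add up to 1, as
   the a_i do, so the powers of [vol] agree on both sides of [E] below. *)
pose g Q := f W1 Q `^ (b1 / beta) * f W2 Q `^ (b2 / beta) * f W3 Q `^ (b3 / beta).
have bsum : b1 / beta + b2 / beta + b3 / beta = 1.
  by rewrite -!mulrDl divff ?gt_eqF.
have fE W Q b : 0 < vol Q ->
    f W Q `^ (b / beta) = (W Q / vol Q) `^ b * vol Q `^ (b / beta).
  move=> V0; rewrite /f powRM ?powR_ge0 ?(ltW V0)// -powRrM mulrCA divff ?mulr1//.
  by rewrite gt_eqF.
have split_powR W Q a e : 0 < vol Q -> 0 < W Q ->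
    W Q `^ a = (W Q / vol Q) `^ (a - tau * e) * ((W Q / vol Q) `^ e) `^ tau * vol Q `^ a.
  move=> V0 WQ0; have wQ0 : 0 < W Q / vol Q by rewrite divr_gt0.
  rewrite -powRrM -powRD ?(gt_eqF wQ0) ?implybT// (mulrC e) subrK -powRM ?(ltW wQ0) ?(ltW V0)//.
  by rewrite divfK ?gt_eqF.
have E Q : Q \in s -> W1 Q `^ a1 * W2 Q `^ a2 * W3 Q `^ a3 = m Q `^ tau * g Q.
  move=> Qs; have V0 := vol_gt0 Q Qs; have [W1p W2p W3p] := Wgt0 Q Qs.
  rewrite /g !fE// /m (powRM _ (mulr_ge0 (powR_ge0 _ _) (powR_ge0 _ _)) (powR_ge0 _ _)).
  rewrite (powRM _ (powR_ge0 _ _) (powR_ge0 _ _)).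
  rewrite (split_powR W1 Q a1 e1)// (split_powR W2 Q a2 e2)// (split_powR W3 Q a3 e3)//.
  rewrite -/b1 -/b2 -/b3.
  have V1 : vol Q `^ a1 * vol Q `^ a2 * vol Q `^ a3 =
      vol Q `^ (b1 / beta) * vol Q `^ (b2 / beta) * vol Q `^ (b3 / beta).
    rewrite -!powRD ?(gt_eqF V0) ?implybT//; congr (_ `^ _).
    by rewrite asum bsum.
  exact: mulr_regroup3.
move=> Q Qs; rewrite E// big_seq_cond.
have g0 Q' : 0 <= g Q' by rewrite !mulr_ge0 ?powR_ge0.
have m0 Q' : 0 <= m Q' by rewrite !mulr_ge0 ?powR_ge0.
(* On one level the factor m^tau varies by at most 2^tau, so it can be taken out here and restored
   for [Q] at the end. *)
apply: (@le_trans _ _ (\sum_(Q' <- s | (Q' \in s) && `[< Q' `<=` Q >]) (2 * c) `^ tau * g Q')).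
  apply: ler_sum => Q' /andP[Q's _]; rewrite E//; apply: ler_wpM2r => //.
  have /andP[_ mQ'] := mc _ Q's.
  have c20 : 0 <= 2 * c by rewrite mulr_ge0// ltW.
  by rewrite ge0_ler_powR ?nnegrE ?(ltW tau0).
rewrite -big_seq_cond -mulr_sumr.
have h := holder_sum3 s (fun Q' => `[< Q' `<=` Q >]) (f0 W1) (f0 W2) (f0 W3)
  (divr_gt0 b10 beta0) (divr_gt0 b20 beta0) (divr_gt0 b30 beta0) bsum.
have {}h : \sum_(Q' <- s | `[< Q' `<=` Q >]) g Q' <= K * g Q.
  apply: (le_trans h).
  have bd W b : W \in [:: W1; W2; W3] -> 0 < b ->
      0 <= (\sum_(Q' <- s | `[< Q' `<=` Q >]) f W Q') `^ (b / beta) <=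
      (K * f W Q) `^ (b / beta).
    move=> WW b0; rewrite powR_ge0.
    rewrite ge0_ler_powR ?nnegrE ?divr_ge0 ?sumr_ge0 ?(ltW b0) ?(ltW beta0)//.
    - by rewrite mulr_ge0.
    - exact: kolm.
  apply: (le_trans (ler_pM3 (bd W1 b1 _ _) (bd W2 b2 _ _) (bd W3 b3 _ _))) => //.
  - by rewrite mem_head.
  - by rewrite !in_cons eqxx orbT.
  - by rewrite !in_cons eqxx !orbT.
  rewrite !(powRM _ K0 (f0 _ _)) /g le_eqVlt; apply/orP; left; apply/eqP.
  apply: (etrans (mulrACA3 _ _ _ _ _ _)); congr (_ * _).
  have [->|K1] := eqVneq K 0.
    by rewrite powR0 ?mul0r// gt_eqF// divr_gt0.
  by rewrite -!powRD ?K1 ?implybT// bsum powRr1.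
apply: (le_trans (ler_wpM2l _ h)); first exact: powR_ge0.
have /andP[cm _] := mc _ Qs.
rewrite powRM ?(ltW c0)// [leRHS](_ : _ = 2 `^ tau * m Q `^ tau * (K * g Q)); last first.
  by move: (g Q) (m Q `^ _) => ? ?; ring.
apply: ler_wpM2r; first exact: mulr_ge0.
apply: ler_wpM2l; first exact: powR_ge0.
by rewrite ge0_ler_powR ?nnegrE ?(ltW tau0) ?(ltW c0).
Qed.

(** Dyadic decomposition by the size of [m]. The summand is [m Q] times that of [trilinear_level],
    so the level bounds form a geometric series of sum at most 2B. The increments are relative to
    the family, hence the Doob bounds are assumed for every subfamily. *)
Lemma trilinear_estimate s vol (tau B K : R)
    (e1 := d1 - a1) (e2 := d2 - a2) (e3 := d3 - a3)
    (b1 := a1 - tau * e1) (b2 := a2 - tau * e2) (b3 := a3 - tau * e3)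
    (beta := b1 + b2 + b3)
    (m := fun Q => (W1 Q / vol Q) `^ e1 * (W2 Q / vol Q) `^ e2 * (W3 Q / vol Q) `^ e3) :
  laminar s ->
  (forall Q, 0 <= vol Q) -> (forall Q, Q \in s -> 0 < vol Q) ->
  (forall Q, Q \in s -> [/\ 0 < W1 Q, 0 < W2 Q & 0 < W3 Q]) ->
  0 < tau -> 0 < b1 -> 0 < b2 -> 0 < b3 -> 0 <= K -> 0 < B ->
  (forall W Q, W \in [:: W1; W2; W3] -> Q \in s ->
    \sum_(Q' <- s | `[< Q' `<=` Q >]) (W Q' / vol Q') `^ beta * vol Q' <=
    K * ((W Q / vol Q) `^ beta * vol Q)) ->
  (forall Q, Q \in s -> m Q <= B) ->
  (forall Q, Q \in s -> \sum_(Q' <- s | `[< Q' `<=` Q >]) W1 Q' <= k1 * W1 Q) ->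
  (forall Q, Q \in s -> \sum_(Q' <- s | `[< Q' `<=` Q >]) W2 Q' <= k2 * W2 Q) ->
  (forall Q, Q \in s -> \sum_(Q' <- s | `[< Q' `<=` Q >]) W3 Q' <= k3 * W3 Q) ->
  (forall P, let s' := [seq Q <- s | P Q] in [/\
    \sum_(Q <- s') increment (fun l => maxval v1 l `^ (d1 / a1)) s' Q * W1 Q <= N1,
    \sum_(Q <- s') increment (fun l => maxval v2 l `^ (d2 / a2)) s' Q * W2 Q <= N2 &
    \sum_(Q <- s') increment (fun l => maxval v3 l `^ (d3 / a3)) s' Q * W3 Q <= N3]) ->
  \sum_(Q <- s) v1 Q `^ d1 * v2 Q `^ d2 * v3 Q `^ d3 *
    ((W1 Q / vol Q) `^ d1 * (W2 Q / vol Q) `^ d2 * (W3 Q / vol Q) `^ d3 * vol Q) <=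
  2 * B * (K * 2 `^ tau * pairs * (N1 `^ a1 * N2 `^ a2 * N3 `^ a3)).
Proof.
move=> lam vol_ge0 vol_gt0 Wgt0 tau0 b10 b20 b30 K0 B0 kolm mB kW1 kW2 kW3 doob.
have wgt0 Q : Q \in s -> [/\ 0 < W1 Q / vol Q, 0 < W2 Q / vol Q & 0 < W3 Q / vol Q].
  by move=> Qs; have [? ? ?] := Wgt0 Q Qs; split; rewrite divr_gt0// vol_gt0.
have mgt0 Q : Q \in s -> 0 < m Q.
  by move=> /wgt0[? ? ?]; rewrite !mulr_gt0 ?powR_gt0.
(* The least j with B < m Q 2^j is positive because m Q <= B; the level is its predecessor. *)
have /choice[lvl lvlP] : forall Q, exists k, Q \in s ->
    B / 2 ^+ k.+1 <= m Q <= 2 * (B / 2 ^+ k.+1).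
  move=> Q; have [Qs|_] := boolP (Q \in s); last by exists 0%N.
  have pow2 k : 0 < 2 ^+ k :> R by rewrite exprn_gt0.
  have ex : exists k, B < m Q * 2 ^+ k.
    exists (Num.bound (B / m Q)).
    by rewrite mulrC -ltr_pdivrMr ?mgt0//; exact: upper_nthrootP.
  case: (ex_minnP ex) => -[|k].
    by rewrite expr0 mulr1 ltNge mB.
  move=> Bk kmin; exists k => _; rewrite ler_pdivrMr// (ltW Bk)/=.
  have -> : 2 * (B / 2 ^+ k.+1) = B / 2 ^+ k by rewrite exprS; field; rewrite gt_eqF.
  rewrite ler_pdivlMr//.
  by rewrite leNgt; apply/negP => /kmin; rewrite ltnn.
pose V Q := v1 Q `^ d1 * v2 Q `^ d2 * v3 Q `^ d3.
pose w Q := W1 Q `^ a1 * W2 Q `^ a2 * W3 Q `^ a3.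
have V0 Q : 0 <= V Q by rewrite !mulr_ge0 ?powR_ge0.
have w0 Q : 0 <= w Q by rewrite !mulr_ge0 ?powR_ge0.
have termE Q : Q \in s -> V Q * ((W1 Q / vol Q) `^ d1 * (W2 Q / vol Q) `^ d2 *
    (W3 Q / vol Q) `^ d3 * vol Q) = m Q * (V Q * w Q).
  move=> Qs; have volQ := vol_gt0 _ Qs; have [wQ1 wQ2 wQ3] := wgt0 _ Qs.
  have dE W d a : 0 < W Q / vol Q ->
      (W Q / vol Q) `^ d = (W Q / vol Q) `^ a * (W Q / vol Q) `^ (d - a).
    by move=> WV; rewrite -powRD ?subrKC// (gt_eqF WV) implybT.
  have wE W a : 0 <= W Q -> W Q `^ a = (W Q / vol Q) `^ a * vol Q `^ a.
    move=> WQ; rewrite -powRM ?divfK ?gt_eqF ?divr_ge0 ?vol_ge0//.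
  have volE : vol Q `^ a1 * vol Q `^ a2 * vol Q `^ a3 = vol Q.
    by rewrite -!powRD ?(gt_eqF volQ) ?implybT// asum powRr1 ?vol_ge0.
  have -> : (W1 Q / vol Q) `^ d1 * (W2 Q / vol Q) `^ d2 * (W3 Q / vol Q) `^ d3 =
      (W1 Q / vol Q) `^ a1 * (W2 Q / vol Q) `^ a2 * (W3 Q / vol Q) `^ a3 * m Q.
    rewrite (dE W1 d1 a1)// (dE W2 d2 a2)// (dE W3 d3 a3)//; exact: mulrACA3.
  have -> : w Q = (W1 Q / vol Q) `^ a1 * (W2 Q / vol Q) `^ a2 * (W3 Q / vol Q) `^ a3 * vol Q.
    rewrite /w (wE _ a1 (W10 _)) (wE _ a2 (W20 _)) (wE _ a3 (W30 _)).
    by rewrite -[X in _ = _ * X]volE; exact: mulrACA3.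
  have shuffle (x y z t : R) : x * (y * z * t) = z * (x * (y * t)) by ring.
  exact: shuffle.
set C := K * 2 `^ tau * pairs * _.
have level k : \sum_(Q <- s | lvl Q == k) m Q * (V Q * w Q) <= 2 * (B / 2 ^+ k.+1) * C.
  rewrite -big_filter; set s' := seq.filter _ s.
  have s's Q : Q \in s' -> Q \in s by rewrite mem_filter => /andP[].
  have sub (f : set X -> R) Q : (forall Q', 0 <= f Q') ->
      \sum_(Q' <- s' | `[< Q' `<=` Q >]) f Q' <= \sum_(Q' <- s | `[< Q' `<=` Q >]) f Q'.
    move=> f0; rewrite big_filter_cond [leLHS]big_mkcond [leRHS]big_mkcond/=.
    by apply: ler_sum => Q' _; case: (lvl Q' == k) => //=; case: ifP.
  have lvl' Q : Q \in s' -> B / 2 ^+ k.+1 <= m Q <= 2 * (B / 2 ^+ k.+1).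
    by rewrite mem_filter => /andP[/eqP <-]; exact: lvlP.
  have ck0 : 0 < B / 2 ^+ k.+1 by rewrite divr_gt0// exprn_gt0.
  apply: (@le_trans _ _ (2 * (B / 2 ^+ k.+1) * \sum_(Q <- s') V Q * w Q)).
    rewrite mulr_sumr big_seq [leRHS]big_seq; apply: ler_sum => Q Qs'.
    apply: ler_wpM2r; first exact: mulr_ge0.
    by have /andP[] := lvl' _ Qs'.
  apply: ler_wpM2l; first by rewrite mulr_ge0// ltW.
  have [hN1 hN2 hN3] := doob (fun Q => lvl Q == k).
  apply: trilinear_level => //.
  - by rewrite mulr_ge0 ?powR_ge0.
  - exact: laminar_filter.
  - by move=> Q /s's Qs; apply: le_trans (kW1 _ Qs); exact: sub.
  - by move=> Q /s's Qs; apply: le_trans (kW2 _ Qs); exact: sub.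
  - by move=> Q /s's Qs; apply: le_trans (kW3 _ Qs); exact: sub.
  apply: (@level_carleson s' vol e1 e2 e3 tau (B / 2 ^+ k.+1) K) => //.
  - by move=> Q /s's; exact: vol_gt0.
  - by move=> Q /s's; exact: Wgt0.
  move=> W Q WW /s's Qs; apply: le_trans (kolm _ _ WW Qs); apply: sub => Q'.
  by rewrite mulr_ge0 ?powR_ge0.
rewrite big_seq (eq_bigr _ (fun Q Qs => termE Q Qs)) -big_seq.
pose M := (\max_(Q <- s) lvl Q).+1.
have -> : \sum_(Q <- s) m Q * (V Q * w Q) =
    \sum_(k < M) \sum_(Q <- s | lvl Q == k) m Q * (V Q * w Q).
  under [RHS]eq_bigr do rewrite big_mkcond.
  rewrite exchange_big/= big_seq [RHS]big_seq; apply: eq_bigr => Q Qs.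
  have lvlM : (lvl Q < M)%N by rewrite ltnS; exact: leq_bigmax_seq.
  by rewrite -big_mkcond (big_pred1 (Ordinal lvlM))// => k; rewrite -val_eqE eq_sym.
apply: (@le_trans _ _ (\sum_(k < M) 2 * (B / 2 ^+ k.+1) * C)).
  by apply: ler_sum => k _; exact: level.
have C0 : 0 <= C.
  have pairs0 : 0 <= pairs by rewrite !addr_ge0// mulr_ge0 ?powR_ge0.
  by apply: mulr_ge0; rewrite ?mulr_ge0 ?powR_ge0.
rewrite -mulr_suml; apply: ler_wpM2r => //.
have -> : \sum_(k < M) 2 * (B / 2 ^+ k.+1) = 2 * B - 2 * (B / 2 ^+ M).
  elim: M => [|M IH]; first by rewrite big_ord0 expr0 divr1 subrr.
  rewrite big_ord_recr IH/= exprS; field.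
  by rewrite expf_neq0.
by rewrite gerBl mulr_ge0// divr_ge0 ?exprn_ge0 ?(ltW B0).
Qed.

End Trilinear.

(** * Dyadic cubes and sparse families *)

Section Cubes.
Context {R : realType} {n : nat}.
Hypothesis n0 : (0 < n)%N.
Local Notation E := (Rn R n).
Local Notation mu := (leb n).

Definition vol (Q : set E) : R := fine (mu Q).

Lemma vol_ge0 Q : 0 <= vol Q.
Proof. exact: fine_ge0. Qed.

Lemma vol_cube (a : E) (l : R) : 0 < l -> vol (cube a l) = l ^+ n.
Proof. by move=> l0; rewrite /vol leb_cube. Qed.

Lemma is_cube_vol Q : is_cube Q -> mu Q = (vol Q)%:E /\ 0 < vol Q.
Proof.
by move=> [l l0 [a ->]]; rewrite vol_cube// leb_cube// exprn_gt0.
Qed.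

Lemma is_cube_measurable (Q : set E) : is_cube Q -> measurable Q.
Proof. by move=> [l l0 [a ->]]; exact: measurable_cube. Qed.

Lemma is_cube_nonempty (Q : set E) : is_cube Q -> Q !=set0.
Proof. by move=> [l l0 [a ->]]; exists a => i; rewrite lexx/= ltrDl. Qed.

Section grid.
Variable D : set (set E).
Hypothesis gridD : dyadic_grid D.

Lemma dyadic_is_cube Q : D Q -> is_cube Q.
Proof.
have [h _ _] := gridD; move=> /h[k [a ->]]; exists (2 ^ k); last by exists a.
exact: exprz_gt0.
Qed.

Lemma dyadic_nested Q Q' : D Q -> D Q' -> Q `&` Q' !=set0 -> Q `<=` Q' \/ Q' `<=` Q.
Proof.
have [_ h _] := gridD; move=> DQ DQ' QQ'; have [E1|E1|E1] := h _ _ DQ DQ'.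
- by left; rewrite -E1; exact: subIsetr.
- by right; rewrite -E1; exact: subIsetl.
- by move: QQ'; rewrite E1 => -[].
Qed.

Lemma dyadic_laminar s : uniq s -> (forall Q, Q \in s -> D Q) -> laminar s.
Proof.
move=> us sD; split => // [Q /sD/dyadic_is_cube/is_cube_nonempty//|Q Q' Qs Q's].
by apply: dyadic_nested; exact: sD.
Qed.

(** The exponent of the side length. In positive dimension inclusion compares volumes and hence
    sides, and the partition at a fixed scale identifies nested cubes of equal side. The inductions
    over cubes run on this integer. *)
Lemma dyadic_scale : exists scale : set E -> int,
  [/\ forall Q Q', D Q -> D Q' -> Q `<=` Q' -> scale Q <= scale Q' &
      forall Q Q', D Q -> D Q' -> Q `<=` Q' -> scale Q = scale Q' -> Q = Q'].
Proof.
have [h _ part] := gridD.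
have /choice[scale scaleP] : forall Q, exists k : int, D Q ->
    exists a : E, Q = cube a (2 ^ k).
  move=> Q; have [DQ|nDQ] := pselect (D Q); last by exists 0.
  by have [k [a Qa]] := h _ DQ; exists k => _; exists a.
exists scale; split => Q Q' DQ DQ' QQ'.
  have muE P : D P -> mu P = ((2 ^ scale P) ^+ n)%:E.
    by move=> /scaleP[a {1}->]; rewrite leb_cube// exprz_gt0.
  have p k : 0 < (2 : R) ^ k by exact: exprz_gt0.
  have : (mu Q <= mu Q')%E.
    by apply: le_measure => //; rewrite inE; apply: is_cube_measurable; exact: dyadic_is_cube.
  rewrite !muE// lee_fin ler_pXn2r ?nnegrE ?(ltW (p _))//.
  by rewrite ler_eXz2l ?ltr1n.
move=> scE; have [x Qx] := is_cube_nonempty (dyadic_is_cube DQ).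
have [P [_ Puniq]] := part (scale Q) x.
rewrite -(Puniq Q); last by split => //; exact: scaleP.
by rewrite (Puniq Q')//; split => //; [rewrite scE; exact: scaleP|exact: QQ'].
Qed.

Section packing.
Variables (S : set (set E)) (delta : R).
Hypotheses (SD : S `<=` D) (sparseS : sparse delta S).

(** A cube that is not maximal below [R0] has a strictly larger one above it, and only finitely many
    scales lie between those of [Q] and [R0]. *)
Lemma children_above Q R0 : S Q -> S R0 -> Q `<` R0 ->
  exists2 R1, children S R0 R1 & Q `<=` R1.
Proof.
have [scale [scale_le scale_eq]] := dyadic_scale => SQ SR0.
have [N] := ubnP `|scale R0 - scale Q|%N; elim: N Q SQ => // N IH Q SQ sN QR0.
have [Qmax|] := pselect (forall Q'', S Q'' -> Q'' `<` R0 -> Q `<=` Q'' -> Q'' = Q).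
  by exists Q => //; split.
move=> /existsNP[Q1 /not_implyP[SQ1 /not_implyP[Q1R0 /not_implyP[QQ1 Q1Q]]]].
have leQ1 := scale_le _ _ (SD SQ) (SD SQ1) QQ1.
have leR0 := scale_le _ _ (SD SQ1) (SD SR0) (properW Q1R0).
have neQ1 : scale Q <> scale Q1.
  by move=> /(scale_eq _ _ (SD SQ) (SD SQ1) QQ1) QE; apply: Q1Q.
have sN1 : (`|(scale R0 - scale Q1)%R| < N)%N by lia.
have [R1 R1c Q1R1] := IH _ SQ1 sN1 Q1R0.
by exists R1 => //; exact: subset_trans Q1R1.
Qed.

(** The proper descendants lie below children of total volume at most [delta * vol R0], so L = 1 /
    (1 - delta) solves 1 + delta L = L. The induction runs on the distance from the scale of [R0] to
    a lower bound for the scales in [s]. *)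
Lemma sparse_packing s R0 : uniq s -> (forall Q, Q \in s -> S Q) -> S R0 ->
  \sum_(Q <- s | `[< Q `<=` R0 >]) vol Q <= (1 - delta)^-1 * vol R0.
Proof.
have [/andP[delta0 delta1] sp] := sparseS => us sS.
have [scale [scale_le scale_eq]] := dyadic_scale.
have cubeS Q : S Q -> is_cube Q by move=> /SD/dyadic_is_cube.
have L0 : 0 <= (1 - delta)^-1 by rewrite invr_ge0 subr_ge0 ltW.
have [kmin kminP] : exists k : int, forall Q, Q \in s -> k <= scale Q.
  exists (- (\max_(Q <- s) `|scale Q|%N)%:Z) => Q Qs.
  have := @leq_bigmax_seq _ s xpredT (fun Q => `|scale Q|%N) Q Qs isT.
  lia.
have [N] := ubnP `|scale R0 - kmin|%N; elim: N R0 => // N IH R0 hN SR0.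
pose below Q := (Q \in s) && `[< Q `<` R0 >].
have /choice[c cP] : forall Q, exists R1, below Q -> children S R0 R1 /\ Q `<=` R1.
  move=> Q; have [/andP[Qs /asboolP QR0]|nb] := boolP (below Q); last by exists Q.
  by have [R1 ? ?] := children_above (sS _ Qs) SR0 QR0; exists R1.
(* Only the finitely many children lying above some member of [s] are used; their volumes are a
   partial sum of the one in [sparse]. *)
pose cs := undup [seq c Q | Q <- s & below Q].
have csP R1 : R1 \in cs -> children S R0 R1 /\ exists2 Q, below Q & Q `<=` R1.
  rewrite mem_undup => /mapP[Q]; rewrite mem_filter => /andP[bQ _] ->.
  by have [? ?] := cP _ bQ; split => //; exists Q.
apply: (@le_trans _ _ (vol R0 + \sum_(R1 <- cs) \sum_(Q <- s | `[< Q `<=` R1 >]) vol Q)).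
  under [X in _ + X]eq_bigr do rewrite big_mkcond/=.
  rewrite exchange_big/=.
  pose single Q := if Q == R0 then vol R0 else 0.
  apply: (@le_trans _ _ (\sum_(Q <- s) (single Q +
      \sum_(R1 <- cs) if `[< Q `<=` R1 >] then vol Q else 0))).
    rewrite big_mkcond big_seq [leRHS]big_seq; apply: ler_sum => Q Qs.
    have s0 R1 : 0 <= if `[< Q `<=` R1 >] then vol Q else 0.
      by case: ifP => _ //; exact: vol_ge0.
    have sum0 : 0 <= \sum_(R1 <- cs) if `[< Q `<=` R1 >] then vol Q else 0.
      by apply: sumr_ge0.
    have single0 : 0 <= single Q by rewrite /single; case: eqP => // _; exact: vol_ge0.
    case: ifPn => [/asboolP QR0|_]; last exact: addr_ge0.
    rewrite /single; case: eqP => [QE|/eqP QR0E]; first by rewrite -QE lerDl.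
    have bQ : below Q by rewrite /below Qs; apply/asboolP; rewrite properEneq.
    have [_ QcQ] := cP _ bQ.
    have cQcs : c Q \in cs.
      by rewrite mem_undup; apply: map_f; rewrite mem_filter bQ.
    rewrite add0r (bigD1_seq (c Q)) ?undup_uniq//= asboolT// lerDl.
    exact: sumr_ge0.
  rewrite big_split/= lerD2r.
  rewrite -big_mkcond/=; have [R0s|R0s] := boolP (R0 \in s).
    by rewrite -big_filter filter_pred1_uniq// big_seq1.
  rewrite big_seq_cond big1 ?vol_ge0// => Q /andP[Qs /eqP QE].
  by move: R0s; rewrite -QE Qs.
have step : \sum_(R1 <- cs) \sum_(Q <- s | `[< Q `<=` R1 >]) vol Q <=
    (1 - delta)^-1 * \sum_(R1 <- cs) vol R1.
  rewrite mulr_sumr big_seq [leRHS]big_seq; apply: ler_sum => R1 /csP[].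
  move=> [SR1 R1R0 _] [Q /andP[Qs _] QR1]; apply: IH => //.
  have le1 := scale_le _ _ (SD SR1) (SD SR0) (properW R1R0).
  have le2 := scale_le _ _ (SD (sS _ Qs)) (SD SR1) QR1.
  have ne : scale R1 <> scale R0.
    move=> /(scale_eq _ _ (SD SR1) (SD SR0) (properW R1R0)) RE.
    by move: R1R0; rewrite RE properEneq => -[/eqP].
  have := kminP _ Qs; lia.
have csum : \sum_(R1 <- cs) vol R1 <= delta * vol R0.
  have [R0E volR0] := is_cube_vol (cubeS _ SR0).
  rewrite -lee_fin EFinM -R0E; apply: le_trans (sp _ SR0).
  apply: esum_ge; exists [set` cs].
    by split; [exact: finite_seq|move=> R1 /= /csP[]].
  rewrite -fsbig_seq ?undup_uniq// -sumEFin big_seq [leRHS]big_seq.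
  apply: lee_sum => R1 /csP[[SR1 _ _] _].
  by have [-> _] := is_cube_vol (cubeS _ SR1).
apply: (le_trans (lerD (lexx _) step)).
apply: (le_trans (lerD (lexx _) (ler_wpM2l L0 csum))).
by rewrite le_eqVlt; apply/orP; left; apply/eqP; field; rewrite subr_eq0 gt_eqF.
Qed.

End packing.
End grid.
End Cubes.

(** * Weights *)

Section Weights.
Context {R : realType} {n : nat}.
Local Notation E := (Rn R n).
Local Notation mu := (leb n).

(** By the partition property a cube is determined by its scale and any rational point in it. *)
Lemma dyadic_countable (D : set (set E)) : dyadic_grid D -> countable D.
Proof.
move=> [h _ part].
have /choice[f fP] : forall kt : int * n.-tuple rat, exists Q : set E,
    D Q /\ (exists a : E, Q = cube a (2 ^ kt.1)) /\
    Q [tuple ratr (tnth kt.2 i) | i < n].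
  move=> [k t]; have [Q [[DQ Qa Qx] _]] := part k [tuple ratr (tnth t i) | i < n].
  by exists Q.
apply: (@sub_countable _ _ D (f @` setT)); last first.
  by apply: card_le_trans (card_image_le _ _) _; exact: countableP.
apply: subset_card_le => Q DQ; have [k [a Qa]] := h _ DQ.
have l0 : 0 < (2 : R) ^ k by exact: exprz_gt0.
have /choice[t tP] : forall i : 'I_n, exists q : rat,
    ratr q \in `](tnth a i : R), ((tnth a i : R) + 2 ^ k)[.
  by move=> i; apply: rat_in_itvoo; rewrite ltrDl.
exists (k, [tuple t i | i < n]) => //.
have [DQ' [Qa' Qx]] := fP (k, [tuple t i | i < n]).
have [P [_ Puniq]] := part k [tuple ratr (tnth [tuple t i | i < n] i) | i < n].
rewrite -(Puniq (f _)); last by split.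
rewrite (Puniq Q)//; split => //; first by exists a.
rewrite Qa => i; have := tP i; rewrite in_itv/= !tnth_mktuple => /andP[ai ia].
by rewrite (ltW ai) ia.
Qed.

(** The integral of a nonnegative function is a supremum over simple functions below it, hence
    monotone for arbitrary functions. This serves [maximal] and the sparse operator, whose
    measurability is not established. *)
Lemma ge0_le_integral_pointwise d (T : measurableType d) (nu : {measure set T -> \bar R})
    (f g : T -> \bar R) :
  (forall x, (0 <= f x)%E) -> (forall x, (f x <= g x)%E) ->
  (\int[nu]_x f x <= \int[nu]_x g x)%E.
Proof.
move=> f0 fg; have g0 x : (0 <= g x)%E by exact: le_trans (fg x).
rewrite !ge0_integralTE//; apply: ereal_sup_le => _ [h hf <-].
by exists h => // x; exact: le_trans (hf x) (fg x).
Qed.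

Variable w : E -> R.
Hypothesis weightw : weight w.

(* A weight is only positive almost everywhere. *)
Definition pos_part (x : E) : R := Num.max (w x) 0.

Lemma pos_part_ge0 x : 0 <= pos_part x.
Proof. by rewrite le_max lexx orbT. Qed.

Lemma measurable_pos_part : measurable_fun [set: E] pos_part.
Proof. by have [mw _ _] := weightw; exact: measurable_maxr. Qed.

Lemma integral_pos_part (A : set E) (f : E -> R) : measurable A ->
  measurable_fun [set: E] f ->
  (\int[mu]_(x in A) (f x * w x)%:E = \int[mu]_(x in A) (f x * pos_part x)%:E)%E.
Proof.
move=> mA mf; have [mw _ wpos] := weightw.
apply: ae_eq_integral => //.
- apply/measurable_funTS/measurable_EFinP; exact: measurable_funM.
- apply/measurable_funTS/measurable_EFinP; apply: measurable_funM => //.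
  exact: measurable_pos_part.
by apply: filterS wpos => x wx _; rewrite /pos_part max_l// ltW.
Qed.

Lemma integral_cube_pos_part (A : set E) : measurable A ->
  (\int[mu]_(x in A) (w x)%:E = \int[mu]_(x in A) (pos_part x)%:E)%E.
Proof.
move=> mA; have := @integral_pos_part A (fun=> 1) mA (measurable_cst _).
by under eq_integral do rewrite mul1r; under [RHS]eq_integral do rewrite mul1r.
Qed.

Lemma integral_pos_part_lty Q : is_cube Q -> (\int[mu]_(x in Q) (pos_part x)%:E < +oo)%E.
Proof.
move=> cQ; have mQ := is_cube_measurable cQ; have [mw locw _] := weightw.
rewrite -integral_cube_pos_part//.
by have := integrable_lty mQ (locw _ cQ).
Qed.

Lemma mass_pos_partE Q : is_cube Q ->
  ((mass mu pos_part Q)%:E = \int[mu]_(x in Q) (pos_part x)%:E)%E.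
Proof.
move=> cQ; rewrite fineK// ge0_fin_numE ?integral_pos_part_lty//.
by apply: integral_ge0 => x _; rewrite lee_fin pos_part_ge0.
Qed.

Lemma mass_pos_part_gt0 Q : is_cube Q -> 0 < mass mu pos_part Q.
Proof.
move=> cQ; have mQ := is_cube_measurable cQ; have [mw locw wpos] := weightw.
rewrite lt_neqAle mass_ge0 ?andbT; last exact: pos_part_ge0.
apply/eqP => /esym mass0.
have int0 : (\int[mu]_(x in Q) `|(pos_part x)%:E| = 0)%E.
  under eq_integral do rewrite gee0_abs ?lee_fin ?pos_part_ge0//.
  by rewrite -mass_pos_partE// mass0.
have mp : measurable_fun Q (fun x => (pos_part x)%:E).
  apply/measurable_funTS/measurable_EFinP; exact: measurable_pos_part.
have ae0 := (ae_eq_integral_abs mu mQ mp).1 int0.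
have : mu.-negligible Q.
  have : {ae mu, forall x, ~ Q x}.
    apply: filterS2 wpos ae0 => x wx h Qx; have := h Qx.
    by move=> /eqP; rewrite eqe /pos_part max_l ?(ltW wx)// gt_eqF.
  by apply: negligibleS => x Qx; apply.
move=> /(measure_negligible mQ) muQ.
by have [] := is_cube_vol cQ; rewrite muQ => -[<-]; rewrite ltxx.
Qed.

Lemma avg_weight Q : is_cube Q ->
  avg (EFin \o w) Q = (mass mu pos_part Q / vol Q)%:E.
Proof.
move=> cQ; have [volE vol0] := is_cube_vol cQ; have mQ := is_cube_measurable cQ.
rewrite /avg volE integral_cube_pos_part// -mass_pos_partE//.
by rewrite inver gt_eqF// -EFinM mulrC.
Qed.

Lemma avg_ge0 (f : E -> \bar R) Q : (forall x, (0 <= f x)%E) -> (0 <= avg f Q)%E.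
Proof.
by move=> f0; rewrite /avg mule_ge0 ?inve_ge0 ?measure_ge0// integral_ge0.
Qed.

Lemma maximal_ge0 (f : E -> R) x : (0 <= maximal f x)%E.
Proof.
apply: le_trans (ereal_sup_ubound _); last first.
  exists (cube x 1) => //; split; first by exists 1 => //; exists x.
  by move=> i; rewrite lexx/= ltrDl.
by apply: avg_ge0.
Qed.

Lemma Ainfty_const_ge0 : (0 <= Ainfty_const w)%E.
Proof.
pose Q0 : set E := cube [tuple 0 | i < n] 1.
have cQ : is_cube Q0 by exists 1 => //; exists [tuple 0 | i < n].
apply: le_trans (ereal_sup_ubound _); last by exists Q0.
have mQ := is_cube_measurable cQ.
rewrite mule_ge0 ?integral_ge0//; last by move=> x _; exact: maximal_ge0.
rewrite inve_ge0 integral_cube_pos_part// integral_ge0// => x _.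
by rewrite lee_fin pos_part_ge0.
Qed.

Lemma Ainfty_const_bound (Q : set E) : is_cube Q -> (Ainfty_const w < +oo)%E ->
  (\int[mu]_(x in Q) maximal (fun y => w y * \1_Q y)%R x <=
   (fine (Ainfty_const w) * mass mu pos_part Q)%:E)%E.
Proof.
move=> cQ Aoo; have mQ := is_cube_measurable cQ; have WQ := mass_pos_part_gt0 cQ.
rewrite EFinM fineK ?ge0_fin_numE ?Ainfty_const_ge0//.
rewrite muleC -lee_pdivrMl// -[X in (X <= _)%E]/_.
apply: ereal_sup_ubound; exists Q => //.
by rewrite integral_cube_pos_part// -mass_pos_partE// inver gt_eqF.
Qed.

Lemma mean_le_maximal (Q Q' : set E) x : is_cube Q' -> Q' `<=` Q -> Q' x ->
  ((mass mu pos_part Q' / vol Q')%:E <= maximal (fun y => w y * \1_Q y)%R x)%E.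
Proof.
move=> cQ' Q'Q Q'x; have [volE vol0] := is_cube_vol cQ'.
have mQ' := is_cube_measurable cQ'; have [mw _ _] := weightw.
apply: le_trans (ereal_sup_ubound _); last by exists Q'.
rewrite /avg volE inver gt_eqF// mulrC EFinM lee_pmul2l ?lte_fin ?invr_gt0//.
rewrite mass_pos_partE//; apply: ge0_le_integral => //.
- by move=> y _; rewrite lee_fin pos_part_ge0.
- by apply/measurable_funTS/measurable_EFinP; exact: measurable_pos_part.
- apply/measurable_EFinP/measurableT_comp => //.
  apply: (eq_measurable_fun w); last exact: measurable_funTS.
  by move=> y /set_mem/Q'Q Qy; rewrite indicE mem_set// mulr1.
- move=> y /Q'Q Qy; rewrite lee_fin indicE mem_set// mulr1 /pos_part.
  by rewrite ge_max normr_ge0 ler_norm.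
Qed.

(** Packing bounds the sum by [L] times the integral of the maximal mean over the family below [R0],
    which is at most that of M(w 1_R0) over [R0]. This is the exponent 1, out of reach of Doob's
    inequality; the Fujii-Wilson constant takes its place. *)
Lemma Ainfty_carleson (s : seq (set E)) (L : R) R0 : (Ainfty_const w < +oo)%E -> laminar s ->
  (forall Q, Q \in s -> is_cube Q) -> 0 <= L ->
  (forall Q, Q \in s -> \sum_(Q' <- s | `[< Q' `<=` Q >]) vol Q' <= L * vol Q) ->
  R0 \in s ->
  \sum_(Q <- s | `[< Q `<=` R0 >]) mass mu pos_part Q <=
  L * fine (Ainfty_const w) * mass mu pos_part R0.
Proof.
move=> Aoo lam cs L0 packing R0s.
pose s' := [seq Q <- s | `[< Q `<=` R0 >]].
have s's Q : Q \in s' -> Q \in s by rewrite mem_filter => /andP[].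
have lam' : laminar s' by exact: laminar_filter.
have ms' Q : Q \in s' -> measurable Q by move=> /s's/cs/is_cube_measurable.
pose v Q := mass mu pos_part Q / vol Q.
have packing' Q : Q \in s' -> \sum_(Q' <- s' | `[< Q' `<=` Q >]) vol Q' <= L * vol Q.
  move=> /s's Qs; apply: le_trans (packing _ Qs); rewrite big_filter_cond.
  rewrite [leLHS]big_mkcond [leRHS]big_mkcond/=; apply: ler_sum => Q' _.
  by case: asboolP => //=; case: ifP => // _ _; exact: vol_ge0.
have h1 := powR_maxval_carleson (v := v) ltr01 L0 lam' packing' (lexx _).
rewrite -big_filter -/s' -mulrA.
apply: (@le_trans _ _ (\sum_(Q <- s') maxval v (supersets s' Q) `^ 1 * vol Q)).
  rewrite big_seq [leRHS]big_seq; apply: ler_sum => Q Qs'.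
  have [_ volQ] := is_cube_vol (cs _ (s's _ Qs')).
  rewrite powRr1 ?maxval_ge0// -ler_pdivrMr//.
  exact: (@supersets_le _ _ v).
apply: (le_trans h1); apply: ler_wpM2l => //.
have mass1 Q : Q \in s' -> mass mu (fun=> 1) Q = vol Q.
  move=> Qs'; have [volE volQ] := is_cube_vol (cs _ (s's _ Qs')).
  rewrite /mass integral_cst; last exact: ms'.
  by rewrite mul1e.
rewrite big_seq.
under eq_bigr => Q Qs' do rewrite -mass1//.
have oneoo Q : Q \in s' -> (\int[mu]_(x in Q) 1%:E < +oo)%E.
  move=> Qs'; have [volE volQ] := is_cube_vol (cs _ (s's _ Qs')).
  rewrite integral_cst; last exact: ms'.
  by rewrite mul1e [X in (X < _)%E]volE ltry.
rewrite -big_seq -lee_fin.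
rewrite (@sum_increment_integral _ _ _ mu s' lam' ms' v 1 (fun=> 1) ltr01
  (measurable_cst _) (fun=> ler01) oneoo).
apply: le_trans (Ainfty_const_bound (cs _ R0s) Aoo).
rewrite [leRHS]integral_mkcond; apply: ge0_le_integral_pointwise => x.
  by rewrite lee_fin mulr1 powR_ge0.
rewrite mulr1 powRr1 ?maxval_ge0// patchE; case: ifPn => [_|xR0]; last first.
  rewrite lee_fin maxval_le// => Q; rewrite mem_filter => /andP[xQ].
  rewrite mem_filter => /andP[/asboolP QR0 _].
  by move: xR0; rewrite notin_setE => /(_ (QR0 _ (set_mem xQ))).
have := maximal_ge0 (fun y => w y * \1_R0 y) x.
have : forall Q, Q \in [seq Q <- s' | x \in Q] ->
    ((v Q)%:E <= maximal (fun y => w y * \1_R0 y)%R x)%E.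
  move=> Q; rewrite mem_filter => /andP[/set_mem xQ].
  rewrite mem_filter => /andP[/asboolP QR0 Qs].
  by apply: mean_le_maximal => //; exact: cs.
case: (maximal _ _) => [M|_ _|_]; last 2 first.
- by rewrite leey.
- by rewrite leeNy_eq.
by move=> h M0; rewrite lee_fin; apply: maxval_le => // Q /h.
Qed.

End Weights.

(** * Taking roots and absorbing the integral *)

Section Absorption.
Context {R : realType}.

(** Comparison with the largest of the three, which covers both e = 1/r <= 1 and e = 1/r > 1. *)
Lemma powR_add3_le (e x y z : R) : 0 < e -> 0 <= x -> 0 <= y -> 0 <= z ->
  (x + y + z) `^ e <= 3 `^ e * (x `^ e + y `^ e + z `^ e).
Proof.
move=> e0 x0 y0 z0; pose m := Num.max x (Num.max y z).
have m0 : 0 <= m by rewrite le_max x0.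
have xm : x <= m by rewrite le_max lexx.
have ym : y <= m by rewrite !le_max lexx orbT.
have zm : z <= m by rewrite !le_max lexx !orbT.
apply: (@le_trans _ _ ((3 * m) `^ e)).
  by rewrite ge0_ler_powR ?nnegrE ?(ltW e0) ?addr_ge0 ?mulr_ge0//; lra.
rewrite powRM// ler_wpM2l ?powR_ge0// /m.
have [xp yp zp] : [/\ 0 <= x `^ e, 0 <= y `^ e & 0 <= z `^ e] by rewrite !powR_ge0.
by case: (leP x (Num.max y z)) => _; [case: (leP y z) => _|]; lra.
Qed.

Variables (q1 q2 q r : R).
Hypotheses (q11 : 1 < q1) (q21 : 1 < q2) (qq : q^-1 = q1^-1 + q2^-1) (r0 : 0 < r).

Let q1_gt0 : 0 < q1. Proof. exact: lt_trans ltr01 q11. Qed.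
Let q2_gt0 : 0 < q2. Proof. exact: lt_trans ltr01 q21. Qed.
Let q_gt0 : 0 < q. Proof. by rewrite -invr_gt0 qq addr_gt0// invr_gt0. Qed.

Lemma concave_root (I A L K1 K2 C1 C2 N1 N2 : R) :
  0 <= I -> 0 <= A -> 0 <= L -> 0 <= K1 -> 0 <= K2 -> 0 <= C1 -> 0 <= C2 ->
  0 <= N1 -> 0 <= N2 ->
  I <= A * ((L * K1 * (C1 * N1)) `^ (q / q1) * (L * K2 * (C2 * N2)) `^ (q / q2)) ->
  I `^ q^-1 <= (L * C1) `^ q1^-1 * (L * C2) `^ q2^-1 *
    (A `^ q^-1 * (K1 `^ q1^-1 * K2 `^ q2^-1) * (N1 `^ q1^-1 * N2 `^ q2^-1)).
Proof.
move=> I0 A0 L0 K10 K20 C10 C20 N10 N20 hI.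
have P0 : 0 <= A * ((L * K1 * (C1 * N1)) `^ (q / q1) * (L * K2 * (C2 * N2)) `^ (q / q2)).
  by rewrite !mulr_ge0 ?powR_ge0.
have qV : 0 <= q^-1 by rewrite invr_ge0 ltW.
apply: (le_trans (ge0_ler_powR qV I0 P0 hI)).
have eE p : q / p * q^-1 = p^-1 by rewrite mulrAC divff ?mul1r ?gt_eqF.
have LC1 := mulr_ge0 L0 C10; have LC2 := mulr_ge0 L0 C20.
have KN1 := mulr_ge0 K10 N10; have KN2 := mulr_ge0 K20 N20.
rewrite (powRM _ A0 (mulr_ge0 (powR_ge0 _ _) (powR_ge0 _ _))).
rewrite (powRM _ (powR_ge0 _ _) (powR_ge0 _ _)) -!powRrM !eE.
rewrite (mulrACA L K1) (mulrACA L K2) (powRM _ LC1 KN1) (powRM _ LC2 KN2).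
rewrite (powRM _ K10 N10) (powRM _ K20 N20).
have regroup (a l1 l2 k1 k2 m1 m2 : R) : a * (l1 * (k1 * m1) * (l2 * (k2 * m2))) =
  l1 * l2 * (a * (k1 * k2) * (m1 * m2)) by ring.
by rewrite regroup.
Qed.

(** As a3 = 1 - r/q, cancelling I^a3 leaves I^(r/q). The power 1/r then gives I^(1/q) and turns a1,
    a2, a3 into 1/q1, 1/q2, 1/r - 1/q. *)
Lemma convex_absorb (I A L K1 K2 K3 C1 C2 C3 M N1 N2 : R)
    (a1 := r / q1) (a2 := r / q2) (a3 := 1 - r / q) : r < q ->
  0 <= I -> 0 <= A -> 1 <= L -> 0 <= K1 -> 0 <= K2 -> 0 <= K3 ->
  0 <= C1 -> 0 <= C2 -> 0 <= C3 -> 0 <= M -> 0 <= N1 -> 0 <= N2 ->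
  I <= 2 * A `^ (r / q) * (M * ((L * K2) `^ a2 * (L * K3) `^ a3 +
      (L * K1) `^ a1 * (L * K3) `^ a3 + (L * K1) `^ a1 * (L * K2) `^ a2) *
    ((C1 * N1) `^ a1 * (C2 * N2) `^ a2 * (C3 * I) `^ a3)) ->
  I `^ q^-1 <= (2 * M * L * (C1 `^ a1 * C2 `^ a2 * C3 `^ a3)) `^ r^-1 * 3 `^ r^-1 *
    (A `^ q^-1 * (K1 `^ q1^-1 * K2 `^ q2^-1 +
      K3 `^ (r^-1 - q^-1) * (K2 `^ q2^-1 + K1 `^ q1^-1)) *
    (N1 `^ q1^-1 * N2 `^ q2^-1)).
Proof.
move=> rq I0 A0 L1 K10 K20 K30 C10 C20 C30 M0 N10 N20 hI.
have L0 : 0 <= L by exact: le_trans ler01 L1.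
have rq0 : 0 < r / q by rewrite divr_gt0.
have rq1 : r / q < 1 by rewrite ltr_pdivrMr// mul1r.
have a10 : 0 < a1 by rewrite divr_gt0.
have a20 : 0 < a2 by rewrite divr_gt0.
have a30 : 0 < a3 by rewrite subr_gt0.
have asum : a1 + a2 + a3 = 1.
  have -> : a1 + a2 = r / q by rewrite /a1 /a2 -mulrDr -qq.
  by rewrite /a3 addrC subrK.
have [->|Ipos] := eqVneq I 0.
  rewrite powR0 ?invr_eq0 ?gt_eqF//.
  by rewrite !(mulr_ge0, addr_ge0) ?powR_ge0.
have {}Ipos : 0 < I by rewrite lt_neqAle eq_sym Ipos.
pose P := K2 `^ a2 * K3 `^ a3 + K1 `^ a1 * K3 `^ a3 + K1 `^ a1 * K2 `^ a2.
have P0 : 0 <= P by rewrite /P !addr_ge0// mulr_ge0 ?powR_ge0.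
(* With [1 <= L] and exponents of sum at most 1, the factors [L] leave each pair as at most one
   [L]. *)
have pairL a b K K' : 0 <= K -> 0 <= K' -> 0 < a -> 0 < b -> a + b <= 1 ->
    (L * K) `^ a * (L * K') `^ b <= L * (K `^ a * K' `^ b).
  move=> K0 K'0 a0 b0 ab1; rewrite (powRM _ L0 K0) (powRM _ L0 K'0) mulrACA.
  apply: ler_wpM2r; first exact: mulr_ge0 (powR_ge0 _ _) (powR_ge0 _ _).
  rewrite -powRD; last by rewrite gt_eqF// addr_gt0.
  by rewrite -[leRHS](powRr1 L0); exact: ler_powR.
have pairsL : (L * K2) `^ a2 * (L * K3) `^ a3 + (L * K1) `^ a1 * (L * K3) `^ a3 +
    (L * K1) `^ a1 * (L * K2) `^ a2 <= L * P.
  rewrite /P !mulrDr; apply: lerD; first apply: lerD; apply: pairL => //; lra.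
pose D := 2 * M * L * (C1 `^ a1 * C2 `^ a2 * C3 `^ a3) *
  (A `^ (r / q) * P * (N1 `^ a1 * N2 `^ a2)).
have ID : I <= D * I `^ a3.
  apply: (le_trans hI).
  rewrite (powRM _ C10 N10) (powRM _ C20 N20) (powRM _ C30 I0).
  apply: (@le_trans _ _ (2 * A `^ (r / q) * (M * (L * P) *
      (C1 `^ a1 * N1 `^ a1 * (C2 `^ a2 * N2 `^ a2) * (C3 `^ a3 * I `^ a3))))).
    apply: ler_wpM2l; first by rewrite mulr_ge0// powR_ge0.
    apply: ler_wpM2r; first by rewrite !mulr_ge0 ?powR_ge0.
    exact: ler_wpM2l.
  have regroup (a c1 c2 c3 b m1 m2 i : R) :
      2 * a * (M * (L * b) * (c1 * m1 * (c2 * m2) * (c3 * i))) =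
      2 * M * L * (c1 * c2 * c3) * (a * b * (m1 * m2)) * i by ring.
  by rewrite regroup.
have {}ID : I `^ (r / q) <= D.
  have Ia0 : 0 < I `^ a3 by rewrite powR_gt0.
  rewrite -(ler_pM2r Ia0) -powRD; last by rewrite (gt_eqF Ipos) implybT.
  by rewrite /a3 addrC subrK powRr1.
have rV : 0 < r^-1 by rewrite invr_gt0.
have -> : q^-1 = r / q / r by rewrite mulrAC divff ?mul1r ?gt_eqF.
rewrite {1}powRrM; apply: (le_trans (ge0_ler_powR (ltW rV) (powR_ge0 _ _) _ ID)).
  by rewrite nnegrE; exact: le_trans (powR_ge0 _ _) ID.
have -> : r / q / r = q^-1 by rewrite mulrAC divff ?mul1r ?gt_eqF.
have C0 : 0 <= 2 * M * L * (C1 `^ a1 * C2 `^ a2 * C3 `^ a3).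
  by rewrite !mulr_ge0 ?powR_ge0.
have aE p : r / p / r = p^-1 by rewrite mulrAC divff ?mul1r ?gt_eqF.
have AP0 : 0 <= A `^ (r / q) * P by rewrite mulr_ge0 ?powR_ge0.
have NN0 : 0 <= N1 `^ a1 * N2 `^ a2 by rewrite mulr_ge0 ?powR_ge0.
rewrite /D (powRM _ C0 (mulr_ge0 AP0 NN0)) (powRM _ AP0 NN0).
rewrite (powRM _ (powR_ge0 A _) P0) (powRM _ (powR_ge0 N1 _) (powR_ge0 N2 _)) -!powRrM !aE.
have PV : P `^ r^-1 <= 3 `^ r^-1 * (K1 `^ q1^-1 * K2 `^ q2^-1 +
    K3 `^ (r^-1 - q^-1) * (K2 `^ q2^-1 + K1 `^ q1^-1)).
  apply: (le_trans (powR_add3_le rV (mulr_ge0 (powR_ge0 _ _) (powR_ge0 _ _))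
    (mulr_ge0 (powR_ge0 _ _) (powR_ge0 _ _)) (mulr_ge0 (powR_ge0 _ _) (powR_ge0 _ _)))).
  apply: ler_wpM2l; first exact: powR_ge0.
  rewrite !(powRM _ (powR_ge0 _ _) (powR_ge0 _ _)) -!powRrM !aE.
  have -> : a3 / r = r^-1 - q^-1 by rewrite /a3 mulrBl mul1r aE.
  have regroup (k1 k2 k3 : R) : k2 * k3 + k1 * k3 + k1 * k2 = k1 * k2 + k3 * (k2 + k1).
    by ring.
  by rewrite regroup.
have regroup (c t a k m : R) : c * t * (a * k * m) = c * (a * (t * k) * m) by ring.
rewrite [leRHS]regroup; apply: ler_wpM2l; first exact: powR_ge0.
apply: ler_wpM2r; first exact: mulr_ge0 (powR_ge0 _ _) (powR_ge0 _ _).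
by apply: ler_wpM2l PV; exact: powR_ge0.
Qed.

End Absorption.

(** * Finite sparse families *)

Section DoobWeight.
Context {R : realType} {n : nat}.
Local Notation E := (Rn R n).
Local Notation mu := (leb n).
Variables (w : E -> R) (s : seq (set E)) (g : E -> R) (q : R).
Hypotheses (weightw : weight w) (lam : laminar s)
  (cubes : forall Q, Q \in s -> is_cube Q) (q1 : 1 < q)
  (mg : measurable_fun [set: E] g) (g0 : forall x, 0 <= g x)
  (goo : (\int[mu]_x (g x `^ q * pos_part w x)%:E < +oo)%E).
Local Notation W := (pos_part w).

Let mW := measurable_pos_part weightw.
Let W0 := pos_part_ge0 w.

Let mgq : measurable_fun [set: E] (fun x => g x `^ q * W x).
Proof. apply: measurable_funM => //; exact: (measurableT_comp (measurable_powR q) mg). Qed.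

(** Pointwise g <= 1 + g^q, and [W] is integrable over cubes. *)
Lemma integral_weight_lty Q : is_cube Q -> (\int[mu]_(x in Q) (g x * W x)%:E < +oo)%E.
Proof.
move=> cQ; have mQ := is_cube_measurable cQ.
have gq0 x : 0 <= g x `^ q * W x by rewrite mulr_ge0 ?powR_ge0.
apply: (@le_lt_trans _ _ (\int[mu]_(x in Q) ((W x)%:E + (g x `^ q * W x)%:E))%E).
  apply: ge0_le_integral => //.
  - by move=> x _; rewrite lee_fin mulr_ge0.
  - by apply/measurable_funTS/measurable_EFinP; exact: measurable_funM.
  - by apply: emeasurable_funD; apply/measurable_funTS/measurable_EFinP.
  move=> x _; rewrite -EFinD lee_fin -[X in _ <= X + _]mul1r -mulrDl ler_wpM2r//.
  have [gx1|gx1] := leP (g x) 1; first by rewrite (le_trans gx1)// lerDl powR_ge0.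
  by rewrite (le_trans (le1r_powR (ltW gx1) (ltW q1)))// lerDr.
rewrite ge0_integralD//; last 4 first.
- by move=> x _; rewrite lee_fin.
- by apply/measurable_funTS/measurable_EFinP.
- by move=> x _; rewrite lee_fin.
- by apply/measurable_funTS/measurable_EFinP.
rewrite lte_add_pinfty ?integral_pos_part_lty//.
apply: le_lt_trans goo; apply: ge0_subset_integral => //.
  exact/measurable_EFinP.
by move=> x _; rewrite lee_fin.
Qed.

Lemma doob_weight :
  \sum_(Q <- s) increment (fun l => maxval (wavg mu W g) l `^ q) s Q * mass mu W Q <=
  (2 * (q / (q - 1))) `^ q * fine (\int[mu]_x (g x `^ q * W x)%:E).
Proof.
have ms Q : Q \in s -> measurable Q by move=> /cubes/is_cube_measurable.
rewrite -lee_fin EFinM fineK; last first.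
  rewrite ge0_fin_numE// integral_ge0// => x _.
  by rewrite lee_fin mulr_ge0 ?powR_ge0.
apply: doob_increment => //.
- by move=> Q /cubes/(integral_pos_part_lty weightw).
- by move=> Q /cubes/(mass_pos_part_gt0 weightw).
- by move=> Q /cubes; exact: integral_weight_lty.
Qed.

Lemma carleson_embedding (L : R) : (Ainfty_const w < +oo)%E -> 0 <= L ->
  (forall Q, Q \in s -> \sum_(Q' <- s | `[< Q' `<=` Q >]) vol Q' <= L * vol Q) ->
  \sum_(Q <- s) wavg mu W g Q `^ q * mass mu W Q <=
  L * fine (Ainfty_const w) *
  ((2 * (q / (q - 1))) `^ q * fine (\int[mu]_x (g x `^ q * W x)%:E)).
Proof.
move=> Aoo L0 packing; have q0 : 0 < q := lt_trans ltr01 q1.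
have K0 : 0 <= L * fine (Ainfty_const w).
  by rewrite mulr_ge0// fine_ge0// Ainfty_const_ge0.
have := powR_maxval_carleson q0 K0 lam _ doob_weight => h.
apply: le_trans (h _); last by move=> Q Qs; exact: Ainfty_carleson.
rewrite big_seq [leRHS]big_seq; apply: ler_sum => Q Qs.
rewrite ler_wpM2r ?mass_ge0// ge0_ler_powR ?nnegrE ?maxval_ge0 ?(ltW q0)//.
  by rewrite divr_ge0// mass_ge0// => x; rewrite mulr_ge0.
exact: (@supersets_le _ _ (wavg mu W g)).
Qed.

End DoobWeight.

(** * The cases q <= r and q > r for a finite family *)

Section FiniteFamily.
Context {R : realType} {n : nat}.
Local Notation E := (Rn R n).
Local Notation mu := (leb n).
Variables (w sigma1 sigma2 : E -> R) (s : seq (set E)) (g1 g2 : E -> R).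
Variables (q1 q2 q r L A : R).
Hypotheses (ww : weight w) (wsigma1 : weight sigma1) (wsigma2 : weight sigma2)
  (Aw : (Ainfty_const w < +oo)%E) (Asigma1 : (Ainfty_const sigma1 < +oo)%E)
  (Asigma2 : (Ainfty_const sigma2 < +oo)%E).
Hypotheses (lam : laminar s) (cubes : forall Q, Q \in s -> is_cube Q) (L0 : 0 <= L)
  (packing : forall Q, Q \in s ->
     \sum_(Q' <- s | `[< Q' `<=` Q >]) vol Q' <= L * vol Q).
Hypotheses (q11 : 1 < q1) (q21 : 1 < q2) (qq : q^-1 = q1^-1 + q2^-1) (r0 : 0 < r).
Hypotheses (mg1 : measurable_fun [set: E] g1) (mg2 : measurable_fun [set: E] g2)
  (g10 : forall x, 0 <= g1 x) (g20 : forall x, 0 <= g2 x).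
Local Notation W3 := (pos_part w).
Local Notation W1 := (pos_part sigma1).
Local Notation W2 := (pos_part sigma2).
Local Notation K3 := (fine (Ainfty_const w)).
Local Notation K1 := (fine (Ainfty_const sigma1)).
Local Notation K2 := (fine (Ainfty_const sigma2)).
Hypotheses (g1oo : (\int[mu]_x (g1 x `^ q1 * W1 x)%:E < +oo)%E)
  (g2oo : (\int[mu]_x (g2 x `^ q2 * W2 x)%:E < +oo)%E).
Let N1 := fine (\int[mu]_x (g1 x `^ q1 * W1 x)%:E).
Let N2 := fine (\int[mu]_x (g2 x `^ q2 * W2 x)%:E).
Let C1 := (2 * (q1 / (q1 - 1))) `^ q1.
Let C2 := (2 * (q2 / (q2 - 1))) `^ q2.

Hypotheses (A0 : 0 < A) (Abound : forall Q, Q \in s ->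
  (mass mu W3 Q / vol Q) *
  ((mass mu W1 Q / vol Q) `^ (q - q / q1) * (mass mu W2 Q / vol Q) `^ (q - q / q2)) <= A).

Definition mean (W g : E -> R) (Q : set E) : R := mass mu (fun x => g x * W x) Q / vol Q.

Let u1 := mean W1 g1.
Let u2 := mean W2 g2.
Let coef (Q : set E) := (u1 Q * u2 Q) `^ r.

Definition sparse_sum (x : E) : R := \sum_(Q <- s | x \in Q) coef Q.

Let T := sparse_sum.

Let ms Q : Q \in s -> measurable Q. Proof. by move=> /cubes/is_cube_measurable. Qed.

Let q_gt0 : 0 < q.
Proof. by rewrite -invr_gt0 qq addr_gt0// invr_gt0 (lt_trans ltr01). Qed.

Let q1_gt0 : 0 < q1. Proof. exact: lt_trans ltr01 q11. Qed.
Let q2_gt0 : 0 < q2. Proof. exact: lt_trans ltr01 q21. Qed.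

Let q12 : q / q1 + q / q2 = 1.
Proof. by rewrite -mulrDr -qq divff// gt_eqF. Qed.

Let T0 x : 0 <= T x.
Proof. by apply: sumr_ge0 => Q _; exact: powR_ge0. Qed.

Let mT : measurable_fun [set: E] T.
Proof. exact: measurable_sum_mem. Qed.

Let W30 := pos_part_ge0 w.
Let W10 := pos_part_ge0 sigma1.
Let W20 := pos_part_ge0 sigma2.
Let mW3 := measurable_pos_part ww.

Let u1E Q : Q \in s -> u1 Q = wavg mu W1 g1 Q * (mass mu W1 Q / vol Q).
Proof.
move=> /cubes cQ; rewrite /u1 /mean /wavg mulrA divfK// gt_eqF//.
exact: mass_pos_part_gt0.
Qed.

Let u2E Q : Q \in s -> u2 Q = wavg mu W2 g2 Q * (mass mu W2 Q / vol Q).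
Proof.
move=> /cubes cQ; rewrite /u2 /mean /wavg mulrA divfK// gt_eqF//.
exact: mass_pos_part_gt0.
Qed.

Let wavg_ge0 (W g : E -> R) Q : (forall x, 0 <= W x) -> (forall x, 0 <= g x) ->
  0 <= wavg mu W g Q.
Proof. by move=> W0 g0; rewrite divr_ge0// mass_ge0// => x; rewrite mulr_ge0. Qed.

Lemma sum_coef_mass (c : set E -> R) : (forall Q, 0 <= c Q) ->
  (\sum_(Q <- s) c Q * mass mu W3 Q)%R%:E =
  (\int[mu]_x ((\sum_(Q <- s | x \in Q) c Q) * W3 x)%:E)%E.
Proof.
move=> c0; apply: sum_mass_integral => // Q /cubes.
exact: integral_pos_part_lty.
Qed.

Lemma sparse_sum_concave : q <= r ->
  (\int[mu]_x (T x `^ (q / r) * W3 x)%:E <=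
   (A * ((L * K1 * (C1 * N1)) `^ (q / q1) * (L * K2 * (C2 * N2)) `^ (q / q2)))%:E)%E.
Proof.
move=> qr.
have t0 : 0 < q / r by rewrite divr_gt0.
apply: (@le_trans _ _ (\int[mu]_x
    ((\sum_(Q <- s | x \in Q) (u1 Q * u2 Q) `^ q) * W3 x)%:E)%E).
  apply: ge0_le_integral_pointwise => x; first by rewrite lee_fin mulr_ge0 ?powR_ge0.
  rewrite lee_fin ler_wpM2r// /T /sparse_sum /coef.
  apply: le_trans (powR_sum_le _ _ _ _) _.
  - by rewrite t0 ler_pdivrMr// mul1r.
  - by move=> Q; exact: powR_ge0.
  have rq : r * (q / r) = q by rewrite mulrCA divff ?mulr1// gt_eqF.
  by apply: ler_sum => Q _; rewrite -powRrM rq.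
rewrite -sum_coef_mass; last by move=> Q; exact: powR_ge0.
rewrite lee_fin.
set x1 := wavg mu W1 g1; set x2 := wavg mu W2 g2.
pose f1 Q := x1 Q `^ q1 * mass mu W1 Q; pose f2 Q := x2 Q `^ q2 * mass mu W2 Q.
have x10 Q : 0 <= x1 Q by exact: wavg_ge0.
have x20 Q : 0 <= x2 Q by exact: wavg_ge0.
have f10 Q : 0 <= f1 Q by rewrite mulr_ge0 ?powR_ge0 ?mass_ge0.
have f20 Q : 0 <= f2 Q by rewrite mulr_ge0 ?powR_ge0 ?mass_ge0.
apply: (@le_trans _ _ (\sum_(Q <- s) A * (f1 Q `^ (q / q1) * f2 Q `^ (q / q2)))).
  rewrite big_seq [leRHS]big_seq; apply: ler_sum => Q Qs.
  have cQ := cubes Qs; have [_ volQ] := is_cube_vol cQ.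
  have M10 := mass_pos_part_gt0 wsigma1 cQ; have M20 := mass_pos_part_gt0 wsigma2 cQ.
  set m1 := mass mu W1 Q / vol Q; set m2 := mass mu W2 Q / vol Q.
  have m10 : 0 < m1 by rewrite divr_gt0.
  have m20 : 0 < m2 by rewrite divr_gt0.
  have fE x M p : 0 <= x -> 0 <= M -> 0 < p ->
      (x `^ p * M) `^ (q / p) = x `^ q * ((M / vol Q) `^ (q / p) * vol Q `^ (q / p)).
    move=> x0 M0 p0; rewrite powRM ?powR_ge0// -powRrM (mulrC p) divfK ?gt_eqF//.
    by rewrite -powRM ?divr_ge0 ?(ltW volQ)// divfK ?gt_eqF.
  rewrite (fE _ _ _ (x10 Q) (ltW M10) q1_gt0) (fE _ _ _ (x20 Q) (ltW M20) q2_gt0).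
  rewrite u1E// u2E// -/x1 -/x2 -/m1 -/m2.
  rewrite (powRM _ (mulr_ge0 (x10 Q) (ltW m10)) (mulr_ge0 (x20 Q) (ltW m20))).
  rewrite (powRM _ (x10 Q) (ltW m10)) (powRM _ (x20 Q) (ltW m20)).
  (* The first power enters the A_P product; the second goes into Hölder's inequality with exponents
     q/q1 and q/q2, of sum 1. *)
  have mE m p : 0 < m -> m `^ q = m `^ (q - q / p) * m `^ (q / p).
    by move=> m0; rewrite -powRD ?subrK// (gt_eqF m0) implybT.
  rewrite (mE m1 q1 m10) (mE m2 q2 m20).
  have -> : mass mu W3 Q = (mass mu W3 Q / vol Q) * vol Q by rewrite divfK// gt_eqF.
  have volE : vol Q = vol Q `^ (q / q1) * vol Q `^ (q / q2).
    by rewrite -powRD ?q12 ?powRr1 ?(ltW volQ)// (gt_eqF volQ) implybT.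
  rewrite [X in _ / _ * X]volE.
  have regroup (a b c d e f h k l : R) :
      a * (c * e) * (b * (d * f)) * (h * (k * l)) =
      h * (c * d) * (a * (e * k) * (b * (f * l))) by ring.
  rewrite regroup; apply: ler_wpM2r; last exact: Abound.
  by rewrite !mulr_ge0 ?powR_ge0.
rewrite -mulr_sumr ler_wpM2l ?(ltW A0)//.
have qE : q / q2 = 1 - q / q1 by rewrite -q12 addrC addKr.
have b01 : 0 < q / q1 < 1.
  have : 0 < q / q2 by rewrite divr_gt0.
  by rewrite qE subr_gt0 => ->; rewrite divr_gt0.
have h := holder_sum2 s xpredT f10 f20 b01; rewrite -qE in h.
apply: (le_trans h); have [b0 b1] := andP b01.
have F1 := carleson_embedding wsigma1 lam cubes q11 mg1 g10 g1oo Asigma1 L0 packing.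
have F2 := carleson_embedding wsigma2 lam cubes q21 mg2 g20 g2oo Asigma2 L0 packing.
have S1 : 0 <= \sum_(Q <- s) f1 Q by exact: sumr_ge0.
have S2 : 0 <= \sum_(Q <- s) f2 Q by exact: sumr_ge0.
apply: ler_pM; rewrite ?powR_ge0//.
  by rewrite ge0_ler_powR ?nnegrE ?(ltW b0)//; exact: le_trans F1.
rewrite ge0_ler_powR ?nnegrE//; last exact: le_trans F2.
by rewrite qE subr_ge0 ltW.
Qed.

(** [T] is bounded and vanishes off finitely many cubes. This finiteness justifies the cancellation
    in [convex_absorb]. *)
Lemma sparse_sum_lty t : 0 < t -> (\int[mu]_x (T x `^ t * W3 x)%:E < +oo)%E.
Proof.
move=> t0; pose M := \sum_(Q <- s) coef Q.
have M0 : 0 <= M by apply: sumr_ge0 => Q _; exact: powR_ge0.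
have TM x : T x <= M.
  by rewrite /T /sparse_sum big_mkcond; apply: ler_sum => Q _; case: ifP => // _; exact: powR_ge0.
have := @sum_coef_mass (fun=> M `^ t) (fun=> powR_ge0 _ _) => E.
apply: (@le_lt_trans _ _ _ _ _ _ (ltry (\sum_(Q <- s) M `^ t * mass mu W3 Q))).
rewrite E; apply: ge0_le_integral_pointwise => x.
  by rewrite lee_fin mulr_ge0 ?powR_ge0.
rewrite lee_fin ler_wpM2r//.
have [/hasP[Q Qs xQ]|] := boolP (has (fun Q => x \in Q) s).
  apply: (@le_trans _ _ (M `^ t)); first by rewrite ge0_ler_powR ?nnegrE ?(ltW t0).
  have [us _ _] := lam; rewrite big_mkcond (bigD1_seq Q)//= xQ lerDl.
  by apply: sumr_ge0 => Q' _; case: ifP => // _; exact: powR_ge0.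
rewrite -all_predC => /allP h.
rewrite /T /sparse_sum big1_seq; last by move=> Q /andP[xQ /h]; rewrite /= xQ.
by rewrite powR0 ?gt_eqF//; apply: sumr_ge0 => Q _; exact: powR_ge0.
Qed.

Let a1 := r / q1.
Let a2 := r / q2.
Let a3 := 1 - r / q.

(* Any positive tau for which the three exponents a_i - tau (d_i - a_i) are positive,
   d = (r, r, 1), would do. *)
Definition kolmogorov_shift : R :=
  Num.min ((r / q1) / (r - r / q1))
    (Num.min ((r / q2) / (r - r / q2)) ((1 - r / q) / (r / q))) / 2.

Definition kolmogorov_exponent : R :=
  (r / q1 - kolmogorov_shift * (r - r / q1)) +
  (r / q2 - kolmogorov_shift * (r - r / q2)) +
  (1 - r / q - kolmogorov_shift * (1 - (1 - r / q))).

Let tau := kolmogorov_shift.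
Let beta := kolmogorov_exponent.
(** The exponent conjugate to q/r, that is q / (q - r). *)
Let p3 := 1 / a3.
Let C3 := (2 * (p3 / (p3 - 1))) `^ p3.
Let pairs := (L * K2) `^ a2 * (L * K3) `^ a3 + (L * K1) `^ a1 * (L * K3) `^ a3 +
  (L * K1) `^ a1 * (L * K2) `^ a2.

(** Half of the minimum is strictly below each of the three quotients, whence the positive
    exponents. As [beta] is 1 minus [tau] times the sum of the d_i - a_i, and these are positive, it
    is less than 1. *)
Lemma kolmogorov_exponentP : r < q ->
  [/\ 0 < tau, 0 < a1 - tau * (r - a1), 0 < a2 - tau * (r - a2),
     0 < a3 - tau * (1 - a3) & 0 < beta < 1].
Proof.
move=> rq.
have rq0 : 0 < r / q by rewrite divr_gt0.
have rq1 : r / q < 1 by rewrite ltr_pdivrMr// mul1r.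
have a10 : 0 < a1 by rewrite divr_gt0.
have a20 : 0 < a2 by rewrite divr_gt0.
have a30 : 0 < a3 by rewrite subr_gt0.
have asum : a1 + a2 + a3 = 1.
  have -> : a1 + a2 = r / q by rewrite /a1 /a2 -mulrDr -qq.
  by rewrite /a3 addrC subrK.
have e10 : 0 < r - r / q1 by rewrite subr_gt0 ltr_pdivrMr// ltr_pMr.
have e20 : 0 < r - r / q2 by rewrite subr_gt0 ltr_pdivrMr// ltr_pMr.
have e3E : 1 - a3 = r / q by rewrite /a3 opprB addrC subrK.
have tau0 : 0 < tau.
  by rewrite divr_gt0// !lt_min !divr_gt0// subr_gt0.
have tau2 : tau < Num.min (a1 / (r - r / q1)) (Num.min (a2 / (r - r / q2)) (a3 / (r / q))).
  rewrite /tau /kolmogorov_shift -/a1 -/a2 -/a3; set M := Num.min _ _.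
  have M0 : 0 < M by rewrite !lt_min !divr_gt0.
  by rewrite ltr_pdivrMr// ltr_pMr// ltr1n.
move: tau2; rewrite !lt_min => /and3P[tau_a1 tau_a2 tau_a3].
have b10 : 0 < a1 - tau * (r - a1) by rewrite subr_gt0 -ltr_pdivlMr.
have b20 : 0 < a2 - tau * (r - a2) by rewrite subr_gt0 -ltr_pdivlMr.
have b30 : 0 < a3 - tau * (1 - a3) by rewrite subr_gt0 e3E -ltr_pdivlMr.
have beta0 : 0 < beta by exact: addr_gt0 (addr_gt0 b10 b20) b30.
have beta1 : beta < 1.
  have -> : beta = a1 + a2 + a3 - tau * ((r - a1) + (r - a2) + (1 - a3)).
    by rewrite /beta /kolmogorov_exponent -/a1 -/a2 -/a3 -/tau; ring.
  rewrite asum.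
  have e30 : 0 < 1 - a3 by rewrite e3E.
  rewrite gtrBl mulr_gt0//; exact: addr_gt0 (addr_gt0 e10 e20) e30.
by rewrite beta0.
Qed.

(** Writing T^(q/r) = T h makes [I] the trilinear sum with d = (r, r, 1), whose third average is
    that of [h] with respect to w. As h^p3 = T^(q/r), the Doob bound for [h] is [C3 * I]. *)
Lemma sparse_sum_convex (I := fine (\int[mu]_x (T x `^ (q / r) * W3 x)%:E)) : r < q ->
  I <= 2 * A `^ (r / q) * (L / (1 - beta) * 2 `^ tau * pairs *
    ((C1 * N1) `^ a1 * (C2 * N2) `^ a2 * (C3 * I) `^ a3)).
Proof.
move=> rq.
have rq0 : 0 < r / q by rewrite divr_gt0.
have rq1 : r / q < 1 by rewrite ltr_pdivrMr// mul1r.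
have a10 : 0 < a1 by rewrite divr_gt0.
have a20 : 0 < a2 by rewrite divr_gt0.
have a30 : 0 < a3 by rewrite subr_gt0.
have asum : a1 + a2 + a3 = 1.
  have -> : a1 + a2 = r / q by rewrite /a1 /a2 -mulrDr -qq.
  by rewrite /a3 addrC subrK.
have e3E : 1 - a3 = r / q by rewrite /a3 opprB addrC subrK.
have [tau0 b10 b20 b30 /andP[beta0 beta1]] := kolmogorov_exponentP rq.
have t1 : 1 < q / r by rewrite ltr_pdivlMr// mul1r.
have t0 : 0 < q / r by exact: lt_trans t1.
pose h x := T x `^ (q / r - 1).
have h0 x : 0 <= h x by exact: powR_ge0.
have mh : measurable_fun [set: E] h by exact: (measurableT_comp (measurable_powR _) mT).
have p31 : 1 < p3.
  by rewrite /p3 div1r invf_gt1// /a3 gtrBl.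
have hp x : h x `^ p3 = T x `^ (q / r).
  rewrite /h -powRrM; congr (_ `^ _); rewrite /p3 /a3; field.
  by rewrite subr_eq0 !gt_eqF.
have intE : (\int[mu]_x (h x `^ p3 * W3 x)%:E = \int[mu]_x (T x `^ (q / r) * W3 x)%:E)%E.
  by apply: eq_integral => x _; rewrite hp.
have hoo : (\int[mu]_x (h x `^ p3 * W3 x)%:E < +oo)%E.
  by rewrite intE; exact: sparse_sum_lty.
have hQoo Q : Q \in s -> (\int[mu]_(x in Q) (h x * W3 x)%:E < +oo)%E.
  by move=> /cubes; exact: (integral_weight_lty ww p31 mh h0 hoo).
have Ieq : I = \sum_(Q <- s) coef Q * mass mu (fun x => h x * W3 x) Q.
  have mhW : measurable_fun [set: E] (fun x => h x * W3 x) by exact: measurable_funM.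
  have hW0 x : 0 <= h x * W3 x by rewrite mulr_ge0.
  have coef0 Q : 0 <= coef Q by exact: powR_ge0.
  rewrite /I -intE; have := sum_mass_integral ms coef0 mhW hW0 hQoo.
  move=> /(congr1 fine)/= ->; congr fine; apply: eq_integral => x _; congr (_%:E).
  by rewrite hp -(mulr_powRB1 (T0 x) t0) -mulrA.
set x1 := wavg mu W1 g1; set x2 := wavg mu W2 g2; set x3 := wavg mu W3 h.
have x10 Q : 0 <= x1 Q by exact: wavg_ge0.
have x20 Q : 0 <= x2 Q by exact: wavg_ge0.
have x30 Q : 0 <= x3 Q by exact: wavg_ge0.
have mgt0 Q : Q \in s -> [/\ 0 < mass mu W1 Q, 0 < mass mu W2 Q & 0 < mass mu W3 Q].
  by move=> /cubes cQ; split; exact: mass_pos_part_gt0.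
have dpE p : 0 < p -> r / (r / p) = p by move=> p0; field; rewrite !gt_eqF.
have K0 (sigma : E -> R) : weight sigma -> 0 <= L * fine (Ainfty_const sigma).
  by move=> ws; apply: (mulr_ge0 L0); apply: fine_ge0; exact: Ainfty_const_ge0.
have volpos Q : Q \in s -> 0 < vol Q by move=> /cubes/is_cube_vol[].
have Kolm0 : 0 <= L / (1 - beta) by rewrite divr_ge0// subr_ge0 ltW.
have kolm_weight (sigma : E -> R) Q : weight sigma -> Q \in s ->
    \sum_(Q' <- s | `[< Q' `<=` Q >])
      (mass mu (pos_part sigma) Q' / vol Q') `^ beta * vol Q' <=
    L / (1 - beta) * ((mass mu (pos_part sigma) Q / vol Q) `^ beta * vol Q).
  move=> wsigma Qs; have beta01 : 0 < beta < 1 by rewrite beta0.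
  exact: (kolmogorov_sum (measurable_pos_part wsigma) (pos_part_ge0 sigma) lam ms
    (fun Q' Q's => integral_pos_part_lty wsigma (cubes Q's))
    (fun Q' Q's => mass_pos_part_gt0 wsigma (cubes Q's)) beta01 Qs volpos packing).
have kolm W Q : W \in [:: mass mu W1; mass mu W2; mass mu W3] -> Q \in s ->
    \sum_(Q' <- s | `[< Q' `<=` Q >]) (W Q' / vol Q') `^ beta * vol Q' <=
    L / (1 - beta) * ((W Q / vol Q) `^ beta * vol Q).
  by rewrite !in_cons in_nil orbF => /or3P[] /eqP ->; exact: kolm_weight.
(* The exponents d_i - a_i are r/q times those of the A_P product, which gives the top level
   A^(r/q). *)
have mB Q : Q \in s -> (mass mu W1 Q / vol Q) `^ (r - a1) *
    (mass mu W2 Q / vol Q) `^ (r - a2) * (mass mu W3 Q / vol Q) `^ (1 - a3) <=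
    A `^ (r / q).
  move=> Qs; have [M1 M2 M3] := mgt0 _ Qs; have V := volpos _ Qs.
  have h1 : 0 < mass mu W1 Q / vol Q by rewrite divr_gt0.
  have h2 : 0 < mass mu W2 Q / vol Q by rewrite divr_gt0.
  have h3 : 0 < mass mu W3 Q / vol Q by rewrite divr_gt0.
  have := Abound Qs.
  move: (mass mu W1 Q / vol Q) (mass mu W2 Q / vol Q) (mass mu W3 Q / vol Q) h1 h2 h3.
  move=> m1 m2 m3 m10 m20 m30 hA.
  have m12 : 0 <= m1 `^ (q - q / q1) * m2 `^ (q - q / q2) by rewrite mulr_ge0 ?powR_ge0.
  have e1E p : (q - q / p) * (r / q) = r - r / p.
    rewrite mulrBl mulrCA divff ?gt_eqF// mulr1; congr (_ - _).
    by rewrite mulrAC mulrCA divff ?gt_eqF// mulr1.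
  apply: (@le_trans _ _ ((m3 * (m1 `^ (q - q / q1) * m2 `^ (q - q / q2))) `^ (r / q))).
    rewrite (powRM _ (ltW m30) m12) (powRM _ (powR_ge0 _ _) (powR_ge0 _ _)) -!powRrM !e1E e3E.
    by rewrite mulrC.
  by apply: (ge0_ler_powR (ltW rq0) _ (ltW A0) hA); exact: mulr_ge0 (ltW m30) m12.
have p3E : 1 / a3 = p3 by [].
have doob P : let s' := [seq Q <- s | P Q] in [/\
    \sum_(Q <- s') increment (fun l => maxval x1 l `^ (r / a1)) s' Q * mass mu W1 Q <= C1 * N1,
    \sum_(Q <- s') increment (fun l => maxval x2 l `^ (r / a2)) s' Q * mass mu W2 Q <= C2 * N2 &
    \sum_(Q <- s') increment (fun l => maxval x3 l `^ (1 / a3)) s' Q * mass mu W3 Q <= C3 * I].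
  move=> s'; have lam' : laminar s' by exact: laminar_filter.
  have cubes' Q : Q \in s' -> is_cube Q by rewrite mem_filter => /andP[_ /cubes].
  rewrite /a1 /a2 (dpE _ q1_gt0) (dpE _ q2_gt0); split.
  - exact: (doob_weight wsigma1 lam' cubes' q11 mg1 g10 g1oo).
  - exact: (doob_weight wsigma2 lam' cubes' q21 mg2 g20 g2oo).
  - by rewrite /I -intE; exact: (doob_weight ww lam' cubes' p31 mh h0 hoo).
have := trilinear_estimate x10 x20 x30
  (fun Q => mass_ge0 mu Q W10) (fun Q => mass_ge0 mu Q W20) (fun Q => mass_ge0 mu Q W30)
  a10 a20 a30 asum (K0 sigma1 wsigma1) (K0 sigma2 wsigma2) (K0 w ww)
  r0 r0 ltr01 lam (@vol_ge0 R n) volpos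
  mgt0 tau0 b10 b20 b30 Kolm0 (powR_gt0 (r / q) A0) kolm mB
  (fun Q => Ainfty_carleson wsigma1 Asigma1 lam cubes L0 packing (R0 := Q))
  (fun Q => Ainfty_carleson wsigma2 Asigma2 lam cubes L0 packing (R0 := Q))
  (fun Q => Ainfty_carleson ww Aw lam cubes L0 packing (R0 := Q)) doob.
apply: le_trans; rewrite {1}Ieq big_seq [leRHS]big_seq; apply: ler_sum => Q Qs.
have [M1 M2 M3] := mgt0 _ Qs; have V := volpos _ Qs.
rewrite /coef (u1E Qs) (u2E Qs) -/x1 -/x2 (powRr1 (x30 Q)).
have -> : mass mu (fun x => h x * W3 x) Q = x3 Q * mass mu W3 Q.
  by rewrite /x3 /wavg divfK// gt_eqF.
have -> : mass mu W3 Q = (mass mu W3 Q / vol Q) * vol Q by rewrite divfK// gt_eqF.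
have V' : vol Q != 0 by rewrite gt_eqF.
have m1 : 0 <= mass mu W1 Q / vol Q by rewrite divr_ge0 ?(ltW M1) ?(ltW V).
have m2 : 0 <= mass mu W2 Q / vol Q by rewrite divr_ge0 ?(ltW M2) ?(ltW V).
have m3 : 0 <= mass mu W3 Q / vol Q by rewrite divr_ge0 ?(ltW M3) ?(ltW V).
rewrite (mulfK V') (powRr1 m3).
move: (mass mu W1 Q / vol Q) (mass mu W2 Q / vol Q) (mass mu W3 Q / vol Q) m1 m2 m3.
move: (x1 Q) (x2 Q) (x3 Q) (vol Q) (x10 Q) (x20 Q) => X1 X2 X3 v X10 X20 m1 m2 m3 m10 m20 _.
rewrite (powRM _ (mulr_ge0 X10 m10) (mulr_ge0 X20 m20)) (powRM _ X10 m10) (powRM _ X20 m20).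
by move: (X1 `^ r) (X2 `^ r) (m1 `^ r) (m2 `^ r) => *; rewrite le_eqVlt; apply/orP; left;
  apply/eqP; ring.
Qed.

(** The constants of the two cases, added so that one formula serves both; it depends on the
    exponents and [L] only. *)
Definition sparse_const : R :=
  (L * C1) `^ q1^-1 * (L * C2) `^ q2^-1 +
  (2 * (L / (1 - beta) * 2 `^ tau) * L * (C1 `^ a1 * C2 `^ a2 * C3 `^ a3)) `^ r^-1 * 3 `^ r^-1.

Lemma sparse_sum_bound : 1 <= L ->
  fine (\int[mu]_x (T x `^ (q / r) * W3 x)%:E) `^ q^-1 <= sparse_const *
  (A `^ q^-1 * (K1 `^ q1^-1 * K2 `^ q2^-1 +
     K3 `^ Num.max (r^-1 - q^-1) 0 * (K2 `^ q2^-1 + K1 `^ q1^-1)) *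
   (N1 `^ q1^-1 * N2 `^ q2^-1)).
Proof.
move=> L1; set I := fine _.
have I0 : 0 <= I.
  by apply: fine_ge0; apply: integral_ge0 => x _; rewrite lee_fin mulr_ge0 ?powR_ge0.
have N10 : 0 <= N1.
  by apply: fine_ge0; apply: integral_ge0 => x _; rewrite lee_fin mulr_ge0 ?powR_ge0.
have N20 : 0 <= N2.
  by apply: fine_ge0; apply: integral_ge0 => x _; rewrite lee_fin mulr_ge0 ?powR_ge0.
have K10 : 0 <= K1 by apply: fine_ge0; exact: Ainfty_const_ge0.
have K20 : 0 <= K2 by apply: fine_ge0; exact: Ainfty_const_ge0.
have K30 : 0 <= K3 by apply: fine_ge0; exact: Ainfty_const_ge0.
have C10 : 0 <= C1 by exact: powR_ge0.
have C20 : 0 <= C2 by exact: powR_ge0.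
have C30 : 0 <= C3 by exact: powR_ge0.
have KK0 e : 0 <= K1 `^ q1^-1 * K2 `^ q2^-1 + K3 `^ e * (K2 `^ q2^-1 + K1 `^ q1^-1).
  by rewrite addr_ge0 ?mulr_ge0 ?addr_ge0 ?powR_ge0.
have NN0 : 0 <= N1 `^ q1^-1 * N2 `^ q2^-1 by rewrite mulr_ge0 ?powR_ge0.
have AN0 e : 0 <= A `^ q^-1 *
    (K1 `^ q1^-1 * K2 `^ q2^-1 + K3 `^ e * (K2 `^ q2^-1 + K1 `^ q1^-1)) *
    (N1 `^ q1^-1 * N2 `^ q2^-1).
  by apply: mulr_ge0 NN0; apply: mulr_ge0 (KK0 e); exact: powR_ge0.
rewrite /sparse_const mulrDl; have [qr|rq] := leP q r.
  apply: (@le_trans _ _ ((L * C1) `^ q1^-1 * (L * C2) `^ q2^-1 *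
      (A `^ q^-1 * (K1 `^ q1^-1 * K2 `^ q2^-1) * (N1 `^ q1^-1 * N2 `^ q2^-1)))).
    apply: concave_root => //; first exact: ltW.
    rewrite -lee_fin fineK; first exact: sparse_sum_concave.
    rewrite ge0_fin_numE ?sparse_sum_lty ?divr_gt0//.
    by apply: integral_ge0 => x _; rewrite lee_fin mulr_ge0 ?powR_ge0.
  apply: (@le_trans _ _ ((L * C1) `^ q1^-1 * (L * C2) `^ q2^-1 *
    (A `^ q^-1 * (K1 `^ q1^-1 * K2 `^ q2^-1 +
      K3 `^ Num.max (r^-1 - q^-1) 0 * (K2 `^ q2^-1 + K1 `^ q1^-1)) *
    (N1 `^ q1^-1 * N2 `^ q2^-1)))); last first.
    rewrite lerDl; apply: mulr_ge0 (AN0 _); exact: mulr_ge0 (powR_ge0 _ _) (powR_ge0 _ _).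
  apply: ler_wpM2l; first exact: mulr_ge0 (powR_ge0 _ _) (powR_ge0 _ _).
  apply: ler_wpM2r => //; apply: ler_wpM2l; first exact: powR_ge0.
  by rewrite lerDl mulr_ge0 ?addr_ge0 ?powR_ge0.
have -> : Num.max (r^-1 - q^-1) 0 = r^-1 - q^-1.
  by apply/max_idPl; rewrite subr_ge0 lef_pV2 ?posrE// ltW.
apply: (@le_trans _ _ ((2 * (L / (1 - beta) * 2 `^ tau) * L *
    (C1 `^ a1 * C2 `^ a2 * C3 `^ a3)) `^ r^-1 * 3 `^ r^-1 *
    (A `^ q^-1 * (K1 `^ q1^-1 * K2 `^ q2^-1 +
      K3 `^ (r^-1 - q^-1) * (K2 `^ q2^-1 + K1 `^ q1^-1)) *
    (N1 `^ q1^-1 * N2 `^ q2^-1)))); last first.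
  rewrite lerDr; apply: mulr_ge0 (AN0 _); exact: mulr_ge0 (powR_ge0 _ _) (powR_ge0 _ _).
have [_ _ _ _ /andP[_ beta1]] := kolmogorov_exponentP rq.
apply: convex_absorb => //; first exact: ltW.
  apply: mulr_ge0 (powR_ge0 _ _); rewrite divr_ge0// subr_ge0; exact: ltW.
exact: sparse_sum_convex.
Qed.

End FiniteFamily.

(** * Passage to the limit *)

Section Exhaustion.
Context {R : realType}.

Lemma ler_sum_subset (I : eqType) (s l : seq I) (P : pred I) (a : I -> R) : uniq l -> uniq s ->
  {subset l <= s} -> (forall i, 0 <= a i) ->
  \sum_(i <- l | P i) a i <= \sum_(i <- s | P i) a i.
Proof.
move=> ul us ls a0.
have lE : perm_eq l [seq i <- s | i \in l].
  apply: uniq_perm => //; first exact: filter_uniq.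
  by move=> i; rewrite mem_filter; case: (boolP (i \in l)) => // /ls ->.
rewrite (perm_big _ lE)/= big_filter_cond [leLHS]big_mkcond [leRHS]big_mkcond/=.
by apply: ler_sum => i _; case: (P i); rewrite ?andbF//; case: (i \in l).
Qed.

Context d {T : measurableType d} (mu : {measure set T -> \bar R}).

Lemma countable_exhaustion (S : set (set T)) : countable S ->
  exists s : nat -> seq (set T), [/\ forall k, uniq (s k),
    forall k Q, Q \in s k -> S Q, forall k, {subset s k <= s k.+1} &
    forall l : seq (set T), (forall Q, Q \in l -> S Q) -> exists k, {subset l <= s k}].
Proof.
move=> /countable_injP[f finj].
have /choice[s sP] : forall k, exists l : seq (set T),
    S `&` [set Q | (f Q < k)%N] = [set` l].
  move=> k; apply/finite_seqP.
  (* The value [k] outside [S] keeps the preimage of the integers below [k] inside [S], where [f] is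
     injective. *)
  pose f' Q := if Q \in S then f Q else k.
  have -> : S `&` [set Q | (f Q < k)%N] = f' @^-1` [set i | (i < k)%N].
    apply/seteqP; split => Q /=; rewrite /f'; first by move=> [SQ]; rewrite mem_set.
    by case: ifPn; rewrite ?ltnn// => /set_mem.
  apply: finite_preimage; last exact: finite_II.
  move=> P Q /set_mem/= + /set_mem/=; rewrite /f'.
  case: ifPn => [PS|_]; rewrite ?ltnn// => _.
  by case: ifPn => [QS|_]; rewrite ?ltnn// => _ /finj; apply.
have sE k Q : Q \in undup (s k) <-> S Q /\ (f Q < k)%N.
  by rewrite mem_undup; have /(congr1 (fun A => A Q))/= := sP k; move=> <-.
exists (fun k => undup (s k)); split => [k|k Q /sE[]//|k Q|l lS]; first exact: undup_uniq.
  by move=> /sE[SQ fk]; apply/sE; split => //; exact: ltnW.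
exists (\max_(Q <- l) f Q).+1 => Q Ql; apply/sE; split; first exact: lS.
by rewrite ltnS; exact: leq_bigmax_seq.
Qed.

(** Monotone convergence along an exhaustion of [S] by finite lists. The integrand is only compared
    from above with the limit: a finite limit y bounds all partial sums by (y / W x)^(1/t), hence
    also the full sum. *)
Lemma integral_esum_powR_le (S : set (set T)) (c : set T -> R) (W : T -> R) (t : R)
    (B : \bar R) :
  countable S -> (forall Q, S Q -> measurable Q) -> (forall Q, 0 <= c Q) ->
  measurable_fun [set: T] W -> (forall x, 0 <= W x) -> 0 < t ->
  (forall s, uniq s -> (forall Q, Q \in s -> S Q) ->
    (\int[mu]_x ((\sum_(Q <- s | x \in Q) c Q) `^ t * W x)%:E <= B)%E) ->
  (\int[mu]_x ((\esum_(Q in S) (c Q * \1_Q x)%:E) `^ t * (W x)%:E) <= B)%E.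
Proof.
move=> countS mS c0 mW W0 t0 hB.
have [s [us sS s_incr s_exh]] := countable_exhaustion countS.
pose phi k x := ((\sum_(Q <- s k | x \in Q) c Q) `^ t * W x)%:E.
have sum0 k x : 0 <= \sum_(Q <- s k | x \in Q) c Q by exact: sumr_ge0.
have mphi k : measurable_fun [set: T] (phi k).
  apply/measurable_EFinP; apply: measurable_funM => //.
  apply: (measurableT_comp (measurable_powR t)); apply: measurable_sum_mem => Q /sS.
  exact: mS.
have phi0 k x : [set: T] x -> (0 <= phi k x)%E.
  by move=> _; rewrite lee_fin mulr_ge0 ?powR_ge0.
have phi_incr x : [set: T] x -> {homo phi^~ x : k m / (k <= m)%N >-> (k <= m)%E}.
  move=> _; apply: (@homo_leq _ _ (fun a b : \bar R => is_true (a <= b)%E)) => [y|y z u|k].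
  - exact: lexx.
  - exact: le_trans.
  rewrite lee_fin ler_wpM2r// ge0_ler_powR ?nnegrE ?(ltW t0)//.
  exact: ler_sum_subset.
apply: (@le_trans _ _ (\int[mu]_x limn (phi^~ x))%E); last first.
  have cvg_int := @cvg_monotone_convergence _ _ _ mu _ measurableT _ mphi phi0 phi_incr.
  rewrite -(cvg_lim _ cvg_int)//; apply: lime_le; first by apply/cvg_ex; eexists; exact: cvg_int.
  by apply: nearW => k; apply: hB => [|Q]; [exact: us|exact: sS].
apply: ge0_le_integral_pointwise => x; first by rewrite mule_ge0 ?poweR_ge0// lee_fin.
have := ereal_nondecreasing_cvgn (phi_incr x I) => /cvg_lim -> //.
set M := ereal_sup _.
have phiM k : (phi k x <= M)%E by apply: ereal_sup_ubound; exists k.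
have M0 : (0 <= M)%E by exact: le_trans (phi0 0%N x I) (phiM 0%N).
have esum0 : (0 <= \esum_(Q in S) (c Q * \1_Q x)%:E)%E.
  by apply: esum_ge0 => Q _; rewrite lee_fin mulr_ge0.
(* Where [W] vanishes the product is 0 even if the sum is infinite. *)
have [->|Wx] := eqVneq (W x) 0; first by rewrite mule0.
have {}Wx : 0 < W x by rewrite lt_neqAle eq_sym Wx W0.
move: M M0 phiM => [y y0 phiy|_ _|//]; last by rewrite leey.
rewrite lee_fin in y0.
have yW : 0 <= y / W x by exact: divr_ge0.
have Ty k : \sum_(Q <- s k | x \in Q) c Q <= (y / W x) `^ t^-1.
  have := phiy k; rewrite lee_fin -ler_pdivlMr// => h.
  rewrite -[leLHS](powRr1 (sum0 k x)) -(divff (lt0r_neq0 t0)) powRrM.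
  by rewrite ge0_ler_powR ?nnegrE ?powR_ge0// invr_ge0 ltW.
have esumy : (\esum_(Q in S) (c Q * \1_Q x)%:E <= ((y / W x) `^ t^-1)%:E)%E.
  apply: ge_ereal_sup => _ [X [/finite_seqP[l ->] lS] <-].
  have [|k lk] := s_exh (undup l); first by move=> Q; rewrite mem_undup => /lS.
  have -> : [set` l] = [set` undup l].
    by apply/seteqP; split => Q /=; rewrite mem_undup.
  rewrite -fsbig_seq ?undup_uniq// sumEFin lee_fin; apply: le_trans (Ty k).
  apply: (@le_trans _ _ (\sum_(Q <- undup l | x \in Q) c Q)); last first.
    by apply: ler_sum_subset => //; exact: undup_uniq.
  rewrite [leRHS]big_mkcond/=; apply: ler_sum => Q _.
  by rewrite indicE; case: (x \in Q); rewrite ?mulr1 ?mulr0.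
apply: (@le_trans _ _ ((y / W x)%:E * (W x)%:E)%E); last first.
  by rewrite -EFinM divfK ?gt_eqF.
rewrite lee_wpmul2r ?lee_fin//.
move: esumy esum0; case: (\esum_(Q in S) _)%E => [z|//|//].
rewrite poweR_EFin !lee_fin => zy z0.
rewrite -[leRHS](powRr1 yW) -(mulVf (lt0r_neq0 t0)) powRrM.
by rewrite ge0_ler_powR ?nnegrE ?powR_ge0// ltW.
Qed.

End Exhaustion.

(** * Reduction to p0 = 1 *)

Section Reduction.
Context {R : realType} {n : nat}.
Local Notation E := (Rn R n).
Local Notation mu := (leb n).

Lemma powR_normM_root (p0 a b : R) : 0 < p0 -> 0 <= b ->
  `|a * b `^ p0^-1| `^ p0 = `|a| `^ p0 * b.
Proof.
move=> p00 b0; rewrite normrM (ger0_norm (powR_ge0 _ _)) powRM ?powR_ge0//.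
by rewrite -powRrM mulVf ?gt_eqF// powRr1.
Qed.

Lemma mean_ge0 (W g : E -> R) Q : (forall x, 0 <= W x) -> (forall x, 0 <= g x) ->
  0 <= mean W g Q.
Proof.
move=> W0 g0; apply: divr_ge0 (vol_ge0 Q).
by apply: mass_ge0 => x; exact: mulr_ge0.
Qed.

Lemma wnorm_EFin (p : R) (sigma f : E -> R) : wnorm p sigma (EFin \o f) =
  ((\int[mu]_x (`|f x| `^ p * sigma x)%:E) `^ p^-1)%E.
Proof. by []. Qed.

Lemma wnorm_lty (p : R) (sigma f : E -> R) : 0 < p -> weight sigma ->
  measurable_fun [set: E] f -> (wnorm p sigma (EFin \o f) < +oo)%E ->
  (\int[mu]_x (`|f x| `^ p * pos_part sigma x)%:E < +oo)%E.
Proof.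
move=> p0 ws mf; have mfp : measurable_fun [set: E] (fun x => `|f x| `^ p).
  by apply: (measurableT_comp (measurable_powR p)); exact: measurableT_comp.
have := integral_pos_part ws measurableT mfp => <-.
rewrite (wnorm_EFin p sigma f) !ltey; apply: contra => /eqP ->; rewrite poweRyr// invr_neq0//.
exact: lt0r_neq0.
Qed.

Lemma wnormE (p : R) (sigma f : E -> R) : 0 < p -> weight sigma ->
  measurable_fun [set: E] f -> (wnorm p sigma (EFin \o f) < +oo)%E ->
  wnorm p sigma (EFin \o f) =
  (fine (\int[mu]_x (`|f x| `^ p * pos_part sigma x)%:E) `^ p^-1)%:E.
Proof.
move=> p0 ws mf foo; have Ioo := wnorm_lty p0 ws mf foo.
rewrite -poweR_EFin fineK; last first.
  rewrite ge0_fin_numE//; apply: integral_ge0 => x _.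
  by rewrite lee_fin mulr_ge0 ?powR_ge0 ?pos_part_ge0.
have mfp : measurable_fun [set: E] (fun x => `|f x| `^ p).
  by apply: (measurableT_comp (measurable_powR p)); exact: measurableT_comp.
have := integral_pos_part ws measurableT mfp => <-.
exact: wnorm_EFin.
Qed.

(** Almost everywhere the p0-th power of |f sigma^(1/p0)| is |f|^p0 sigma, which reduces [pavg] to a
    mean of |f|^p0 against the weight. *)
Lemma pavg_mean (p0 : R) (sigma f : E -> R) Q : 0 < p0 -> weight sigma ->
  measurable_fun [set: E] f -> is_cube Q ->
  (\int[mu]_(x in Q) (`|f x| `^ p0 * pos_part sigma x)%:E < +oo)%E ->
  pavg p0 (fun x => f x * sigma x `^ p0^-1)%R Q =
  (mean (pos_part sigma) (fun x => `|f x| `^ p0) Q `^ p0^-1)%:E.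
Proof.
move=> p00 ws mf cQ foo; have [volE vol0] := is_cube_vol cQ.
have mQ := is_cube_measurable cQ; have [ms _ sigma_gt0] := ws.
have mfp : measurable_fun [set: E] (fun x => `|f x| `^ p0).
  by apply: (measurableT_comp (measurable_powR p0)); exact: measurableT_comp.
rewrite /pavg -poweR_EFin; congr (_ `^ _)%E; rewrite /avg volE inver gt_eqF//.
rewrite /mean mulrC EFinM; congr (_ * _)%E; rewrite mass_integral//; last first.
  by move=> x; rewrite mulr_ge0 ?powR_ge0 ?pos_part_ge0.
apply: ae_eq_integral => //.
- apply/measurable_funTS/measurable_EFinP.
  apply: (measurableT_comp (measurable_powR p0)); apply: measurableT_comp => //.
  by apply: measurable_funM => //; exact: (measurableT_comp (measurable_powR _) ms).
- apply/measurable_funTS/measurable_EFinP; apply: measurable_funM => //.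
  exact: measurable_pos_part.
apply: filterS sigma_gt0 => x sx _.
by rewrite powR_normM_root ?(ltW sx)// /pos_part max_l// ltW.
Qed.

(** [F] is arbitrary, so [w] is not replaced by its positive part through almost everywhere equality
    of measurable integrands. Instead the negative part of the integrand is bounded by +oo on the
    null set w < 0, and the positive part is compared pointwise. *)
Lemma wnorm_le (p : R) (w : E -> R) (F : E -> \bar R) (B : \bar R) : 0 < p ->
  weight w -> (0 <= B)%E -> (\int[mu]_x (`|F x| `^ p * (pos_part w x)%:E) <= B)%E ->
  (wnorm p w F <= B `^ p^-1)%E.
Proof.
move=> p0 ww B0 hB; have [mw _ w_gt0] := ww.
pose N := [set x | w x < 0]; pose f x := (`|F x| `^ p * (w x)%:E)%E.
have mN : measurable N.
  have -> : N = w @^-1` `]-oo, 0[%classic by apply/seteqP; split => x /=; rewrite in_itv.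
  by rewrite -[X in measurable X]setTI; apply: mw.
have N0 : mu N = 0%E.
  apply: measure_negligible => //; apply: negligibleS w_gt0 => x /= Nx wx.
  by have := lt_trans Nx wx; rewrite ltxx.
have fneg : (\int[mu]_x f^\- x = 0)%E.
  apply/eqP; rewrite eq_le integral_ge0 ?andbT//.
  apply: (@le_trans _ _ (\int[mu]_(x in N) +oo)%E); last first.
    by rewrite integral_cst// [X in (_ * X)%E]N0 mule0.
  rewrite [leRHS]integral_mkcond; apply: ge0_le_integral_pointwise => x.
    exact: funeneg_ge0.
  rewrite patchE; case: ifPn => [_|]; first by rewrite leey.
  rewrite notin_setE /N/= => /negP; rewrite -leNgt => w0.
  rewrite funenegE ge_max lexx andbT oppe_le0.
  by rewrite mule_ge0 ?poweR_ge0.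
have fE : (\int[mu]_x f x = \int[mu]_x f^\+ x)%E.
  by rewrite integralE fneg sube0.
have f0 : (0 <= \int[mu]_x f x)%E by rewrite fE integral_ge0.
have fB : (\int[mu]_x f x <= B)%E.
  apply: le_trans hB; rewrite fE; apply: ge0_le_integral_pointwise => x.
    exact: funepos_ge0.
  rewrite funeposE ge_max mule_ge0 ?poweR_ge0 ?lee_fin ?pos_part_ge0// andbT.
  by apply: lee_wpmul2l; rewrite ?poweR_ge0// lee_fin /pos_part le_max lexx.
by apply: gt0_ler_poweR; rewrite ?invr_ge0 ?(ltW p0)// in_itv/= ?leey ?andbT.
Qed.

Lemma A_const_exponent (q1 q : R) : 1 < q1 ->
  q / fine (hoelder_conjugate q1%:E) = q - q / q1.
Proof.
move=> q11; have q10 : 0 < q1 by exact: lt_trans q11.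
have q1B : 0 < q1 - 1 by rewrite subr_gt0.
have -> : fine (hoelder_conjugate q1%:E) = q1 / (q1 - 1).
  by rewrite /hoelder_conjugate/= eqe (gt_eqF q10) -EFinB inver (gt_eqF q1B).
by field; rewrite !gt_eqF.
Qed.

End Reduction.

(** * The bound for the sparse operator *)

Section SparseOperator.
Context {R : realType} {n : nat}.
Local Notation E := (Rn R n).
Local Notation mu := (leb n).

(** Testing a unit cube shows that the constant is positive, as the top level of the decomposition
    must be. *)
Lemma A_const_fine (q1 q2 q : R) (w sigma1 sigma2 : E -> R)
    (A := fine (A_const q1 q2 q w sigma1 sigma2)) : 1 < q1 -> 1 < q2 ->
  weight w -> weight sigma1 -> weight sigma2 ->
  (A_const q1 q2 q w sigma1 sigma2 < +oo)%E ->
  [/\ 0 < A, A_const q1 q2 q w sigma1 sigma2 = A%:E & forall Q, is_cube Q ->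
    (mass mu (pos_part w) Q / vol Q) * ((mass mu (pos_part sigma1) Q / vol Q) `^ (q - q / q1) *
      (mass mu (pos_part sigma2) Q / vol Q) `^ (q - q / q2)) <= A].
Proof.
move=> q11 q21 ww ws1 ws2 Aoo.
pose a Q := (mass mu (pos_part w) Q / vol Q) *
  ((mass mu (pos_part sigma1) Q / vol Q) `^ (q - q / q1) *
   (mass mu (pos_part sigma2) Q / vol Q) `^ (q - q / q2)).
have aA Q : is_cube Q -> ((a Q)%:E <= A_const q1 q2 q w sigma1 sigma2)%E.
  move=> cQ; apply: ereal_sup_ubound; exists Q => //.
  by rewrite !avg_weight// !A_const_exponent// !poweR_EFin -!EFinM.
have a_gt0 Q : is_cube Q -> 0 < a Q.
  move=> cQ; have [_ v0] := is_cube_vol cQ.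
  have m0 := mass_pos_part_gt0 ww cQ; have m1 := mass_pos_part_gt0 ws1 cQ.
  have m2 := mass_pos_part_gt0 ws2 cQ.
  have h0 := divr_gt0 m0 v0; have h1 := divr_gt0 m1 v0; have h2 := divr_gt0 m2 v0.
  by apply: (mulr_gt0 h0); apply: mulr_gt0; exact: powR_gt0.
pose Q0 : set E := cube [tuple 0 | i < n] 1.
have cQ0 : is_cube Q0 by exists 1 => //; exists [tuple 0 | i < n].
have A_gt0 : (0 < A_const q1 q2 q w sigma1 sigma2)%E.
  by apply: lt_le_trans (aA _ cQ0); rewrite lte_fin a_gt0.
have AE : A_const q1 q2 q w sigma1 sigma2 = A%:E.
  by rewrite /A fineK// gt0_fin_numE.
split=> [|//|Q cQ]; first by rewrite -lte_fin -AE.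
by rewrite -lee_fin -AE aA.
Qed.

Lemma sparse_const_ge0 (q1 q2 q r L : R) : 0 <= sparse_const q1 q2 q r L.
Proof.
by apply: addr_ge0; apply: mulr_ge0; exact: powR_ge0.
Qed.

(** With e = 1/p0 <= 1 the power is subadditive, so the p0-th root enters the sums of the bracket
    without a new constant. *)
Lemma powR_bound_root (e c A K1 K2 K3 N1 N2 a b1 b2 m : R) : 0 < e <= 1 -> 0 <= c ->
  (c * (A `^ a * (K1 `^ b1 * K2 `^ b2 + K3 `^ m * (K2 `^ b2 + K1 `^ b1)) *
    (N1 `^ b1 * N2 `^ b2))) `^ e <=
  c `^ e * (A `^ (a * e) * (K1 `^ (b1 * e) * K2 `^ (b2 * e) +
    K3 `^ (m * e) * (K2 `^ (b2 * e) + K1 `^ (b1 * e)))) *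
    (N1 `^ (b1 * e) * N2 `^ (b2 * e)).
Proof.
move=> e01 c0; rewrite !powRrM.
move: (A `^ a) (K1 `^ b1) (K2 `^ b2) (K3 `^ m) (N1 `^ b1) (N2 `^ b2) (powR_ge0 A a)
  (powR_ge0 K1 b1) (powR_ge0 K2 b2) (powR_ge0 K3 m) (powR_ge0 N1 b1) (powR_ge0 N2 b2).
move=> x k1 k2 k3 n1 n2 x0 k10 k20 k30 n10 n20.
have kk0 := mulr_ge0 k10 k20; have k21 := addr_ge0 k20 k10.
have y0 : 0 <= k1 * k2 + k3 * (k2 + k1) by exact: addr_ge0 kk0 (mulr_ge0 k30 k21).
have nn0 := mulr_ge0 n10 n20; have xy0 := mulr_ge0 x0 y0.
rewrite (powRM _ c0 (mulr_ge0 xy0 nn0)) (powRM _ xy0 nn0) (powRM _ x0 y0) (powRM _ n10 n20).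
rewrite mulrA; apply: ler_wpM2r; first exact: mulr_ge0 (powR_ge0 _ _) (powR_ge0 _ _).
apply: ler_wpM2l; first exact: powR_ge0.
apply: ler_wpM2l; first exact: powR_ge0.
apply: (le_trans (powR_addr_le e01 kk0 (mulr_ge0 k30 k21))).
rewrite (powRM _ k10 k20) (powRM _ k30 k21) lerD2l.
by apply: ler_wpM2l (powR_addr_le e01 k20 k10); exact: powR_ge0.
Qed.

Lemma two_weight_op_bound (gamma p0 p1 p2 p delta : R) (D S : set (set E))
    (w sigma1 sigma2 f1 f2 : E -> R)
    (A := fine (A_const (p1 / p0) (p2 / p0) (p / p0) w sigma1 sigma2))
    (K1 := fine (Ainfty_const sigma1)) (K2 := fine (Ainfty_const sigma2))
    (K3 := fine (Ainfty_const w)) :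
  (0 < n)%N -> 0 < gamma -> 1 <= p0 -> p0 < p1 -> p0 < p2 -> p^-1 = p1^-1 + p2^-1 ->
  dyadic_grid D -> S `<=` D -> sparse delta S ->
  weight w -> weight sigma1 -> weight sigma2 ->
  (A_const (p1 / p0) (p2 / p0) (p / p0) w sigma1 sigma2 < +oo)%E ->
  (Ainfty_const w < +oo)%E -> (Ainfty_const sigma1 < +oo)%E ->
  (Ainfty_const sigma2 < +oo)%E ->
  measurable_fun [set: E] f1 -> measurable_fun [set: E] f2 ->
  (wnorm p1 sigma1 (EFin \o f1) < +oo)%E -> (wnorm p2 sigma2 (EFin \o f2) < +oo)%E ->
  (wnorm p w (two_weight_op p0 gamma S sigma1 sigma2 f1 f2) <=
   (sparse_const (p1 / p0) (p2 / p0) (p / p0) (gamma / p0) (1 - delta)^-1 `^ p0^-1 *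
     (A `^ p^-1 * (K1 `^ p1^-1 * K2 `^ p2^-1 +
       K3 `^ Num.max (gamma^-1 - p^-1) 0 * (K2 `^ p2^-1 + K1 `^ p1^-1))))%:E *
   (wnorm p1 sigma1 (EFin \o f1) * wnorm p2 sigma2 (EFin \o f2)))%E.
Proof.
move=> n0 gamma0 p01 p01lt p02lt hp gridD SD spS ww ws1 ws2 Aoo Kw Ks1 Ks2 mf1 mf2 f1oo f2oo.
have p00 : 0 < p0 by exact: lt_le_trans p01.
have p10 : 0 < p1 by exact: lt_trans p01lt.
have p20 : 0 < p2 by exact: lt_trans p02lt.
have p_gt0 : 0 < p by rewrite -invr_gt0 hp addr_gt0// invr_gt0.
have q11 : 1 < p1 / p0 by rewrite ltr_pdivlMr// mul1r.
have q21 : 1 < p2 / p0 by rewrite ltr_pdivlMr// mul1r.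
have q0 : 0 < p / p0 by rewrite divr_gt0.
have r0 : 0 < gamma / p0 by rewrite divr_gt0.
have invE (a : R) : (a / p0)^-1 = p0 * a^-1 by rewrite invf_div.
have invEr (a : R) : (a / p0)^-1 * p0^-1 = a^-1.
  by rewrite invE mulrAC divff ?mul1r// gt_eqF.
have qq : (p / p0)^-1 = (p1 / p0)^-1 + (p2 / p0)^-1 by rewrite !invE -mulrDr hp.
have qr : p / p0 / (gamma / p0) = gamma^-1 * p by field; rewrite !gt_eqF.
pose g1 x := `|f1 x| `^ p0; pose g2 x := `|f2 x| `^ p0.
have mg1 : measurable_fun [set: E] g1.
  by apply: (measurableT_comp (measurable_powR p0)); exact: measurableT_comp.
have mg2 : measurable_fun [set: E] g2.
  by apply: (measurableT_comp (measurable_powR p0)); exact: measurableT_comp.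
have g10 x : 0 <= g1 x by exact: powR_ge0.
have g20 x : 0 <= g2 x by exact: powR_ge0.
have gE (f sigma : E -> R) a :
    (\int[mu]_x ((`|f x| `^ p0) `^ (a / p0) * pos_part sigma x)%:E =
     \int[mu]_x (`|f x| `^ a * pos_part sigma x)%:E)%E.
  by apply: eq_integral => x _; rewrite -powRrM mulrCA divff ?mulr1// gt_eqF.
have g1E : (\int[mu]_x (g1 x `^ (p1 / p0) * pos_part sigma1 x)%:E =
    \int[mu]_x (`|f1 x| `^ p1 * pos_part sigma1 x)%:E)%E by exact: gE.
have g2E : (\int[mu]_x (g2 x `^ (p2 / p0) * pos_part sigma2 x)%:E =
    \int[mu]_x (`|f2 x| `^ p2 * pos_part sigma2 x)%:E)%E by exact: gE.
have g1oo : (\int[mu]_x (g1 x `^ (p1 / p0) * pos_part sigma1 x)%:E < +oo)%E.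
  by rewrite g1E; exact: (wnorm_lty p10 ws1 mf1 f1oo).
have g2oo : (\int[mu]_x (g2 x `^ (p2 / p0) * pos_part sigma2 x)%:E < +oo)%E.
  by rewrite g2E; exact: (wnorm_lty p20 ws2 mf2 f2oo).
pose N1 := fine (\int[mu]_x (g1 x `^ (p1 / p0) * pos_part sigma1 x)%:E).
pose N2 := fine (\int[mu]_x (g2 x `^ (p2 / p0) * pos_part sigma2 x)%:E).
have N1E : wnorm p1 sigma1 (EFin \o f1) = (N1 `^ p1^-1)%:E.
  by rewrite (wnormE p10 ws1 mf1 f1oo) -g1E; reflexivity.
have N2E : wnorm p2 sigma2 (EFin \o f2) = (N2 `^ p2^-1)%:E.
  by rewrite (wnormE p20 ws2 mf2 f2oo) -g2E; reflexivity.
have [A0 _ Abound] := A_const_fine q11 q21 ww ws1 ws2 Aoo.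
have [/andP[delta0 delta1] _] := spS.
have dB : 0 < 1 - delta by rewrite subr_gt0.
have L1 : 1 <= (1 - delta)^-1 by rewrite (invf_ge1 dB) gerBl; exact: ltW.
have L0 : 0 <= (1 - delta)^-1 by exact: le_trans ler01 L1.
have cubeS Q : S Q -> is_cube Q by move=> /SD/(dyadic_is_cube gridD).
pose coef Q := (mean (pos_part sigma1) g1 Q * mean (pos_part sigma2) g2 Q) `^ (gamma / p0).
pose X := sparse_const (p1 / p0) (p2 / p0) (p / p0) (gamma / p0) (1 - delta)^-1 *
  (A `^ (p / p0)^-1 * (K1 `^ (p1 / p0)^-1 * K2 `^ (p2 / p0)^-1 +
    K3 `^ Num.max ((gamma / p0)^-1 - (p / p0)^-1) 0 *
      (K2 `^ (p2 / p0)^-1 + K1 `^ (p1 / p0)^-1)) *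
   (N1 `^ (p1 / p0)^-1 * N2 `^ (p2 / p0)^-1)).
(* The bound does not depend on the finite list [s], so it survives the limit. *)
have finite_bound s : uniq s -> (forall Q, Q \in s -> S Q) ->
    (\int[mu]_x ((\sum_(Q <- s | x \in Q) coef Q) `^ (p / p0 / (gamma / p0)) *
      pos_part w x)%:E <= (X `^ (p / p0))%:E)%E.
  move=> us sS.
  have lam : laminar s by apply: (dyadic_laminar gridD us) => Q /sS/SD.
  have cubes Q : Q \in s -> is_cube Q by move=> /sS/cubeS.
  have packing Q : Q \in s ->
      \sum_(Q' <- s | `[< Q' `<=` Q >]) vol Q' <= (1 - delta)^-1 * vol Q.
    by move=> /sS SQ; exact: (sparse_packing n0 gridD SD spS us sS SQ).
  have h : fine (\int[mu]_x (sparse_sum sigma1 sigma2 s g1 g2 (gamma / p0) x `^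
      (p / p0 / (gamma / p0)) * pos_part w x)%:E) `^ (p / p0)^-1 <= X.
    exact: (sparse_sum_bound ww ws1 ws2 Kw Ks1 Ks2 lam cubes L0 packing q11 q21 qq r0
      mg1 mg2 g10 g20 g1oo g2oo A0 (fun Q Qs => Abound Q (cubes Q Qs)) L1).
  move: h; set I := fine _ => h.
  have IE : I%:E = (\int[mu]_x (sparse_sum sigma1 sigma2 s g1 g2 (gamma / p0) x `^
      (p / p0 / (gamma / p0)) * pos_part w x)%:E)%E.
    apply: fineK; rewrite ge0_fin_numE.
      exact: (sparse_sum_lty sigma1 sigma2 g1 g2 _ ww lam cubes (divr_gt0 q0 r0)).
    by apply: integral_ge0 => x _; rewrite lee_fin mulr_ge0 ?powR_ge0 ?pos_part_ge0.
  apply: (@le_trans _ _ I%:E); first by rewrite IE.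
  have I0 : 0 <= I.
    apply: fine_ge0; apply: integral_ge0 => x _.
    by rewrite lee_fin mulr_ge0 ?powR_ge0 ?pos_part_ge0.
  rewrite lee_fin -[leLHS](powRr1 I0) -(mulVf (lt0r_neq0 q0)) (powRrM I).
  apply: (ge0_ler_powR (ltW q0) (powR_ge0 _ _) _ h).
  exact: le_trans (powR_ge0 _ _) h.
have sparse_opE x : (`|two_weight_op p0 gamma S sigma1 sigma2 f1 f2 x| `^ p =
    (\esum_(Q in S) (coef Q * \1_Q x)%:E) `^ (p / p0 / (gamma / p0)))%E.
  rewrite /two_weight_op /sparse_op (gee0_abs (poweR_ge0 _ _)) -poweRrM qr.
  congr (_ `^ _)%E; apply: eq_esum => Q /cubeS cQ.
  have fQ1 := integral_weight_lty ws1 q11 mg1 g10 g1oo cQ.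
  have fQ2 := integral_weight_lty ws2 q21 mg2 g20 g2oo cQ.
  rewrite (pavg_mean p00 ws1 mf1 cQ fQ1) (pavg_mean p00 ws2 mf2 cQ fQ2).
  have mulE (a b e : R) : ((a%:E * b%:E) `^ gamma * e%:E)%E = ((a * b) `^ gamma * e)%:E.
    by [].
  have m1 := mean_ge0 Q (pos_part_ge0 sigma1) g10.
  have m2 := mean_ge0 Q (pos_part_ge0 sigma2) g20.
  by rewrite mulE -(powRM _ m1 m2) -powRrM (mulrC p0^-1).
have key : (wnorm p w (two_weight_op p0 gamma S sigma1 sigma2 f1 f2) <=
    (X `^ (p / p0))%:E `^ p^-1)%E.
  apply: (wnorm_le p_gt0 ww); first by rewrite lee_fin powR_ge0.
  under eq_integral do rewrite sparse_opE.
  apply: integral_esum_powR_le finite_bound.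
  - exact: sub_countable (subset_card_le SD) (dyadic_countable gridD).
  - by move=> Q /cubeS/is_cube_measurable.
  - by move=> Q; exact: powR_ge0.
  - exact: measurable_pos_part.
  - exact: pos_part_ge0.
  - exact: divr_gt0.
apply: (le_trans key); rewrite N1E N2E poweR_EFin -!EFinM lee_fin.
rewrite -(powRrM X) (_ : p / p0 * p^-1 = p0^-1); last by rewrite mulrAC divff ?mul1r ?gt_eqF.
have e01 : 0 < p0^-1 <= 1 by rewrite invr_gt0 p00 (invf_le1 p00).
apply: (le_trans (powR_bound_root A K1 K2 K3 N1 N2 _ _ _ _ e01 (sparse_const_ge0 _ _ _ _ _))).
have maxE : Num.max ((gamma / p0)^-1 - (p / p0)^-1) 0 * p0^-1 =
    Num.max (gamma^-1 - p^-1) 0.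
  by have [e0 _] := andP e01; rewrite (maxr_pMl _ _ (ltW e0)) mul0r mulrBl !invEr.
by rewrite maxE !invEr.
Qed.

End SparseOperator.

Local Open Scope ereal_scope.

Theorem theorem4p1 (R : realType) (n : nat) (gamma p0 p1 p2 p delta : R)
    (hn : (0 < n)%N)
    (hgamma : (0 < gamma)%R) (hp0 : (1 <= p0)%R)
    (hp1 : (p0 < p1)%R) (hp2 : (p0 < p2)%R)
    (hp : (p^-1 = p1^-1 + p2^-1)%R)
    (hcase : (p0 <= gamma)%R \/ ((gamma < p0)%R /\ (gamma < p)%R)) :
  exists C : R, (0 < C)%R /\
  forall (D S : set (set (Rn R n))) (w sigma1 sigma2 : Rn R n -> R),
    dyadic_grid D -> S `<=` D -> sparse delta S ->
    weight w -> weight sigma1 -> weight sigma2 ->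
    A_const (p1 / p0) (p2 / p0) (p / p0) w sigma1 sigma2 < +oo ->
    Ainfty_const w < +oo -> Ainfty_const sigma1 < +oo ->
    Ainfty_const sigma2 < +oo ->
    opnorm p1 p2 p sigma1 sigma2 w (two_weight_op p0 gamma S sigma1 sigma2) <=
    C%:E * (A_const (p1 / p0) (p2 / p0) (p / p0) w sigma1 sigma2 `^ p^-1 *
      (Ainfty_const sigma1 `^ p1^-1 * Ainfty_const sigma2 `^ p2^-1 +
       Ainfty_const w `^ (Num.max (gamma^-1 - p^-1) 0)%R *
         (Ainfty_const sigma2 `^ p2^-1 + Ainfty_const sigma1 `^ p1^-1))).
Proof.
pose K := sparse_const (p1 / p0) (p2 / p0) (p / p0) (gamma / p0) (1 - delta)^-1.
have K0 : (0 <= K)%R by exact: sparse_const_ge0.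
(* [K] involves only [delta] and the exponents, so it precedes the grid and the weights; it is known
   to be nonnegative, and adding 1 makes the constant positive. *)
exists ((1 + K) `^ p0^-1)%R; split; first by rewrite powR_gt0// ltr_wpDr.
move=> D S w sigma1 sigma2 gridD SD spS ww ws1 ws2 Aoo Kw Ks1 Ks2.
have p00 : (0 < p0)%R by exact: lt_le_trans hp0.
have q11 : (1 < p1 / p0)%R by rewrite ltr_pdivlMr// mul1r.
have q21 : (1 < p2 / p0)%R by rewrite ltr_pdivlMr// mul1r.
have [_ AE _] := A_const_fine q11 q21 ww ws1 ws2 Aoo.
have KE (sigma : Rn R n -> R) : weight sigma -> Ainfty_const sigma < +oo ->
    Ainfty_const sigma = (fine (Ainfty_const sigma))%:E.
  by move=> ws oo; rewrite fineK// ge0_fin_numE//; exact: Ainfty_const_ge0.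
rewrite AE (KE _ ww Kw) (KE _ ws1 Ks1) (KE _ ws2 Ks2).
pose A := fine (A_const (p1 / p0) (p2 / p0) (p / p0) w sigma1 sigma2).
pose K1 := fine (Ainfty_const sigma1); pose K2 := fine (Ainfty_const sigma2).
pose K3 := fine (Ainfty_const w).
pose M := (A `^ p^-1 * (K1 `^ p1^-1 * K2 `^ p2^-1 +
  K3 `^ Num.max (gamma^-1 - p^-1) 0 * (K2 `^ p2^-1 + K1 `^ p1^-1)))%R.
have M0 : (0 <= M)%R.
  by apply: mulr_ge0 (powR_ge0 _ _) _; apply: addr_ge0; apply: mulr_ge0;
    rewrite ?addr_ge0 ?powR_ge0.
apply: ereal_inf_lbound; exists ((1 + K) `^ p0^-1 * M)%R => //; split.
  exact: mulr_ge0 (powR_ge0 _ _) M0.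
move=> f1 f2 mf1 mf2 f1oo f2oo.
have h := two_weight_op_bound hn hgamma hp0 hp1 hp2 hp gridD SD spS ww ws1 ws2
  Aoo Kw Ks1 Ks2 mf1 mf2 f1oo f2oo.
apply: (@le_trans _ _ ((K `^ p0^-1 * M)%:E *
  (wnorm p1 sigma1 (EFin \o f1) * wnorm p2 sigma2 (EFin \o f2)))); first exact: h.
apply: lee_wpmul2r; first exact: mule_ge0 (poweR_ge0 _ _) (poweR_ge0 _ _).
rewrite lee_fin; apply: ler_wpM2r => //.
apply: ge0_ler_powR; rewrite ?nnegrE ?invr_ge0 ?(ltW p00)//.
  exact: addr_ge0 ler01 K0.
by rewrite lerDr.
Qed.
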